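(* Let $s:\mathbb{Z}\to\mathbb{R}$ be a correlation function with $s(0)=1$, and let $X_{ij}$ ($i,j\ge 1$) be the associated row-independent Gaussian array, i.e. jointly Gaussian centered variables with $\mathbb{E}[X_{ij}X_{i'j'}]=\mathbf{1}_{\{i=i'\}}s(j-j')$. For $n,d\ge1$ let $\mathcal{X}_{n,d}^{(s)}=(X_{ij})_{1\le i\le n,1\le j\le d}$ and $$\mathcal{W}_{n,d}^{(s)}=(W_{ij})_{1\leq i,j\leq n}=\sqrt{d}\left(\frac1d\mathcal{X}_{n,d}^{(s)}(\mathcal{X}_{n,d}^{(s)})^T-\mathcal{I}_n\right).$$ Let $\mathcal{G}^{(s)}_{n,d}=(G_{ij})_{1\leq i,j\leq n}$ be an $n\times n$ symmetric random matrix such that the random vector $(G_{11},\ldots,G_{1n},G_{21},\ldots,G_{2n},\ldots,G_{n1},\ldots,G_{nn})^T$ of $\mathbb{R}^{n^2}$ is (centered) Gaussian with the same covariance matrix as $(W_{11},\ldots,W_{1n},W_{21},\ldots,W_{2n},\ldots,W_{n1},\ldots,W_{nn})^T$. Then, for any $n,d\geq 1$, $$d_{\rm Wass}\big(\mathcal{W}_{n,d}^{(s)},\mathcal{G}_{n,d}^{(s)}\big)\leq\sqrt{\frac{192\,n^3}{\sum_{|k|\leq d}(1-\frac{|k|}{d})s(k)^2}\times\frac1d\left(\sum_{|k|\leq d}|s(k)|^{4/3}\right)^{3}}\leq\sqrt{\frac{192\,n^3}{d}\left(\sum_{|k|\leq d}|s(k)|^{4/3}\right)^{3}}.$$ Moreover,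 if $s\in\ell^2(\mathbb{Z})$ and if $\mathcal{Z}^{(s)}_{n}=(Z_{ij})_{1\leq i,j\leq n}$ denotes an $n\times n$ symmetric random matrix such that $Z_{ii}\sim N(0,2\|s\|^2_{\ell^2(\mathbb{Z})})$, $Z_{ij}\sim N(0,\|s\|^2_{\ell^2(\mathbb{Z})})$ for $i<j$, $Z_{ij}=Z_{ji}$ for $i>j$, and $\{Z_{ij},1\leq i\leq j\leq n\}$ are independent, then $$d_{\rm Wass}\big(\mathcal{G}_{n,d}^{(s)},\mathcal{Z}_{n}^{(s)}\big)\leq\frac{2\sqrt{n(n+1)}}{\|s\|_{\ell^2(\mathbb{Z})}}\left(\sum_{|k|>d}s(k)^2+\frac1d\sum_{|k|\leq d}|k|s(k)^2\right).$$
   Context: Here $k$ ranges over $\mathbb{Z}$ in all sums. A correlation function $s:\mathbb{Z}\to\mathbb{R}$ is one for which there is a real separable Hilbert space $\mathfrak{H}$ and a family $\{e_{ij}:i,j\ge1\}\subset\mathfrak{H}$ with $\langle e_{ij},e_{i'j'}\rangle_{\mathfrak{H}}=\mathbf{1}_{\{i=i'\}}s(j-j')$; the array is $X_{ij}=X(e_{ij})$, where $X=\{X(h):h\in\mathfrak{H}\}$ is an isonormal Gaussian process (centered Gaussian with $\mathbb{E}[X(g)X(h)]=\langle g,h\rangle_{\mathfrak{H}}$). $\mathcal{I}_n$ is the $n\times n$ identity matrix. For random matrices $\mathcal{X},\mathcal{Y}$ with values in the space $\mathcal{M}_n(\mathbb{R})$ of $n\times n$ real matrices, the Wasserstein distance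 is $$d_{\rm Wass}(\mathcal{X},\mathcal{Y})=\sup\{\mathbb{E}[g(\mathcal{X})]-\mathbb{E}[g(\mathcal{Y})]:\ g:\mathcal{M}_n(\mathbb{R})\to\mathbb{R},\ \|g\|_{\rm Lip}\le1\},$$ where $\|g\|_{\rm Lip}=\sup_{A\ne B}|g(A)-g(B)|/\|A-B\|_{\rm HS}$ and $\|\cdot\|_{\rm HS}$ is the Hilbert–Schmidt norm. *)

(* Defs.v *)
From HB Require Import structures.
From mathcomp Require Import all_boot all_order all_algebra.
From mathcomp Require Import sesquilinear.
From mathcomp Require Import all_classical all_reals all_analysis.

Set Implicit Arguments.
Unset Strict Implicit.
Unset Printing Implicit Defensive.

Import Order.TTheory GRing.Theory Num.Theory.
Import numFieldNormedType.Exports.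

Local Open Scope classical_set_scope.
Local Open Scope ring_scope.

(* Indices start at 0 instead of 1 throughout; only differences of column
   indices and equality of row indices matter. *)

Definition separable_space (T : topologicalType) : Prop :=
  exists2 A : set T, countable A & dense A.

(* A real Hilbert space is a complete normed module over R whose norm comes
   from the inner product [ip]. *)
Definition correlation_function (R : realType) (s : int -> R) : Prop :=
  exists (H : completeNormedModType R) (ip : {dot H for idfun})
         (e : nat -> nat -> H),
    [/\ forall x : H, `|x| ^+ 2 = ip x x,
        separable_space H &
        forall i j i' j' : nat,
          ip (e i j) (e i' j') = (i == i')%:R * s (j%:Z - j'%:Z)].

(* N(m, v), with v the variance. The library's [normal_prob m 0] is the uniform
   law on [0, 1], so the degenerate case has to be the Dirac mass at m. *)
Definition normal_law (R : realType) (m v : R) : set R -> \bar R :=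
  if v == 0 then dirac m else normal_prob m (Num.sqrt v).

Definition has_normal_law (dT : measure_display) (T : measurableType dT)
    (R : realType) (P : probability T R) (Y : T -> R) (m v : R) : Prop :=
  forall A : set R, measurable A -> P (Y @^-1` A) = normal_law m v A.

Definition jointly_gaussian (dT : measure_display) (T : measurableType dT)
    (R : realType) (P : probability T R) (I : Type) (Y : I -> {RV P >-> R}) :
    Prop :=
  forall (m : nat) (f : 'I_m -> I) (c : 'I_m -> R),
    exists mu v : R, 0 <= v /\
      has_normal_law P (fun t => \sum_(k < m) c k * Y (f k) t) mu v.
Arguments jointly_gaussian {dT T R} P {I} Y.

Definition centered (dT : measure_display) (T : measurableType dT)
    (R : realType) (P : probability T R) (I : Type) (Y : I -> {RV P >-> R}) :
    Prop :=
  forall i : I, ('E_P[Y i] = 0)%E.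
Arguments centered {dT T R} P {I} Y.

Definition mutually_independent (dT : measure_display) (T : measurableType dT)
    (R : realType) (P : probability T R) (I : eqType) (D : set I)
    (Y : I -> {RV P >-> R}) : Prop :=
  forall (J : seq I) (B : I -> set R),
    uniq J -> (forall i, i \in J -> D i) ->
    (forall i, i \in J -> measurable (B i)) ->
    P [set t | forall i, i \in J -> B i (Y i t)] =
      (\prod_(i <- J) P (Y i @^-1` B i))%E.
Arguments mutually_independent {dT T R} P {I} D Y.

Definition gaussian_array (dT : measure_display) (T : measurableType dT)
    (R : realType) (P : probability T R) (s : int -> R)
    (X : nat -> nat -> {RV P >-> R}) : Prop :=
  [/\ jointly_gaussian P (fun ij : nat * nat => X ij.1 ij.2),
      centered P (fun ij : nat * nat => X ij.1 ij.2) &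
      forall i j i' j' : nat,
        'E_P[fun t => (X i j t * X i' j' t)%R]%E =
          ((i == i')%:R * s (j%:Z - j'%:Z))%:E].
Arguments gaussian_array {dT T R} P s X.

Definition data_matrix (dT : measure_display) (T : measurableType dT)
    (R : realType) (P : probability T R) (X : nat -> nat -> {RV P >-> R})
    (n d : nat) (t : T) : 'M[R]_(n, d) :=
  \matrix_(i < n, j < d) X i j t.

Definition wishart (dT : measure_display) (T : measurableType dT)
    (R : realType) (P : probability T R) (X : nat -> nat -> {RV P >-> R})
    (n d : nat) (t : T) : 'M[R]_n :=
  Num.sqrt d%:R *:
    (d%:R^-1 *: (data_matrix X n d t *m (data_matrix X n d t)^T) - 1%:M).

Definition realization (dT : measure_display) (T : measurableType dT)
    (R : realType) (P : probability T R) (n : nat) (M : 'M[{RV P >-> R}]_n)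
    (t : T) : 'M[R]_n :=
  \matrix_(i < n, j < n) M i j t.

Definition hs_norm (R : realType) (n : nat) (A : 'M[R]_n) : R :=
  Num.sqrt (\sum_(i < n) \sum_(j < n) A i j ^+ 2).

Definition lip_norm (R : realType) (n : nat) (g : 'M[R]_n -> R) : \bar R :=
  ereal_sup [set (`|g AB.1 - g AB.2| / hs_norm (AB.1 - AB.2))%:E
            | AB in [set AB : 'M[R]_n * 'M[R]_n | AB.1 != AB.2]].

Definition d_Wass (dT dU : measure_display) (T : measurableType dT)
    (U : measurableType dU) (R : realType) (P : probability T R)
    (Q : probability U R) (n : nat) (M : T -> 'M[R]_n) (N : U -> 'M[R]_n) :
    \bar R :=
  ereal_sup [set ('E_P[g \o M] - 'E_Q[g \o N])%E
            | g in [set g : 'M[R]_n -> R | (lip_norm g <= 1)%E]].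

Definition ell2 (R : realType) (s : int -> R) : Prop :=
  summable [set: int] (fun k => (s k ^+ 2)%:E).

(* Meaningful only when [ell2 s] holds, because of [fine]. *)
Definition ell2_norm (R : realType) (s : int -> R) : R :=
  Num.sqrt (fine (\esum_(k in [set: int]) (s k ^+ 2)%:E)).

Definition int_le (d : nat) : set int := [set k : int | `|k| <= d%:Z].
Definition int_gt (d : nat) : set int := [set k : int | d%:Z < `|k|].

(* Main.v *)
(* Stein's method along a rotation, on trigonometric polynomials.  The vector W
   of entries of the Wishart matrix is quadratic in a Gaussian array, which
   yields E[<x,W> sin(<x,W> + phi)] = E[<tau x,x> cos(<x,W> + phi)] for an
   explicit random matrix tau whose mean is the covariance C of W.  If S is an
   independent Gaussian vector with covariance C, then for a trigonometric
   polynomial f the derivative in theta of E f(cos theta W + sin theta S) is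
   - sin theta cos theta times E of the contraction of C - tau with the Hessian
   of f.  When f is close to a 1-Lipschitz function, smoothing by sin theta S
   bounds this contraction by a multiple of |C - tau|_HS / sin theta; only directions fixed by
   C up to a factor kappa occur, because C and tau have their rows in that
   eigenspace, so the degeneracy of C (symmetric matrices) is harmless.
   Integrating in theta gives
     |E g(W) - E g(S)| <= sqrt(2 / kappa) E |C - tau|_HS
   for every 1-Lipschitz g.  The variance of tau is a fourfold sum of values of
   s, controlled by Young's inequality.  A constant tau compares two Gaussian
   vectors and gives the second estimate. *)

(* Expectations of trigonometric polynomials are finite sums of characteristic functions, so
   integration by parts and the rotation reduce to calculus in one real variable and the test
   function is never differentiated. The obstacle is that derivatives of a trigonometric approximant
   are not controlled by the Lipschitz constant of its target. The Hessian is therefore estimated by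
   splitting sin theta S into two independent copies of scale sin theta / sqrt 2 and integrating by
   parts in each: one linear factor is paired with the Lipschitz bound, the other only contributes
   its second moment. This is the origin of the 2 in sqrt(2 / kappa). The resulting 1 / sin theta
   cancels the sin theta of the derivative, and the remaining cos theta integrates to 1 on
   [0, pi/2], so no logarithm appears. The approximation error is amplified near theta = 0; hence
   the path starts at a small delta and the error is taken of order sin(delta)^2. On symmetric
   matrices the covariance of W is 2 sigma times the identity, sigma being the variance of an
   off-diagonal entry, so sqrt(2 / kappa) is 1 / sqrt sigma. The argument reaches 8 in place of
   192. *)
Require Import Defs.
From HB Require Import structures.
From mathcomp Require Import all_boot all_order all_algebra.
From mathcomp Require Import all_classical all_reals all_analysis.
From mathcomp Require Import measurable_realfun ring lra zify.

Set Implicit Arguments.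
Unset Strict Implicit.
Unset Printing Implicit Defensive.

Import Order.TTheory GRing.Theory Num.Theory.
Import numFieldNormedType.Exports.

Local Open Scope classical_set_scope.
Local Open Scope ring_scope.

(** * Random variables with all moments *)

Section Moments.
Context {d : measure_display} {T : measurableType d} {R : realType}.
Variable P : probability T R.
Implicit Types f g : T -> R.

Definition ev f : R := \int[P]_t f t.

(** Asking for moments of every order makes the class stable under products, so that integrability
    follows from the shape of the integrand alone. *)
Definition mom f := measurable_fun setT f /\
  forall k : nat, P.-integrable setT (fun t => (`|f t| ^+ k)%:E).

Definition itg f := P.-integrable setT (EFin \o f).

Lemma itg_dom f g : measurable_fun setT f -> (forall t, `|f t| <= g t) ->
  itg g -> itg f.
Proof.
move=> mf fg ig; apply: (le_integrable _ _ _ ig) => //.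
  exact/measurable_EFinP.
by move=> t _ /=; rewrite lee_fin (le_trans (fg t))// ler_norm.
Qed.

Lemma mom_itg f : mom f -> itg f.
Proof.
move=> [mf /(_ 1%N) i1]; apply: itg_dom mf _ i1 => t.
by rewrite expr1.
Qed.

Lemma itgD f g : itg f -> itg g -> itg (fun t => f t + g t).
Proof. by move=> i1 i2; exact: (integrableD _ i1 i2). Qed.

Lemma itgZ a f : itg f -> itg (fun t => a * f t).
Proof. by move=> i1; exact: (integrableZl _ _ i1). Qed.

Lemma mom_dom f g : measurable_fun setT f -> (forall t, `|f t| <= g t) ->
  mom g -> mom f.
Proof.
move=> mf fg [mg ig]; split=> // k.
apply: (itg_dom _ _ (ig k)).
  exact: measurable_funX (measurableT_comp (@normr_measurable R setT) mf).
move=> t; rewrite ger0_norm ?exprn_ge0// lerXn2r ?nnegrE//.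
exact: le_trans (fg t) (ler_norm _).
Qed.

Lemma mom_meas f : mom f -> measurable_fun setT f. Proof. by case. Qed.

Lemma mom_cst a : mom (fun=> a).
Proof.
split; first exact: measurable_cst.
by move=> k; apply: finite_measure_integrable_cst.
Qed.

Lemma momD f g : mom f -> mom g -> mom (fun t => f t + g t).
Proof.
move=> [mf i_f] [mg ig].
have m : measurable_fun setT (fun t => f t + g t) by exact: measurable_funD.
split=> // k.
apply: (@itg_dom _ (fun t => 2 ^+ k * (`|f t| ^+ k + `|g t| ^+ k))).
- exact: measurable_funX (measurableT_comp (@normr_measurable R setT) m).
- move=> t; rewrite ger0_norm ?exprn_ge0//.
  wlog le_fg : f g {mf i_f mg ig m} / `|f t| <= `|g t|.
    move=> H; have [/ltW h|h] := ltP `|g t| `|f t|; last exact: H.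
    by rewrite addrC [X in _ * X]addrC; exact: H.
  rewrite (@le_trans _ _ ((2 * `|g t|) ^+ k))//.
    rewrite lerXn2r ?nnegrE ?mulr_ge0// (le_trans (ler_normD _ _))//.
    by rewrite mulr2n mulrDl mul1r lerD2r.
  by rewrite exprMn ler_wpM2l ?exprn_ge0// lerDr exprn_ge0.
- by apply: itgZ; apply: itgD; [exact: i_f|exact: ig].
Qed.

Lemma momM f g : mom f -> mom g -> mom (fun t => f t * g t).
Proof.
move=> [mf i_f] [mg ig].
have m : measurable_fun setT (fun t => f t * g t) by exact: measurable_funM.
split=> // k.
apply: (@itg_dom _ (fun t => `|f t| ^+ (k + k) + `|g t| ^+ (k + k))).
- exact: measurable_funX (measurableT_comp (@normr_measurable R setT) m).
- move=> t; rewrite ger0_norm ?exprn_ge0// normrM exprMn !exprD.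
  have := exprn_ge0 k (normr_ge0 (f t)); have := exprn_ge0 k (normr_ge0 (g t)).
  by move: (_ ^+ k) (_ ^+ k) => a b a0 b0; nra.
- by apply: itgD; [exact: i_f|exact: ig].
Qed.

Lemma momZ a f : mom f -> mom (fun t => a * f t).
Proof. by apply: momM; exact: mom_cst. Qed.

Lemma momN f : mom f -> mom (fun t => - f t).
Proof.
move=> mf; rewrite (_ : (fun _ => _) = (fun t => -1 * f t)); first exact: momZ.
by apply/funext => t; rewrite mulN1r.
Qed.

Lemma momB f g : mom f -> mom g -> mom (fun t => f t - g t).
Proof. by move=> mf mg; apply: momD => //; exact: momN. Qed.

Lemma mom_sum (I : Type) (s : seq I) (Q : pred I) (F : I -> T -> R) :
  (forall i, mom (F i)) -> mom (fun t => \sum_(i <- s | Q i) F i t).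
Proof.
move=> mF; elim: s => [|i s ih].
  by under eq_fun do rewrite big_nil; exact: mom_cst.
under eq_fun do rewrite big_cons.
by case: (Q i) => //; exact: momD.
Qed.

Lemma momX f k : mom f -> mom (fun t => f t ^+ k).
Proof.
move=> mf; elim: k => [|k ih]; first by under eq_fun do rewrite expr0; exact: mom_cst.
by under eq_fun do rewrite exprS; exact: momM.
Qed.

Lemma mom_norm f : mom f -> mom (fun t => `|f t|).
Proof.
move=> mf; apply: (mom_dom _ _ (momD (mom_cst 1) (momX 2 mf))).
  exact: measurableT_comp (@normr_measurable R setT) (mom_meas mf).
move=> t; rewrite normr_id -real_normK ?num_real//.
by have := normr_ge0 (f t); move: (`|f t|) => a; nra.
Qed.

Lemma mom_bnd f M : measurable_fun setT f -> (forall t, `|f t| <= M) -> mom f.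
Proof. by move=> mf fM; exact: (mom_dom mf fM (mom_cst M)). Qed.

Lemma mom_cos f : measurable_fun setT f -> mom (fun t => cos (f t)).
Proof.
move=> mf; apply: (@mom_bnd _ 1) => [|t]; last exact: cos_max.
apply: (measurableT_comp _ mf); apply: continuous_measurable_fun.
exact: continuous_cos.
Qed.

Lemma mom_sin f : measurable_fun setT f -> mom (fun t => sin (f t)).
Proof.
move=> mf; apply: (@mom_bnd _ 1) => [|t]; last exact: sin_max.
apply: (measurableT_comp _ mf); apply: continuous_measurable_fun.
exact: continuous_sin.
Qed.

Lemma ev_cst a : ev (fun=> a) = a.
Proof. by rewrite /ev Rintegral_cst//= probability_setT mulr1. Qed.

Lemma evD f g : mom f -> mom g -> ev (fun t => f t + g t) = ev f + ev g.
Proof. by move=> /mom_itg i_f /mom_itg ig; exact: RintegralD. Qed.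

Lemma evB f g : mom f -> mom g -> ev (fun t => f t - g t) = ev f - ev g.
Proof. by move=> /mom_itg i_f /mom_itg ig; exact: RintegralB. Qed.

Lemma evZ a f : mom f -> ev (fun t => a * f t) = a * ev f.
Proof. by move=> /mom_itg i_f; exact: RintegralZl. Qed.

Lemma evN f : mom f -> ev (fun t => - f t) = - ev f.
Proof.
move=> mf; rewrite -mulN1r -evZ//; congr ev; apply/funext => t.
by rewrite mulN1r.
Qed.

Lemma ev_sum (I : Type) (s : seq I) (Q : pred I) (F : I -> T -> R) :
  (forall i, mom (F i)) ->
  ev (fun t => \sum_(i <- s | Q i) F i t) = \sum_(i <- s | Q i) ev (F i).
Proof.
move=> mF; elim: s => [|i s ih].
  by under eq_fun do rewrite big_nil; rewrite ev_cst big_nil.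
under eq_fun do rewrite big_cons; rewrite big_cons.
case: (Q i) => //; rewrite evD ?ih//; exact: mom_sum.
Qed.

Lemma ev_le f g : mom f -> mom g -> (forall t, f t <= g t) -> ev f <= ev g.
Proof. by move=> /mom_itg i_f /mom_itg ig fg; apply: le_Rintegral. Qed.

Lemma ev_ge0 f : (forall t, 0 <= f t) -> 0 <= ev f.
Proof. by move=> f0; apply: Rintegral_ge0. Qed.

Lemma ev_abs f g : mom f -> mom g -> (forall t, `|f t| <= g t) ->
  `|ev f| <= ev g.
Proof.
move=> mf mg fg; rewrite ler_norml -evN// !ev_le//; try exact: momN.
- by move=> t; have := fg t; rewrite ler_norml => /andP[].
- by move=> t; have := fg t; rewrite ler_norml => /andP[].
Qed.

Lemma ev_sqr f : mom f -> ev f ^+ 2 <= ev (fun t => f t ^+ 2).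
Proof.
move=> mf; have /(ev_ge0) : forall t, 0 <= (f t - ev f) ^+ 2 by move=> t; exact: sqr_ge0.
under eq_fun do rewrite sqrrB.
have m2 := momX 2 mf; have mm := mom_cst (ev f ^+ 2).
have mfe : mom (fun t => (f t * ev f) *+ 2).
  by under eq_fun do rewrite -mulr_natr; apply: momM; [apply: momM|];
     rewrite //; exact: mom_cst.
rewrite (evD (momB m2 mfe) mm) (evB m2 mfe) ev_cst.
rewrite (_ : (fun t => _ *+ 2) = fun t => (ev f *+ 2) * f t); last first.
  by apply/funext => t; rewrite mulrC mulrnAl.
by rewrite evZ//; nra.
Qed.

End Moments.
Arguments mom_bnd {d T R P f} M.
Arguments mom_cos {d T R P f}.
Arguments mom_sin {d T R P f}.
Arguments mom_cst {d T R P} a.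

Lemma expR_dominates_pow {R : realType} (u : R) (k : nat) : 0 <= u ->
  u ^+ k <= k`!%:R * expR u.
Proof.
move=> u0; case: k => [|k].
  by rewrite expr0 fact0 mul1r -expR0 ler_expR.
rewrite mulrC -ler_pdivrMr ?ltr0n ?fact_gt0//.
by apply: le_trans (expR_ge1Dxn k u0); rewrite lerDr.
Qed.

(** * Gaussian vectors *)

Section NormalMoments.
Context {R : realType}.
Variables (m s : R).
Hypothesis s0 : s != 0.
Local Notation mu := (@lebesgue_measure R).
Local Notation nu := (normal_prob m s : probability _ R).

(** Doubling the standard deviation leaves a Gaussian factor to spare, which absorbs any power.
    Integrability of all moments, and the decay of boundary terms later, are then read off the wider
    density. *)
Lemma normal_pdf_pow_le k : exists C, 0 <= C /\ forall x,
  `|x - m| ^+ k * normal_pdf m s x <= C * normal_pdf m (2 * s) x.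
Proof.
have s20 : 0 < s ^+ 2 by rewrite exprn_even_gt0.
have d0 : 2 * s != 0 by rewrite mulf_neq0.
rewrite (normal_pdfE _ s0) (normal_pdfE _ d0) /normal_fun.
have p1 := normal_peak_gt0 s0; have p2 := normal_peak_gt0 d0.
(* 1/(2 s^2) - 1/(8 s^2) = 3/(8 s^2): this is the exponent left over when s is replaced by 2 s. *)
pose a : R := 8 * s ^+ 2 / 3.
have a0 : 0 < a by rewrite divr_gt0// mulr_gt0.
pose C := (1 + a ^+ k * k`!%:R) * normal_peak s / normal_peak (2 * s).
exists C; split.
  apply: divr_ge0; last exact: ltW.
  apply: mulr_ge0; last exact: ltW.
  by rewrite addr_ge0// mulr_ge0// exprn_ge0// ltW.
move=> x; rewrite mulrA /C mulrA divfK ?gt_eqF// -2!mulrA mulrCA.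
rewrite [leRHS](_ : _ = normal_peak s * ((1 + a ^+ k * k`!%:R) *
   expR (- (x - m) ^+ 2 / ((2 * s) ^+ 2 *+ 2)))); last by ring.
rewrite ler_pM2l//.
pose u := (x - m) ^+ 2 / a.
have u0 : 0 <= u by rewrite divr_ge0 ?sqr_ge0// ltW.
rewrite (_ : - (x - m) ^+ 2 / (s ^+ 2 *+ 2) =
  - (x - m) ^+ 2 / ((2 * s) ^+ 2 *+ 2) - u); last first.
  by rewrite /u /a; field.
rewrite expRD mulrCA [leRHS]mulrC ler_pM2l ?expR_gt0//.
rewrite expRN ler_pdivrMr ?expR_gt0//.
have h1 : 1 <= expR u by rewrite -expR0 ler_expR.
have := expR_dominates_pow k u0.
have -> : u ^+ k = ((x - m) ^+ k) ^+ 2 / a ^+ k by rewrite /u expr_div_n exprAC.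
rewrite ler_pdivrMr ?exprn_gt0// -normrX -[(x - m) ^+ k ^+ 2]real_normK ?num_real//.
move: (`|_|) (normr_ge0 ((x - m) ^+ k)) => z z0 h.
have : z <= 1 + z ^+ 2 by nra.
rewrite mulrDl mul1r; nra.
Qed.

(** Integrals against the normal law become Lebesgue integrals by the Radon-Nikodym change of
    variables; the abstract derivative occurring there has to be identified with [normal_pdf]. *)
Lemma normal_density_ae : ae_eq mu setT (Radon_Nikodym_SigmaFinite.f nu mu)
  (fun x => (normal_pdf m s x)%:E).
Proof.
have dom : nu `<< mu by exact: normal_prob_dominates.
apply: integral_ae_eq => //.
- exact: Radon_Nikodym_SigmaFinite.f_integrable.
- by apply/measurable_EFinP; exact: measurable_normal_pdf.
- by move=> A _ mA; rewrite -Radon_Nikodym_SigmaFinite.f_integral.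
Qed.

Lemma ge0_integral_normal (h : R -> R) : measurable_fun setT h ->
  (forall x, 0 <= h x) ->
  (\int[nu]_x (h x)%:E = \int[mu]_x (h x * normal_pdf m s x)%:E)%E.
Proof.
move=> mh h0.
have dom : nu `<< mu by exact: normal_prob_dominates.
have mh' : measurable_fun setT (EFin \o h) by exact/measurable_EFinP.
rewrite -(Radon_Nikodym_SigmaFinite.change_of_variables dom)//.
apply: ae_eq_integral => //.
- apply: emeasurable_funM => //.
  exact: measurable_int (Radon_Nikodym_SigmaFinite.f_integrable _).
- apply/measurable_EFinP; apply: measurable_funM => //.
  exact: measurable_normal_pdf.
- have := normal_density_ae; apply: filterS => x /= -> //.
Qed.

Lemma normal_itg (h : R -> R) : measurable_fun setT h ->
  mu.-integrable setT (fun x => (h x * normal_pdf m s x)%:E) ->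
  itg nu h.
Proof.
move=> mh /integrableP[_ i]; apply/integrableP; split.
  exact/measurable_EFinP.
rewrite (_ : (fun x => _) = fun x => (`|h x|)%:E)//.
rewrite ge0_integral_normal//; last exact: measurableT_comp.
apply: le_lt_trans i; apply: ge0_le_integral => //=.
- by move=> x _; rewrite lee_fin mulr_ge0// normal_pdf_ge0.
- apply/measurable_EFinP/measurable_funM.
    exact: measurableT_comp.
  exact: measurable_normal_pdf.
- do 2 apply: measurableT_comp => //; apply: measurable_funM => //.
  exact: measurable_normal_pdf.
- by move=> x _; rewrite lee_fin normrM (ger0_norm (normal_pdf_ge0 m s x)).
Qed.

Lemma normal_ev (h : R -> R) : itg nu h ->
  mu.-integrable setT (fun x => (h x * normal_pdf m s x)%:E) /\
  ev nu h = \int[mu]_x (h x * normal_pdf m s x).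
Proof.
move=> ih.
have mh : measurable_fun setT h by apply/measurable_EFinP; exact: measurable_int ih.
have mhp : measurable_fun setT (fun x => h x * normal_pdf m s x).
  by apply: measurable_funM => //; exact: measurable_normal_pdf.
have i1 : mu.-integrable setT (fun x => (h x * normal_pdf m s x)%:E).
  apply/integrableP; split; first exact/measurable_EFinP.
  rewrite (_ : (fun x => _) = fun x => (`|h x| * normal_pdf m s x)%:E); last first.
    by apply/funext => x /=; rewrite normrM (ger0_norm (normal_pdf_ge0 m s x)).
  rewrite -ge0_integral_normal//; last exact: measurableT_comp.
  by case/integrableP : ih.
split=> //; rewrite /ev /Rintegral; congr fine.
have dom : nu `<< mu by exact: normal_prob_dominates.
have mh' : measurable_fun setT (EFin \o h) by exact/measurable_EFinP.
rewrite -[LHS](Radon_Nikodym_change_of_variables dom)//.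
apply: ae_eq_integral => //.
- by apply: emeasurable_funM => //.
- exact/measurable_EFinP.
- have := ae_eq_Radon_Nikodym_SigmaFinite dom measurableT.
  have := normal_density_ae; apply: filterS2 => x /= e1 e2 _.
  by rewrite -e2// e1// EFinM.
Qed.

Lemma normal_mom : mom nu (fun x => x - m).
Proof.
have mm : measurable_fun setT (fun x : R => x - m) by exact: measurable_funB.
split=> // k.
have mk : measurable_fun setT (fun x : R => `|x - m| ^+ k).
  by apply: measurable_funX; exact: measurableT_comp.
apply: normal_itg => //.
have [C [C0 hC]] := normal_pdf_pow_le k.
apply: (le_integrable measurableT _ _ (integrableZl _ C (integrable_normal_pdf m (2 * s)))) => //.
  by apply/measurable_EFinP/measurable_funM => //; exact: measurable_normal_pdf.
move=> x _ /=; rewrite lee_fin [leLHS]ger0_norm; last first.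
  by rewrite mulr_ge0 ?exprn_ge0 ?normal_pdf_ge0.
rewrite [leRHS]ger0_norm; first exact: hC.
by rewrite mulr_ge0 ?normal_pdf_ge0.
Qed.

(** Fundamental theorem of calculus on [-(n+1), n+1], then dominated convergence with dominating
    function |f|. Limits along integers suffice, and n+1 keeps the interval nondegenerate. *)
Lemma Rintegral_derive_eq0 (F f : R -> R) :
  (forall x, is_derive x (1:R) F (f x)) -> continuous f ->
  mu.-integrable setT (EFin \o f) ->
  (F n.+1%:R @[n --> \oo] --> (0 : R)) -> (F (- n.+1%:R) @[n --> \oo] --> (0 : R)) ->
  \int[mu]_x f x = 0.
Proof.
move=> dF cf i_f F1 F2.
have mf : measurable_fun setT f by exact: continuous_measurable_fun.
pose g (n : nat) x := (f x * \1_`[(- n.+1%:R : R), n.+1%:R] x)%:E.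
have [_ _ cv] : [/\ mu.-integrable setT (EFin \o f),
    (\int[mu]_x `|g n x - (EFin \o f) x| @[n --> \oo] --> 0)%E &
    (\int[mu]_x g n x @[n --> \oo] --> \int[mu]_x (EFin \o f) x)%E].
  apply: (@dominated_convergence _ _ _ mu setT measurableT g (EFin \o f) (abse \o (EFin \o f))) => //.
  - move=> n; apply/measurable_EFinP/measurable_funM => //.
  - exact/measurable_EFinP.
  - apply: aeW => x _; apply: cvg_near_cst; near=> n.
    rewrite /g/= indicE mem_set ?mulr1//= in_itv/= -ler_norml.
    rewrite -natr1 (@le_trans _ _ n%:R) ?lerDl//.
    near: n; exact: nbhs_infty_ger.
  - exact: integrable_abse.
  - apply: aeW => x n _; rewrite /g lee_fin normrM ler_piMr//.
    by rewrite indicE; case: (_ \in _); rewrite ?normr1 ?normr0.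
have cF : continuous F.
  by move=> x; apply: differentiable_continuous; apply/derivable1_diffP; case: (dF x).
have e n : (\int[mu]_x g n x = (F n.+1%:R - F (- n.+1%:R))%:E)%E.
  rewrite EFinB -(@continuous_FTC2 _ f F) //.
  - rewrite [RHS]integral_mkcond; apply: eq_integral => x _.
    by rewrite /g /patch indicE; case: (_ \in _); rewrite ?mulr1 ?mulr0.
  - by rewrite gtrN.
  - exact: continuous_subspaceT.
  - split.
    + by move=> x _; case: (dF x).
    + by apply: cvg_at_right_filter; exact: cF.
    + by apply: cvg_at_left_filter; exact: cF.
  - by move=> x _; rewrite derive1E; case: (dF x).
have cv' : (F n.+1%:R - F (- n.+1%:R) @[n --> \oo] --> (0 - 0 : R)) by exact: cvgB.
rewrite subr0 in cv'.
rewrite /Rintegral (_ : integral _ _ _ = 0%:E)//.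
apply: (cvg_unique _ cv) => //.
rewrite (_ : (fun n => _) = fun n => (F n.+1%:R - F (- n.+1%:R))%:E); last exact/funext.
by apply: cvg_EFin => //; near=> n.
Unshelve. all: end_near.
Qed.
End NormalMoments.

(** * Global Taylor bounds for sine and cosine *)

Section TrigoTaylor.
Context {R : realType}.
Implicit Types x y : R.

(** Each Taylor bound below is this lemma applied to the previous one, whose two sides are the
    derivatives of its own. *)
Lemma derive_ge0_ge0 (F F' : R -> R) x :
  (forall y, is_derive y (1 : R) F (F' y)) -> F 0 = 0 ->
  (forall y, 0 <= y -> 0 <= F' y) -> 0 <= x -> 0 <= F x.
Proof.
move=> dF F0 F'0; rewrite le_eqVlt => /predU1P[<-|x0]; first by rewrite F0.
have cF : continuous F.
  by move=> y; apply: differentiable_continuous; apply/derivable1_diffP; case: (dF y).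
have [c + e] := @MVT _ F F' 0 x x0 (fun y _ => dF y) (continuous_subspaceT cF).
rewrite in_itv/= => /andP[c0 _].
by move: e; rewrite F0 !subr0 => ->; rewrite mulr_ge0 ?F'0// ltW.
Qed.

Lemma sin_le x : 0 <= x -> sin x <= x.
Proof.
move=> x0; rewrite -subr_ge0.
apply: (@derive_ge0_ge0 (fun y => y - sin y) (fun y => 1 - cos y)); last exact: x0.
- by rewrite /= sin0 subr0.
- by move=> y _; rewrite subr_ge0 cos_le1.
Qed.

Lemma cosB1_le x : 0 <= x -> 1 - cos x <= x.
Proof.
move=> x0; rewrite -subr_ge0.
apply: (@derive_ge0_ge0 (fun y => y - (1 - cos y)) (fun y => 1 - sin y)); last exact: x0.
- by move=> y; apply: is_derive_eq; rewrite /GRing.scale/=; ring.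
- by rewrite /= cos0 !subrr.
- by move=> y _; rewrite subr_ge0 sin_le1.
Qed.

Lemma sinB_le x : 0 <= x -> x - sin x <= x ^+ 2 / 2.
Proof.
move=> x0; rewrite -subr_ge0.
apply: (@derive_ge0_ge0 (fun y => y ^+ 2 / 2 - (y - sin y)) (fun y => y - (1 - cos y))); last exact: x0.
- move=> y; apply: is_derive_eq; rewrite /GRing.scale/=; by field.
- by rewrite /= sin0 subrr expr0n/= mul0r subrr.
- by move=> y y0; rewrite subr_ge0 cosB1_le.
Qed.

Lemma cosB1_ge x : 0 <= x -> 1 - x ^+ 2 / 2 <= cos x.
Proof.
move=> x0; rewrite -subr_ge0.
apply: (@derive_ge0_ge0 (fun y => cos y - (1 - y ^+ 2 / 2)) (fun y => y - sin y)); last exact: x0.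
- move=> y; apply: is_derive_eq; rewrite /GRing.scale/=; by field.
- by rewrite /= cos0 expr0n/= mul0r subr0 subrr.
- by move=> y y0; rewrite subr_ge0 sin_le.
Qed.

Lemma cosB2_le x : 0 <= x -> cos x - (1 - x ^+ 2 / 2) <= x ^+ 3 / 6.
Proof.
move=> x0; rewrite -subr_ge0.
apply: (@derive_ge0_ge0 (fun y => y ^+ 3 / 6 - (cos y - (1 - y ^+ 2 / 2))) (fun y => y ^+ 2 / 2 - (y - sin y))); last exact: x0.
- move=> y; apply: is_derive_eq; rewrite /GRing.scale/=; by field.
- by rewrite /= cos0 !expr0n/= !mul0r !(subr0, subrr).
- by move=> y y0; rewrite subr_ge0 sinB_le.
Qed.

Lemma sinB3_le x : 0 <= x -> x - sin x <= x ^+ 3 / 6.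
Proof.
move=> x0; rewrite -subr_ge0.
apply: (@derive_ge0_ge0 (fun y => y ^+ 3 / 6 - (y - sin y)) (fun y => cos y - (1 - y ^+ 2 / 2))); last exact: x0.
- move=> y; apply: is_derive_eq; rewrite /GRing.scale/=; by field.
- by rewrite /= sin0 !expr0n/= !mul0r !(subr0, subrr).
- by move=> y y0; rewrite subr_ge0 cosB1_ge.
Qed.

(** Valid for every h and not only for small h, so that it can be integrated when h is a random
    variable. The constant 1 is crude: each of the two remainders, of sin h and of cos h, is at most
    |h|^3 / 6. *)
Lemma cos_taylor2 x h :
  `|cos (x + h) - (cos x - h * sin x - h ^+ 2 / 2 * cos x)| <= `|h| ^+ 3.
Proof.
wlog h0 : x h / 0 <= h.
  move=> H; have [h0|/ltW h0] := leP 0 h; first exact: H.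
  have := H (- x) (- h); rewrite oppr_ge0 -opprD !cosN sinN mulrNN sqrrN normrN.
  exact.
have := cosB1_ge h0; have := cosB2_le h0; have := sin_le h0; have := sinB3_le h0.
have := cos_max x; have := sin_max x.
rewrite cosD (ger0_norm h0) !ler_norml.
have h3 : 0 <= h ^+ 3 by rewrite exprn_ge0.
move: (cos x) (sin x) (cos h) (sin h) h3 => a b c s h3.
move=> /andP[b1 b2] /andP[a1 a2] s1 s2 c1 c2.
set u := c - (1 - h ^+ 2 / 2); set v := h - s.
rewrite (_ : a * c - b * s - _ = a * u + b * v); last by rewrite /u /v; ring.
have u0 : 0 <= u by rewrite /u subr_ge0.
have v0 : 0 <= v by rewrite /v subr_ge0.
have u1 : u <= h ^+ 3 / 6 by exact: c1.
have v1 : v <= h ^+ 3 / 6 by exact: s1.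
by move: u v u0 v0 u1 v1 => u v u0 v0 u1 v1; apply/andP; split; nra.
Qed.

Lemma cos_taylor1 x h : `|cos (x + h) - (cos x - h * sin x)| <= h ^+ 2.
Proof.
wlog h0 : x h / 0 <= h.
  move=> H; have [h0|/ltW h0] := leP 0 h; first exact: H.
  have := H (- x) (- h); rewrite oppr_ge0 -opprD !cosN sinN mulrNN sqrrN.
  exact.
have := cosB1_ge h0; have := cos_le1 h; have := sin_le h0; have := sinB_le h0.
have := cos_max x; have := sin_max x.
rewrite cosD !ler_norml.
have h3 : 0 <= h ^+ 2 by rewrite exprn_ge0.
move: (cos x) (sin x) (cos h) (sin h) h3 => a b c s h3.
move=> /andP[b1 b2] /andP[a1 a2] s1 s2 c1 c2.
set u := 1 - c; set v := h - s.
rewrite (_ : a * c - b * s - _ = - a * u + b * v); last by rewrite /u /v; ring.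
have u0 : 0 <= u by rewrite /u subr_ge0.
have v0 : 0 <= v by rewrite /v subr_ge0.
have u1 : u <= h ^+ 2 / 2 by rewrite /u; lra.
have v1 : v <= h ^+ 2 / 2 by exact: s1.
by move: u v u0 v0 u1 v1 => u v u0 v0 u1 v1; apply/andP; split; nra.
Qed.

Lemma cos_lip x y : `|cos x - cos y| <= `|x - y|.
Proof.
wlog h0 : x y / y <= x.
  by move=> H; have [h0|/ltW h0] := leP y x; [|rewrite distrC [leRHS]distrC]; exact: H.
have d0 : 0 <= x - y by rewrite subr_ge0.
rewrite [leRHS]ger0_norm// ler_norml.
have e : y + (x - y) = x by ring.
have h1 : 0 <= (fun h => cos (y + h) - cos y + h) (x - y).
  apply: (@derive_ge0_ge0 (fun h => cos (y + h) - cos y + h) (fun h => 1 - sin (y + h))); last exact: d0.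
  - move=> h; apply: is_derive_eq; rewrite /GRing.scale/=; ring.
  - by rewrite /= !addr0 subrr.
  - by move=> h _; rewrite subr_ge0 sin_le1.
have h2 : 0 <= (fun h => h - (cos (y + h) - cos y)) (x - y).
  apply: (@derive_ge0_ge0 (fun h => h - (cos (y + h) - cos y)) (fun h => 1 + sin (y + h))); last exact: d0.
  - move=> h; apply: is_derive_eq; rewrite /GRing.scale/=; ring.
  - by rewrite /= !addr0 subrr subr0.
  - by move=> h _; rewrite -[1]opprK addrC subr_ge0 sin_geN1.
by move: h1 h2; rewrite /= e => h1 h2; apply/andP; split; lra.
Qed.

Lemma sin_lip x y : `|sin x - sin y| <= `|x - y|.
Proof.
rewrite -!cosBpihalf; apply: le_trans (cos_lip _ _) _.
by rewrite opprB addrA subrK.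
Qed.

Lemma sinB_sqr x : `|sin x - x| <= x ^+ 2.
Proof.
wlog x0 : x / 0 <= x.
  move=> H; have [x0|/ltW x0] := leP 0 x; first exact: H.
  have := H (- x); rewrite sinN -opprD normrN sqrrN oppr_ge0; exact.
have := sin_le x0; have := sinB_le x0 => h1 h2.
by rewrite distrC ger0_norm ?subr_ge0//; nra.
Qed.

Lemma normr_sin_le x : `|sin x| <= `|x|.
Proof. by have := sin_lip x 0; rewrite sin0 !subr0. Qed.

End TrigoTaylor.

Lemma is_derive_quad {R : realType} (F : R -> R) (x D C : R) :
  (forall h, `|F (x + h) - F x - h * D| <= C * h ^+ 2) ->
  is_derive x (1 : R) F D.
Proof.
move=> H.
have C0 : 0 <= C.
  by have := H 1; rewrite expr1n mulr1; apply: le_trans.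
have cv : h^-1 *: (F (h + x) - F x) @[h --> 0^'] --> D.
  apply/cvgrPdist_le => /= e e0.
  near=> h.
  have h0 : h != 0 by near: h; exact: nbhs_dnbhs_neq.
  rewrite distrC /GRing.scale/=.
  rewrite (_ : _ - D = h^-1 * (F (x + h) - F x - h * D)); last first.
    by rewrite [h + x]addrC; field.
  rewrite normrM normfV ler_pdivrMl ?normr_gt0//.
  apply: le_trans (H h) _.
  rewrite -real_normK ?num_real// expr2 mulrA mulrC ler_wpM2l//.
  have : `|h| <= e / (C + 1).
    near: h; apply: dnbhs0_le.
    by rewrite divr_gt0// ltr_wpDl.
  rewrite ler_pdivlMr ?ltr_wpDl//; have := normr_ge0 h; nra.
split; last by rewrite /derive; under eq_fun do rewrite /GRing.scale/= mulr1; apply/cvg_lim.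
rewrite /derivable; under eq_fun do rewrite /GRing.scale/= mulr1.
by apply/cvg_ex; exists D.
Unshelve. all: end_near.
Qed.

Section DeriveCf.
Context {d : measure_display} {T : measurableType d} {R : realType}.
Variable P : probability T R.

(** The remainder of [cos_taylor1] is at most h^2 Y^2 uniformly in t, so its expectation is
    quadratic in h and differentiation under the expectation needs no limit theorem. *)
Lemma is_derive_ev_cos (Y A : T -> R) (t : R) : mom P Y -> mom P A ->
  is_derive t (1 : R) (fun t => ev P (fun w => cos (t * Y w + A w)))
    (- ev P (fun w => Y w * sin (t * Y w + A w))).
Proof.
move=> mY mA.
have mL u : mom P (fun w => u * Y w + A w) by apply: momD => //; exact: momZ.
have mc u := mom_cos (mom_meas (mL u)).
have ms u : mom P (fun w => Y w * sin (u * Y w + A w)).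
  by apply: momM => //; apply: mom_sin; exact: mom_meas (mL u).
apply: (@is_derive_quad _ _ _ _ (ev P (fun w => Y w ^+ 2))) => h.
rewrite mulrN opprK -evB// -evZ// -evD//; last 2 first.
- by apply: momB; exact: mc.
- exact: momZ.
rewrite mulrC -evZ; last exact: momX.
apply: ev_abs.
- apply: momD; last exact: momZ.
  by apply: momB; exact: mc.
- by apply: momZ; exact: momX.
move=> w.
have := cos_taylor1 (t * Y w + A w) (h * Y w).
rewrite exprMn (_ : cos ((t + h) * _ + _) = cos (t * Y w + A w + h * Y w)); last first.
  by congr cos; ring.
by rewrite opprB addrA mulrA addrAC.
Qed.
End DeriveCf.

(** * Integration by parts and characteristic function of a normal law *)

Section NormalIbp.
Context {R : realType}.
Variables (m s : R).
Hypothesis s0 : s != 0.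
Local Notation mu := (@lebesgue_measure R).
Local Notation nu := (normal_prob m s : probability _ R).
Local Notation pdf := (normal_pdf m s).

Lemma is_derive_normal_pdf (x : R) :
  is_derive x (1 : R) pdf (- ((x - m) / s ^+ 2) * pdf x).
Proof.
rewrite (normal_pdfE _ s0) /normal_fun.
apply: is_derive_eq; rewrite /GRing.scale/=.
by field.
Qed.

(** The derivative of [h * pdf] is h' pdf - s^-2 (x - m) h pdf, and its integral over the line
    vanishes. *)
Lemma normal_ibp (h h' : R -> R) (C : R) :
  (forall x : R, is_derive x (1 : R) h (h' x)) -> continuous h' ->
  (forall x, `|h x| <= C * (1 + `|x - m|)) -> (forall x, `|h' x| <= C) ->
  ev nu (fun x => (x - m) * h x) = s ^+ 2 * ev nu h'.
Proof.
move=> dh ch' hC h'C.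
have ch : continuous h.
  by move=> y; apply: differentiable_continuous; apply/derivable1_diffP; case: (dh y).
have mh : measurable_fun setT h by exact: continuous_measurable_fun.
have mh' : measurable_fun setT h' by exact: continuous_measurable_fun.
have momh' : mom nu h' by apply: (mom_bnd C).
have mid := normal_mom m s0.
have momh : mom nu h.
  apply: (@mom_dom _ _ _ nu h (fun x => C * (1 + `|x - m|))) => //; apply: momZ; apply: momD; first exact: mom_cst.
  exact: mom_norm mid.
have [i1 e1] := normal_ev (mom_itg (momM mid momh)).
have [i2 e2] := normal_ev (mom_itg momh').
pose f x := h' x * pdf x - s ^- 2 * ((x - m) * h x * pdf x).
have cpdf : continuous pdf by exact: continuous_normal_pdf.
have i3 : mu.-integrable setT (EFin \o (fun x => s ^- 2 * ((x - m) * h x * pdf x))).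
  exact: (integrableZl measurableT _ i1).
have i_f : mu.-integrable setT (EFin \o f).
  by have := integrableB measurableT i2 i3; apply: eq_integrable.
suff : \int[mu]_x f x = 0.
  rewrite RintegralB//.
  rewrite RintegralZl// -e1 -e2 => /eqP; rewrite subr_eq0 => /eqP ->.
  by rewrite mulrA divff ?mul1r// expf_neq0.
(* A bound D / |x - m| on the primitive is all that is needed for it to vanish at both ends. *)
have tail : exists D, 0 <= D /\ forall x, `|h x * pdf x| * `|x - m| <= D.
  have [D1 [D10 h1]] := normal_pdf_pow_le m s0 1.
  have [D2 [D20 h2]] := normal_pdf_pow_le m s0 2.
  have C0 : 0 <= C by apply: le_trans (h'C 0).
  exists (C * ((D1 + D2) * normal_peak (2 * s))).
  have pp := normal_peak_ge0 (2 * s).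
  split; first by rewrite !mulr_ge0// addr_ge0.
  move=> x; rewrite normrM (ger0_norm (normal_pdf_ge0 m s x)).
  have p0 := normal_pdf_ge0 m s x.
  rewrite -mulrA (le_trans (ler_wpM2r _ (hC x))) ?mulr_ge0//.
  rewrite -mulrA ler_wpM2l//.
  have := h1 x; have := h2 x; rewrite expr1.
  have s20 : 2 * s != 0 by rewrite mulf_neq0.
  have := normal_pdf_ub m x s20.
  have := normal_pdf_ge0 m (2 * s) x.
  have := normal_pdf_ge0 m s x.
  have := normr_ge0 (x - m).
  move: (pdf x) (normal_pdf m (2 * s) x) (`|x - m|) (normal_peak (2 * s)) => p q z pk.
  move=> z0 {}p0 q0 qk u2 u1.
  have : (D1 + D2) * q <= (D1 + D2) * pk by rewrite ler_wpM2l// addr_ge0.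
  nra.
have [D [D0 hD]] := tail.
have lim0 (u : R^nat) : (forall n, n.+1%:R - `|m| <= `|u n - m|) ->
    ((fun x => h x * pdf x) (u n) @[n --> \oo] --> (0 : R)).
  move=> hu; apply/cvgrPdist_le => e e0; near=> n.
  rewrite sub0r normrN.
  have h1 : D / e + `|m| < n.+1%:R.
    rewrite -natr1 ltr_pwDr//; near: n; exact: nbhs_infty_ger.
  have h2 : D / e < `|u n - m| by have := hu n; lra.
  have := hD (u n); have z0 : 0 < `|u n - m|.
    by apply: le_lt_trans h2; rewrite divr_ge0// ltW.
  rewrite ltr_pdivrMr// mulrC in h2.
  rewrite -ler_pdivlMr// => h3; apply: le_trans h3 _.
  by rewrite ler_pdivrMr// ltW.
apply: (@Rintegral_derive_eq0 _ (fun x => h x * pdf x) f) => //.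
- move=> x; have := is_derive_normal_pdf x => dp; have := dh x => dhx.
  apply: is_derive_eq; rewrite /GRing.scale/= /f.
  by field.
- move=> x; rewrite /f; apply: cvgB; first by apply: cvgM; [exact: ch'|exact: cpdf].
  apply: cvgM; first exact: cvg_cst.
  apply: cvgM; last exact: cpdf.
  apply: cvgM; last exact: ch.
  by apply: cvgB => //; exact: cvg_cst.
- apply: lim0 => n; rewrite lerBlDr; apply: le_trans (ler_norm _) _.
  by apply: le_trans (ler_normD _ _); rewrite subrK.
- apply: lim0 => n; rewrite lerBlDr; apply: le_trans (ler_norm _) _.
  rewrite -normrN; apply: le_trans (ler_normD _ _); by rewrite subrK.
Unshelve. all: end_near.
Qed.

Lemma normal_mean : ev nu (fun x => x - m) = 0.
Proof.
have := @normal_ibp (fun=> 1) (fun=> 0) 1.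
rewrite ev_cst mulr0 (_ : (fun x => (x - m) * 1) = (fun x => x - m)); last first.
  by apply/funext => x; rewrite mulr1.
apply=> //.
- by move=> x; exact: cst_continuous.
- by move=> x; rewrite normr1 mul1r lerDl.
- by move=> x; rewrite normr0.
Qed.

Lemma normal_var : ev nu (fun x => (x - m) ^+ 2) = s ^+ 2.
Proof.
have := @normal_ibp (fun x => x - m) (fun=> 1) 1.
rewrite ev_cst mulr1; apply=> //.
- by move=> x; apply: is_derive_eq; rewrite subr0.
- by move=> x; exact: cst_continuous.
- by move=> x; rewrite mul1r lerDr.
- by move=> x; rewrite normr1.
Qed.

(** By parts, K' = - t s^2 K, and multiplying by exp(t^2 s^2 / 2) gives a function with zero
    derivative. The phase phi stands for the complex exponential: phi = 0 and phi = - pi/2 give its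
    real and imaginary parts. *)
Lemma normal_cf t phi :
  ev nu (fun x => cos (t * (x - m) + phi)) = expR (- (t ^+ 2 * s ^+ 2 / 2)) * cos phi.
Proof.
pose K t := ev nu (fun x => cos (t * (x - m) + phi)).
have mid := normal_mom m s0.
have dK u : is_derive u (1 : R) K (- (u * s ^+ 2) * K u).
  have := is_derive_ev_cos u mid (mom_cst phi); rewrite -/(K) => dk.
  apply: is_derive_eq; rewrite mulNr; congr (- _).
  have -> : ev nu (fun x => (x - m) * sin (u * (x - m) + phi)) = s ^+ 2 * ev nu (fun x => u * cos (u * (x - m) + phi)).
    apply: (@normal_ibp _ _ (1 + `|u|)).
    - by move=> x; apply: is_derive_eq; rewrite /GRing.scale/=; ring.
    - move=> x; apply: cvgM; first exact: cvg_cst.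
      apply: continuous_comp; last exact: continuous_cos.
      apply: cvgD; last exact: cvg_cst.
      apply: cvgM; first exact: cvg_cst.
      by apply: cvgB => //; exact: cvg_cst.
    - move=> x; apply: le_trans (sin_max _) _.
      by have := normr_ge0 u; have := normr_ge0 (x - m); nra.
    - move=> x; rewrite normrM; have := cos_max (u * (x - m) + phi).
      by have := normr_ge0 u; have := normr_ge0 (cos (u * (x - m) + phi)); nra.
  rewrite evZ//; first by rewrite /K; ring.
    apply: mom_cos; apply: measurable_funD => //; apply: measurable_funM => //.
    exact: mom_meas mid.
pose G u := K u * expR (u ^+ 2 * s ^+ 2 / 2).
have dG (u : R) : is_derive u (1 : R) G 0.
  have := dK u => dk; apply: is_derive_eq; rewrite /GRing.scale/=.
  by field.
have : G t = G 0 by exact: is_derive_0_is_cst.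
rewrite /G expr0n/= !mul0r expR0 mulr1 {2}/K.
rewrite (_ : (fun x => cos (0 * _ + _)) = fun=> cos phi); last first.
  by apply/funext => x; rewrite mul0r add0r.
rewrite ev_cst => <-.
by rewrite /K mulrCA -expRD addNr expR0 mulr1.
Qed.
End NormalIbp.

Section Law.
Context {d : measure_display} {T : measurableType d} {R : realType}.
Variables (P : probability T R) (Y : {RV P >-> R}) (mu : probability (measurableTypeR R) R).
Hypothesis PY : forall A : set R, measurable A -> P (Y @^-1` A) = mu A.

Let mY : measurable_fun (setT : set T) (Y : T -> measurableTypeR R).
Proof. exact: (@measurable_funPT _ _ _ _ Y). Qed.

(** [Y] with the codomain on which [mu] is a measure, so that [distribution P Y'] and [mu] can be
    compared set by set. *)
Let Y' : {RV P >-> measurableTypeR R} :=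
  HB.pack (Y : T -> measurableTypeR R) (isMeasurableFun.Build _ _ _ _ _ mY).

Lemma law_ge0_integral (h : R -> R) : measurable_fun setT h ->
  (forall x, 0 <= h x) -> (\int[P]_t (h (Y t))%:E = \int[mu]_x (h x)%:E)%E.
Proof.
move=> mh h0; transitivity (\int[distribution P Y']_x (h x)%:E)%E.
  by rewrite ge0_integral_distribution//; exact/measurable_EFinP.
by apply: eq_measure_integral => A mA _; exact: PY.
Qed.

Lemma law_mom (h : R -> R) : mom mu h -> mom P (h \o Y).
Proof.
move=> [mh ih]; split; first exact: measurableT_comp.
move=> k; have mk : measurable_fun setT (fun x => `|h x| ^+ k).
  by apply: measurable_funX; exact: measurableT_comp.
apply/integrableP; split.
  by apply/measurable_EFinP; exact: (measurableT_comp mk).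
have /integrableP[_] := ih k.
rewrite (_ : (fun x => _) = (fun x => (`|h x| ^+ k)%:E)); last first.
  by apply/funext => x /=; rewrite normrX normr_id.
rewrite (_ : (fun x => `|_|%E) = (fun t => (`|h (Y t)| ^+ k)%:E)); last first.
  by apply/funext => x /=; rewrite normrX normr_id.
by rewrite (@law_ge0_integral (fun x => `|h x| ^+ k)).
Qed.

Lemma law_ev (h : R -> R) : mom mu h -> ev P (h \o Y) = ev mu h.
Proof.
move=> mh; have mh' := law_mom mh.
rewrite /ev /Rintegral; congr fine.
transitivity (\int[distribution P Y']_x (h x)%:E)%E.
  rewrite integral_distribution//; last exact: mom_itg mh'.
  by apply/measurable_EFinP; exact: mom_meas mh.
by apply: eq_measure_integral => A mA _; exact: PY.
Qed.
End Law.

Section NormalLaw.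
Context {d : measure_display} {T : measurableType d} {R : realType}.
Variables (P : probability T R) (Y : {RV P >-> R}) (m v : R).
Hypotheses (v0 : 0 <= v) (lawY : has_normal_law P Y m v).

Lemma normal_law_facts : [/\ mom P Y, ev P Y = m,
  ev P (fun t => (Y t - m) ^+ 2) = v &
  forall a phi, ev P (fun t => cos (a * Y t + phi)) =
    expR (- (a ^+ 2 * v / 2)) * cos (a * m + phi)].
Proof.
move: v0; rewrite le_eqVlt => /predU1P[e|vgt0].
  pose dm : probability (measurableTypeR R) R := \d_(m : measurableTypeR R).
  have PY (A : set R) : measurable A -> P (Y @^-1` A) = dm A.
    by move=> mA; rewrite lawY// /normal_law -e eqxx.
  have mm (h : R -> R) : measurable_fun setT h -> mom dm h.
    move=> mh; split=> // k; apply/integrableP; split.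
      apply/measurable_EFinP; apply: measurable_funX.
      exact: measurableT_comp.
    rewrite integral_dirac//=; first by rewrite diracT mul1e ltry.
    apply/measurable_EFinP; apply: measurableT_comp => //; apply: measurable_funX.
    exact: measurableT_comp.
  have em (h : R -> R) : measurable_fun setT h -> ev dm h = h m.
    move=> mh; rewrite /ev /Rintegral integral_dirac//; last exact/measurable_EFinP.
    by rewrite diracT mul1e.
  have m1 : measurable_fun setT (fun x : R => (x - m) ^+ 2).
    by apply: measurable_funX; exact: measurable_funB.
  have m2 a phi : measurable_fun setT (fun x : R => cos (a * x + phi)).
    apply: measurableT_comp; last by apply: measurable_funD => //; exact: measurable_funM.
    by apply: continuous_measurable_fun; exact: continuous_cos.
  have mi : measurable_fun setT (fun x : R => x) by exact: measurable_id.
  split.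
  - exact: (@law_mom _ _ _ P Y dm PY id (mm _ mi)).
  - by have := law_ev PY (mm _ mi); rewrite em.
  - by have := law_ev PY (mm _ m1); rewrite em// subrr expr0n/= -e.
  - by move=> a phi; have := law_ev PY (mm _ (m2 a phi)); rewrite em// -e mulr0 mul0r oppr0 expR0 mul1r.
set s := Num.sqrt v.
have s0 : s != 0 by rewrite gt_eqF// sqrtr_gt0.
have s2 : s ^+ 2 = v by rewrite sqr_sqrtr.
have PY (A : set R) : measurable A -> P (Y @^-1` A) = (normal_prob m s : probability _ R) A.
  by move=> mA; rewrite lawY// /normal_law gt_eqF.
have mid := normal_mom m s0.
have mi : mom (normal_prob m s : probability _ R) (fun x => x).
  rewrite (_ : (fun x => x) = (fun x : R => (x - m) + m)); last first.
    by apply/funext => x; rewrite subrK.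
  by apply: momD => //; exact: mom_cst.
split.
- exact: (@law_mom _ _ _ P Y (normal_prob m s : probability _ R) PY id mi).
- have -> : ev P Y = ev (normal_prob m s) id by exact: (@law_ev _ _ _ P Y (normal_prob m s : probability _ R) PY id mi).
  have := normal_mean m s0; rewrite evB//; last exact: mom_cst.
  by rewrite ev_cst => /eqP; rewrite subr_eq0 => /eqP.
- have := @law_ev _ _ _ P Y (normal_prob m s : probability _ R) PY (fun x => (x - m) ^+ 2) (momX 2 mid).
  by rewrite normal_var// s2.
- move=> a phi.
  have mc : mom (normal_prob m s : probability _ R) (fun x => cos (a * x + phi)).
    by apply: mom_cos; apply: measurable_funD => //; apply: measurable_funM => //; exact: mom_meas mi.
  have := @law_ev _ _ _ P Y (normal_prob m s : probability _ R) PY (fun x => cos (a * x + phi)) mc.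
  rewrite {1}/comp => ->.
  have := normal_cf m s0 a (a * m + phi); rewrite s2 => <-.
  by congr ev; apply/funext => x; congr cos; ring.
Qed.
End NormalLaw.

Section Gaussian.
Context {d : measure_display} {T : measurableType d} {R : realType} {I : finType}.
Implicit Types (x y xi : I -> R) (C : I -> I -> R).

Definition dot x y : R := \sum_i x i * y i.

Definition qform C xi : R := \sum_a \sum_b xi a * xi b * C a b.

(** Centred Gaussian vector, described by its characteristic function in real form. [C] enters only
    through its quadratic form, so it is determined only up to its antisymmetric part; this is why
    symmetry of [C] is a separate hypothesis later. *)
Definition gaussv (P : probability T R) (Y : I -> T -> R) C :=
  (forall i, mom P (Y i)) /\
  forall xi phi, ev P (fun t => cos (dot xi (Y^~ t) + phi)) =
                 expR (- (qform C xi / 2)) * cos phi.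

Lemma mom_dot (P : probability T R) (Y : I -> T -> R) xi :
  (forall i, mom P (Y i)) -> mom P (fun t => dot xi (Y^~ t)).
Proof. by move=> mY; apply: mom_sum => i; exact: momZ. Qed.

Lemma ev_dot_sqr (P : probability T R) (Y : I -> T -> R) xi :
  (forall i, mom P (Y i)) ->
  ev P (fun t => dot xi (Y^~ t) ^+ 2) =
  qform (fun a b => ev P (fun t => Y a t * Y b t)) xi.
Proof.
move=> mY.
rewrite (_ : (fun t => _) =
   fun t => \sum_a \sum_b xi a * xi b * (Y a t * Y b t)); last first.
  apply/funext => t; rewrite expr2 big_distrl/=; apply: eq_bigr => a _.
  by rewrite big_distrr/=; apply: eq_bigr => b _; ring.
have mm a b : mom P (fun t => xi a * xi b * (Y a t * Y b t)) by apply: momZ; exact: momM.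
rewrite ev_sum; last by move=> a; apply: mom_sum.
apply: eq_bigr => a _; rewrite ev_sum//; apply: eq_bigr => b _.
by rewrite evZ//; exact: momM.
Qed.

Lemma ev_dot (P : probability T R) (Y : I -> T -> R) xi :
  (forall i, mom P (Y i)) ->
  ev P (fun t => dot xi (Y^~ t)) = dot xi (fun i => ev P (Y i)).
Proof.
move=> mY; rewrite ev_sum; last by move=> i; exact: momZ.
by apply: eq_bigr => i _; rewrite evZ.
Qed.

End Gaussian.

Lemma expectation_ev {d} {T : measurableType d} {R : realType} (P : probability T R)
  (f : T -> R) : mom P f -> ('E_P[f] = (ev P f)%:E)%E.
Proof.
move=> mf; rewrite unlock /ev /Rintegral fineK//.
exact: integrable_fin_num (mom_itg mf).
Qed.

Section JointlyGaussian.
Context {d : measure_display} {T : measurableType d} {R : realType} {I : finType}.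

Lemma jointly_gaussian_mom (J : Type) (P : probability T R) (Y : J -> {RV P >-> R}) :
  jointly_gaussian P Y -> forall i, mom P (Y i).
Proof.
move=> gY i; have [mu [v [v0 lawi]]] := gY 1%N (fun=> i) (fun=> 1).
have lawY : has_normal_law P (Y i) mu v.
  move: lawi; rewrite (_ : (fun t => _) = Y i)//.
  by apply/funext => t; rewrite big_ord1 mul1r.
by have [] := normal_law_facts v0 lawY.
Qed.

Lemma jointly_gaussian_gaussv (J : Type) (P : probability T R) (Y : J -> {RV P >-> R})
    (f : I -> J) :
  jointly_gaussian P Y -> centered P Y ->
  gaussv P (fun i => Y (f i)) (fun a b => ev P (fun t => Y (f a) t * Y (f b) t)).
Proof.
move=> gY cY; have mY i := jointly_gaussian_mom gY i.
split=> // xi phi.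
have [mu [v [v0 lawL]]] := gY #|I| (fun k => f (enum_val k)) (fun k => xi (enum_val k)).
pose L t := dot xi ((fun i => Y (f i) : T -> R)^~ t).
(* [jointly_gaussian] speaks of combinations indexed by ordinals; [I] is enumerated to fit. *)
have LE : (fun t => \sum_(k < #|I|) xi (enum_val k) * Y (f (enum_val k)) t) = L.
  apply/funext => t; rewrite /L /dot.
  by rewrite [RHS](reindex_onto enum_val enum_rank)//=;
    [apply: eq_bigl => k; rewrite enum_valK eqxx|move=> i _; rewrite enum_rankK].
rewrite LE in lawL.
have mL : mom P L by apply: (@mom_dot _ _ _ _ P (fun i => Y (f i))) => i; exact: mY.
pose L' : {RV P >-> R} := HB.pack L (isMeasurableFun.Build _ _ _ _ L (mom_meas mL)).
have [_ eL vL cL] := @normal_law_facts _ _ _ P L' mu v v0 lawL.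
have mu0 : mu = 0.
  rewrite -eL [LHS](@ev_dot _ _ _ _ P (fun i => Y (f i)))//.
  rewrite /dot big1// => i _.
  by have := cY (f i); rewrite expectation_ev// => -[->]; rewrite mulr0.
have -> : qform (fun a b => ev P (fun t => Y (f a) t * Y (f b) t)) xi = v.
  rewrite -vL -(@ev_dot_sqr _ _ _ _ P (fun i => Y (f i)))//.
  by congr ev; apply/funext => t; rewrite mu0 subr0.
have := cL 1 phi; rewrite expr1n mul1r mu0 mulr0 add0r => <-.
by congr ev; apply/funext => t; rewrite mul1r.
Qed.
End JointlyGaussian.

(** * Approximation by trigonometric polynomials *)

Section Bernstein.
Context {R : realType}.
Implicit Types (t : R) (n m : nat).

(** The Bernstein weight binom(n, m) t^m (1 - t)^(n - m), built one trial at a time as the law of a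
    number of successes, so that its moments follow by induction on n. *)
Fixpoint bernw n m t : R :=
  if n is n'.+1 then (1 - t) * bernw n' m t + (if m is m'.+1 then t * bernw n' m' t else 0)
  else (m == 0)%:R.

Lemma bernw_ge0 n m t : 0 <= t <= 1 -> 0 <= bernw n m t.
Proof.
move=> /andP[t0 t1]; elim: n m => [|n ih] [|m] //=; first by rewrite addr0 mulr_ge0// subr_ge0.
by rewrite addr_ge0// mulr_ge0// subr_ge0.
Qed.

Lemma bernw_gt n m t : (n < m)%N -> bernw n m t = 0.
Proof.
elim: n m => [|n ih] [|m] //= nm; rewrite ih; last exact: ltnW.
by rewrite ih// !mulr0 addr0.
Qed.

Lemma sum_bernwS n t (h : nat -> R) :
  \sum_(m < n.+2) bernw n.+1 m t * h m =
  (1 - t) * \sum_(m < n.+1) bernw n m t * h m + t * \sum_(m < n.+1) bernw n m t * h m.+1.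
Proof.
transitivity (\sum_(m < n.+2) ((1 - t) * (bernw n m t * h m) +
   (if (m : nat) is m'.+1 then t * (bernw n m' t * h m) else 0))).
  apply: eq_bigr => -[[|m] hm] _ /=; first by rewrite !addr0 mulrA.
  by rewrite mulrDl !mulrA.
rewrite big_split/=; congr (_ + _).
  by rewrite -big_distrr/= big_ord_recr/= bernw_gt// mul0r addr0.
rewrite big_ord_recl/= add0r big_distrr/=; apply: eq_bigr => m _.
by rewrite /bump/= add1n.
Qed.

Lemma sum_bernw n t : \sum_(m < n.+1) bernw n m t = 1.
Proof.
elim: n => [|n ih]; first by rewrite big_ord1.
have := sum_bernwS n t (fun=> 1).
under eq_bigr do rewrite mulr1.
under [X in (1 - t) * X]eq_bigr do rewrite mulr1.
under [X in t * X]eq_bigr do rewrite mulr1.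
by rewrite ih => ->; rewrite !mulr1 subrK.
Qed.

(** Variance of the binomial law plus the squared distance of its mean to c. The centre is arbitrary
    because the induction shifts it to c - 1 after a success. *)
Lemma sum_bernw_sqr n t c :
  \sum_(m < n.+1) bernw n m t * (m%:R - c) ^+ 2 =
  n%:R * t * (1 - t) + (n%:R * t - c) ^+ 2.
Proof.
elim: n c => [|n ih] c; first by rewrite big_ord1 /= mulr1n; ring.
rewrite (sum_bernwS n t (fun m => (m%:R - c) ^+ 2)) ih.
have -> : \sum_(m < n.+1) bernw n m t * (m.+1%:R - c) ^+ 2 =
   \sum_(m < n.+1) bernw n m t * (m%:R - (c - 1)) ^+ 2.
  by apply: eq_bigr => m _; rewrite -natr1 opprB addrA.
by rewrite ih -[n.+1%:R]natr1; ring.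
Qed.

End Bernstein.

(** * Trigonometric polynomials in several variables *)

Section TrigPoly.
Context {R : realType} {I : finType}.
Implicit Types (x y xi : I -> R) (f g : (I -> R) -> R).

(** Each triple is (amplitude, frequency, phase); the phase makes cosines alone sufficient. *)
Definition trigsum (s : seq (R * (I -> R) * R)) x :=
  \sum_(p <- s) p.1.1 * cos (dot p.1.2 x + p.2).

Definition trig f := exists s, f =1 trigsum s.

Lemma eq_trig f g : f =1 g -> trig f -> trig g.
Proof. by move=> fg [s hs]; exists s => x; rewrite -fg. Qed.

Lemma trig_cos a xi phi : trig (fun x => a * cos (dot xi x + phi)).
Proof. by exists [:: (a, xi, phi)] => x; rewrite /trigsum big_seq1. Qed.

Lemma trig_cst a : trig (fun=> a).
Proof.
apply: eq_trig (trig_cos a (fun=> 0) 0) => x.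
by rewrite /dot big1 ?addr0 ?cos0 ?mulr1// => i _; rewrite mul0r.
Qed.

Lemma trigD f g : trig f -> trig g -> trig (fun x => f x + g x).
Proof.
by move=> [s hs] [s' hs']; exists (s ++ s') => x; rewrite hs hs' /trigsum big_cat.
Qed.

Lemma trig_sum (J : Type) (s : seq J) (Q : pred J) (F : J -> (I -> R) -> R) :
  (forall j, trig (F j)) -> trig (fun x => \sum_(j <- s | Q j) F j x).
Proof.
move=> tF; elim: s => [|j s ih].
  by apply: eq_trig (trig_cst 0) => x; rewrite big_nil.
case: (boolP (Q j)) => Qj.
  by apply: eq_trig (trigD (tF j) ih) => x; rewrite big_cons Qj.
by apply: eq_trig ih => x; rewrite big_cons (negbTE Qj).
Qed.

Lemma trigM f g : trig f -> trig g -> trig (fun x => f x * g x).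
Proof.
move=> [s hs] [s' hs'].
apply: (@eq_trig (fun x => \sum_(p <- s) \sum_(q <- s')
   p.1.1 * cos (dot p.1.2 x + p.2) * (q.1.1 * cos (dot q.1.2 x + q.2)))).
  move=> x; rewrite hs hs' /trigsum big_distrl/=; apply: eq_bigr => p _.
  by rewrite big_distrr.
apply: trig_sum => p; apply: trig_sum => q.
pose a := p.1.1 * q.1.1 / 2.
have h1 := trig_cos a (fun i => p.1.2 i + q.1.2 i) (p.2 + q.2).
have h2 := trig_cos a (fun i => p.1.2 i - q.1.2 i) (p.2 - q.2).
apply: eq_trig (trigD h1 h2) => x.
have -> : dot (fun i => p.1.2 i + q.1.2 i) x = dot p.1.2 x + dot q.1.2 x.
  by rewrite /dot -big_split/=; apply: eq_bigr => i _; rewrite mulrDl.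
have -> : dot (fun i => p.1.2 i - q.1.2 i) x = dot p.1.2 x - dot q.1.2 x.
  by rewrite /dot -sumrB; apply: eq_bigr => i _; rewrite mulrBl.
rewrite addrACA [X in _ + a * cos X](_ : _ = (dot p.1.2 x + p.2) - (dot q.1.2 x + q.2)); last by ring.
move: (dot p.1.2 x + p.2) (dot q.1.2 x + q.2) => A B.
by rewrite (cosD A B) (cosB A B) /a; field.
Qed.

Lemma trig_prod (J : Type) (s : seq J) (Q : pred J) (F : J -> (I -> R) -> R) :
  (forall j, trig (F j)) -> trig (fun x => \prod_(j <- s | Q j) F j x).
Proof.
move=> tF; elim: s => [|j s ih].
  by apply: eq_trig (trig_cst 1) => x; rewrite big_nil.
case: (boolP (Q j)) => Qj.
  by apply: eq_trig (trigM (tF j) ih) => x; rewrite big_cons Qj.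
by apply: eq_trig ih => x; rewrite big_cons (negbTE Qj).
Qed.

Lemma trig_sin i (L : R) : trig (fun x => sin (x i / L)).
Proof.
apply: eq_trig (trig_cos 1 (fun k => (k == i)%:R / L) (- (pi / 2))) => x.
rewrite mul1r cosBpihalf /dot (bigD1 i)//= eqxx big1 ?addr0.
  by rewrite mul1r mulrC.
by move=> k /negbTE ->; rewrite !mul0r.
Qed.

Lemma trig_bernw i (L : R) n m :
  trig (fun x => bernw n m ((1 + sin (x i / L)) / 2)).
Proof.
have tt : trig (fun x => (1 + sin (x i / L)) / 2).
  apply: trigM; last exact: trig_cst.
  by apply: trigD; [exact: trig_cst|exact: trig_sin].
have tt' : trig (fun x => 1 - (1 + sin (x i / L)) / 2).
  apply: eq_trig (trigD (trig_cst 1) (trigM (trig_cst (-1)) tt)) => x.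
  by rewrite mulN1r.
elim: n m => [|n ih] m /=; first exact: trig_cst.
apply: trigD; first exact: trigM.
by case: m => [|m]; [exact: trig_cst|exact: trigM].
Qed.

Definition l1 x : R := \sum_i `|x i|.

(* The map [x |-> L sin (x / L)] stays in the box [-L, L]^I and is a
   trigonometric polynomial, so Bernstein polynomials of [f] on the box become
   trigonometric polynomials after composition. *)
Lemma bernstein_trig f (L K e : R) : 0 < L -> 0 <= K -> 0 < e ->
  (forall x y, (forall i, `|x i| <= L) -> (forall i, `|y i| <= L) ->
     `|f x - f y| <= K * l1 (fun i => x i - y i)) ->
  exists2 F, trig F & forall x, `|f (fun i => L * sin (x i / L)) - F x| <= e.
Proof.
move=> L0 K0 e0 fL.
pose N : R := #|I|%:R.
have N0 : 0 <= N by rewrite ler0n.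
have [dlt d0 dltE] : exists2 dlt, 0 < dlt & K * (dlt + dlt) * N <= e.
  have KN0 : 0 < K * N + 1 by rewrite ltr_wpDl// mulr_ge0.
  exists (e / (2 * (K * N + 1))); first by rewrite divr_gt0// mulr_gt0.
  have -> : K * (e / (2 * (K * N + 1)) + e / (2 * (K * N + 1))) * N =
      (K * N * e) / (K * N + 1) by field; rewrite gt_eqF.
  by rewrite ler_pdivrMr// mulrDr mulr1 [e * _]mulrC lerDl ltW.
(* The binomial grid on [-L, L] has variance at most L^2 / n1 in each coordinate, hence at most
   dlt^2. *)
have [n1 n10 hn] : exists2 n1 : nat, 0 < n1%:R :> R & L ^+ 2 / dlt ^+ 2 < n1%:R.
  exists (Num.truncn (L ^+ 2 / dlt ^+ 2)).+1; first by rewrite ltr0n.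
  by apply: truncnS_gt.
have n1n0 : n1%:R != 0 :> R by rewrite gt_eqF.
pose node (m : nat) : R := L * (2 * (m%:R / n1%:R) - 1).
pose tt x i : R := (1 + sin (x i / L)) / 2.
have tt01 x i : 0 <= tt x i <= 1.
  rewrite /tt; have := sin_le1 (x i / L); have := sin_geN1 (x i / L).
  by move: (sin _) => z; lra.
exists (fun x => \sum_(j : {ffun I -> 'I_n1.+1})
    f (fun i => node (j i)) * \prod_i bernw n1 (j i) (tt x i)).
  apply: trig_sum => j; apply: trigM; first exact: trig_cst.
  by apply: trig_prod => i; exact: trig_bernw.
move=> x; pose u i := L * sin (x i / L).
have uE i : u i = L * (2 * tt x i - 1) by rewrite /u /tt; field.
have one : \sum_(j : {ffun I -> 'I_n1.+1}) \prod_i bernw n1 (j i) (tt x i) = 1.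
  rewrite -(bigA_distr_bigA (fun i (m : 'I_n1.+1) => bernw n1 m (tt x i))).
  by rewrite big1// => i _; rewrite sum_bernw.
have prod0 (j : {ffun I -> 'I_n1.+1}) : 0 <= \prod_i bernw n1 (j i) (tt x i).
  by apply: prodr_ge0 => i _; exact: bernw_ge0.
have -> : f u - \sum_(j : {ffun I -> 'I_n1.+1})
     f (fun i => node (j i)) * \prod_i bernw n1 (j i) (tt x i) =
   \sum_(j : {ffun I -> 'I_n1.+1})
     (f u - f (fun i => node (j i))) * \prod_i bernw n1 (j i) (tt x i).
  under [RHS]eq_bigr do rewrite mulrBl.
  by rewrite sumrB -big_distrr/= one mulr1.
apply: le_trans (ler_norm_sum _ _ _) _.
apply: (@le_trans _ _ (\sum_(j : {ffun I -> 'I_n1.+1})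
   K * (\sum_i `|u i - node (j i)|) * \prod_i bernw n1 (j i) (tt x i))).
  apply: ler_sum => j _; rewrite normrM (ger0_norm (prod0 j)) ler_wpM2r//.
  apply: fL => i.
    rewrite normrM (gtr0_norm L0) -[leRHS]mulr1 ler_pM2l//; exact: sin_max.
  rewrite /node normrM (gtr0_norm L0) -[leRHS]mulr1 ler_pM2l//.
  have h1 : 0 <= (j i)%:R / n1%:R :> R by rewrite divr_ge0.
  have h2 : (j i)%:R / n1%:R <= 1 :> R.
    by rewrite ler_pdivrMr// mul1r ler_nat -ltnS.
  by rewrite ler_norml; lra.
have -> : \sum_(j : {ffun I -> 'I_n1.+1})
   K * (\sum_i `|u i - node (j i)|) * \prod_i bernw n1 (j i) (tt x i) =
   K * \sum_i \sum_(m < n1.+1) bernw n1 m (tt x i) * `|u i - node m|.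
  under eq_bigr do rewrite -mulrA big_distrl/=.
  rewrite -big_distrr/= exchange_big/=; congr (_ * _); apply: eq_bigr => i _.
  transitivity (\sum_(j : {ffun I -> 'I_n1.+1})
     \prod_k (bernw n1 (j k) (tt x k) * (if k == i then `|u i - node (j k)| else 1))).
    apply: eq_bigr => j _; rewrite big_split/= mulrC; congr (_ * _).
    by rewrite (bigD1 i)//= eqxx big1 ?mulr1// => k /negbTE ->.
  rewrite -(bigA_distr_bigA (fun k (m : 'I_n1.+1) =>
     bernw n1 m (tt x k) * (if k == i then `|u i - node m| else 1))).
  rewrite (bigD1 i)//= eqxx [X in _ * X]big1 ?mulr1// => k /negbTE ->.
  by under eq_bigr do rewrite mulr1; rewrite sum_bernw.
apply: (@le_trans _ _ (K * (\sum_(i : I) (dlt + dlt)))).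
  rewrite ler_wpM2l//; apply: ler_sum => i _.
  (* |z| <= dlt + z^2 / dlt replaces the usual splitting into near and far nodes, leaving only the
     variance to bound. *)
  apply: (@le_trans _ _ (\sum_(m < n1.+1) bernw n1 m (tt x i) *
     (dlt + (2 * L / n1%:R) ^+ 2 / dlt * (m%:R - n1%:R * tt x i) ^+ 2))).
    apply: ler_sum => m _; rewrite ler_wpM2l ?bernw_ge0//.
    rewrite uE /node.
    have -> : L * (2 * tt x i - 1) - L * (2 * (m%:R / n1%:R) - 1) =
       (2 * L / n1%:R) * (n1%:R * tt x i - m%:R).
      by field; rewrite ?n1n0.
    rewrite -[_ ^+ 2 / dlt * _]mulrAC -exprMn -[(_ * (m%:R - _)) ^+ 2]sqrrN -mulrN opprB.
    move: (_ * (_ - _)) => z; rewrite -[z ^+ 2]real_normK ?num_real//.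
    rewrite -(ler_pM2r d0) mulrDl divfK ?gt_eqF//.
    have := normr_ge0 z; have := ltW d0; nra.
  under eq_bigr do rewrite mulrDr [X in _ + X]mulrCA.
  rewrite big_split/= -big_distrl/= sum_bernw mul1r lerD2l -big_distrr/=.
  rewrite sum_bernw_sqr subrr expr0n/= addr0.
  have /andP[t0 t1] := tt01 x i.
  have ht : tt x i * (1 - tt x i) <= 1 / 4 by have := sqr_ge0 (tt x i - 1 / 2); nra.
  rewrite -(ler_pM2r d0) mulrAC divfK ?gt_eqF// -mulrA.
  apply: (@le_trans _ _ ((2 * L / n1%:R) ^+ 2 * (n1%:R * (1 / 4)))).
    rewrite [2 * (L / _)]mulrA ler_wpM2l ?sqr_ge0//.
    by rewrite -[_ * _ * (1 - _)]mulrA ler_wpM2l// ltW.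
  rewrite (_ : _ * _ = L ^+ 2 / n1%:R); last by field; rewrite gt_eqF.
  rewrite ler_pdivrMr// -expr2 mulrC -ler_pdivrMr ?exprn_gt0//.
  exact: ltW.
by rewrite sumr_const -mulr_natr mulrA.
Qed.

End TrigPoly.

(** * Functions that are Lipschitz up to a polynomial factor *)

Section PolyLip.
Context {R : realType} {I : finType}.
Implicit Types (x y xi : I -> R) (f g : (I -> R) -> R).

(** A class stable under products that contains both Lipschitz functions and quadratic forms, and
    whose members have all moments when the coordinates do. *)
Definition polylip f := exists K p, 0 <= K /\
  forall x y, `|f x - f y| <= K * (1 + l1 x + l1 y) ^+ p * l1 (fun i => x i - y i).

Lemma l1_ge0 x : 0 <= l1 x. Proof. exact: sumr_ge0. Qed.

Lemma le_l1 x i : `|x i| <= l1 x.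
Proof. by rewrite /l1 (bigD1 i)//= lerDl sumr_ge0. Qed.

Lemma l1_le x y : (forall i, `|x i| <= `|y i|) -> l1 x <= l1 y.
Proof. by move=> xy; apply: ler_sum. Qed.

Lemma base_ge1 x y : 1 <= 1 + l1 x + l1 y.
Proof. by rewrite -addrA lerDl addr_ge0// l1_ge0. Qed.

Lemma polylip_raise K p q z : 0 <= K -> 1 <= z :> R -> (p <= q)%N ->
  K * z ^+ p <= K * z ^+ q.
Proof. by move=> K0 z1 pq; rewrite ler_wpM2l// ler_weXn2l. Qed.

Lemma polylip_growth f : polylip f -> exists C q, 0 <= C /\
  forall x, `|f x| <= C * (1 + l1 x) ^+ q.
Proof.
move=> [K [p [K0 fK]]]; exists (`|f (fun=> 0)| + K), p.+1.
split; first by rewrite addr_ge0.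
move=> x; have := fK x (fun=> 0).
have -> : l1 (fun i => x i - (fun=> 0) i) = l1 x.
  by apply: eq_bigr => i _; rewrite subr0.
have -> : @l1 R I (fun=> 0) = 0 by rewrite /l1 big1// => i _; rewrite normr0.
rewrite addr0 => h.
have x0 := l1_ge0 x; have x1 : 1 <= 1 + l1 x by rewrite lerDl.
rewrite -[f x](subrK (f (fun=> 0))) mulrDl.
apply: le_trans (ler_normD _ _) _; rewrite addrC lerD//.
  by rewrite ler_peMr// exprn_ege1.
apply: le_trans h _; rewrite exprSr mulrA ler_wpM2l//.
  by rewrite mulr_ge0// exprn_ge0// (le_trans _ x1).
by rewrite lerDr.
Qed.

Lemma eq_polylip f g : f =1 g -> polylip f -> polylip g.
Proof. by move=> fg [K [p [K0 h]]]; exists K, p; split=> // x y; rewrite -!fg. Qed.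

Lemma polylip_cst a : polylip (fun=> a).
Proof.
exists 0, 0%N; split=> // x y.
by rewrite subrr normr0 !mul0r.
Qed.

Lemma polylip_lip f K : 0 <= K ->
  (forall x y, `|f x - f y| <= K * l1 (fun i => x i - y i)) -> polylip f.
Proof. by move=> K0 fK; exists K, 0%N; split=> // x y; rewrite expr0 mulr1. Qed.

Lemma polylip_coord i : polylip (fun x => x i).
Proof.
by apply: (@polylip_lip _ 1) => // x y; rewrite mul1r (le_l1 (fun i => x i - y i)).
Qed.

Lemma polylipD f g : polylip f -> polylip g -> polylip (fun x => f x + g x).
Proof.
move=> [K [p [K0 fK]]] [K' [p' [K'0 gK]]]; exists (K + K'), (p + p')%N.
split=> [|x y]; first exact: addr_ge0.
rewrite opprD addrACA !mulrDl; apply: le_trans (ler_normD _ _) _.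
have b := base_ge1 x y.
apply: lerD.
  apply: le_trans (fK x y) _; rewrite ler_wpM2r ?l1_ge0//.
  by apply: polylip_raise => //; exact: leq_addr.
apply: le_trans (gK x y) _; rewrite ler_wpM2r ?l1_ge0//.
by apply: polylip_raise => //; exact: leq_addl.
Qed.

Lemma polylipM f g : polylip f -> polylip g -> polylip (fun x => f x * g x).
Proof.
move=> pf pg.
have [C [q [C0 fC]]] := polylip_growth pf.
have [C' [q' [C'0 gC]]] := polylip_growth pg.
move: pf pg => [K [p [K0 fK]]] [K' [p' [K'0 gK]]].
exists (C * K' + C' * K), (q + p' + (q' + p))%N.
split=> [|x y]; first by rewrite addr_ge0// mulr_ge0.
have -> : f x * g x - f y * g y = f x * (g x - g y) + g y * (f x - f y) by ring.
apply: le_trans (ler_normD _ _) _; rewrite !normrM !mulrDl.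
have b := base_ge1 x y; have lx := l1_ge0 x; have ly := l1_ge0 y.
have lxy := l1_ge0 (fun i => x i - y i).
set z := 1 + l1 x + l1 y in b *; have z0 : 0 <= z by apply: le_trans b.
apply: lerD.
  apply: (@le_trans _ _ ((C * z ^+ q) * (K' * z ^+ p' * l1 (fun i => x i - y i)))).
    apply: ler_pM => //.
    apply: le_trans (fC x) _; rewrite ler_wpM2l// lerXn2r ?nnegrE ?addr_ge0//.
    by rewrite /z lerDl.
  rewrite mulrA ler_wpM2r// mulrACA -exprD.
  by apply: polylip_raise; rewrite ?mulr_ge0// leq_addr.
apply: (@le_trans _ _ ((C' * z ^+ q') * (K * z ^+ p * l1 (fun i => x i - y i)))).
  apply: ler_pM => //.
  apply: le_trans (gC y) _; rewrite ler_wpM2l// lerXn2r ?nnegrE ?addr_ge0//.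
  by rewrite /z addrAC lerDl.
rewrite mulrA ler_wpM2r// mulrACA -exprD.
by apply: polylip_raise; rewrite ?mulr_ge0// leq_addl.
Qed.

Lemma polylip_sum (J : Type) (s : seq J) (Q : pred J) (F : J -> (I -> R) -> R) :
  (forall j, polylip (F j)) -> polylip (fun x => \sum_(j <- s | Q j) F j x).
Proof.
move=> tF; elim: s => [|j s ih].
  by apply: eq_polylip (polylip_cst 0) => x; rewrite big_nil.
case: (boolP (Q j)) => Qj.
  by apply: eq_polylip (polylipD (tF j) ih) => x; rewrite big_cons Qj.
by apply: eq_polylip ih => x; rewrite big_cons (negbTE Qj).
Qed.

Lemma polylip_comp (h : R -> R) f : (forall a b, `|h a - h b| <= `|a - b|) ->
  polylip f -> polylip (fun x => h (f x)).
Proof.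
move=> hh [K [p [K0 fK]]]; exists K, p; split=> // x y.
exact: le_trans (hh _ _) (fK _ _).
Qed.

Lemma polylip_dot xi : polylip (dot xi).
Proof.
by apply: polylip_sum => i; apply: polylipM; [exact: polylip_cst|exact: polylip_coord].
Qed.

(** Replacing each x_i by u_i = L sin(x_i / L) moves x by at most |x|^2 / L in the l1 norm and puts
    it in a box where f is Lipschitz, so that [bernstein_trig] applies. The error cannot be uniform;
    a polynomial weight with exponent independent of e is enough under an expectation. *)
Lemma polylip_trig f : polylip f -> exists q, forall e : R, 0 < e ->
  exists2 F, trig F & forall x, `|f x - F x| <= e * (1 + l1 x) ^+ q.
Proof.
(* p comes from the local Lipschitz constant and 2 from the displacement |x|^2 / L. *)
move=> [K [p [K0 fK]]]; exists p.+2 => e e0.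
(* Large enough for K 2^p / L <= e / 2; the factor 2^p arises because both x and u are bounded by
   |x|. *)
pose L := 2 * K * 2 ^+ p / e + 1.
have L1 : 1 <= L.
  by rewrite lerDr divr_ge0// ?mulr_ge0// ?exprn_ge0// ltW.
have L0 : 0 < L by apply: lt_le_trans L1.
have [|||F tF hF] := @bernstein_trig _ I f L (K * (1 + 2 * #|I|%:R * L) ^+ p) (e / 2) L0.
- by rewrite mulr_ge0// exprn_ge0// addr_ge0// !mulr_ge0// ltW.
- by rewrite divr_gt0.
- move=> x y xL yL; apply: le_trans (fK x y) _; rewrite ler_wpM2r ?l1_ge0//.
  rewrite ler_wpM2l// lerXn2r ?nnegrE//.
  + by rewrite (le_trans _ (base_ge1 x y)).
  + by rewrite addr_ge0// !mulr_ge0// ltW.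
  rewrite -addrA lerD2l -mulrA mulr2n mulrDl mul1r.
  have h (z : I -> R) : (forall i, `|z i| <= L) -> l1 z <= #|I|%:R * L.
    move=> zL; rewrite mulr_natl -sumr_const; apply: ler_sum => i _; exact: zL.
  by apply: lerD; exact: h.
exists F => // x.
pose u i := L * sin (x i / L).
have ux : l1 u <= l1 x.
  apply: l1_le => i; rewrite normrM (gtr0_norm L0) mulrC -ler_pdivlMr//.
  by apply: le_trans (normr_sin_le _) _; rewrite normrM normfV (gtr0_norm L0).
have x0 := l1_ge0 x.
have xu : l1 (fun i => x i - u i) <= l1 x ^+ 2 / L.
  apply: (@le_trans _ _ (\sum_i `|x i| * l1 x / L)).
    apply: ler_sum => i _.
    have -> : x i - u i = - (L * (sin (x i / L) - x i / L)).
      by rewrite /u; field; rewrite gt_eqF.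
    rewrite normrN normrM (gtr0_norm L0).
    apply: (@le_trans _ _ (L * (x i / L) ^+ 2)).
      by rewrite ler_pM2l//; exact: sinB_sqr.
    have -> : L * (x i / L) ^+ 2 = x i ^+ 2 / L by field; rewrite gt_eqF.
    rewrite ler_wpM2r ?invr_ge0 ?(ltW L0)//.
    rewrite -[x i ^+ 2]real_normK ?num_real// expr2 ler_wpM2l//.
    exact: le_l1.
  by rewrite -!big_distrl/= -/(l1 x) expr2.
have -> : f x - F x = (f x - f u) + (f u - F x) by ring.
apply: le_trans (ler_normD _ _) _.
have -> : e * (1 + l1 x) ^+ p.+2 = e / 2 * (1 + l1 x) ^+ p.+2 + e / 2 * (1 + l1 x) ^+ p.+2 by field.
have x1 : 1 <= 1 + l1 x by rewrite lerDl.
apply: lerD; last first.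
  apply: le_trans (hF x) _; rewrite ler_peMr ?divr_ge0 ?(ltW e0)// exprn_ege1//.
apply: le_trans (fK x u) _.
apply: (@le_trans _ _ (K * (2 * (1 + l1 x)) ^+ p * (l1 x ^+ 2 / L))).
  apply: ler_pM => //; rewrite ?mulr_ge0 ?exprn_ge0 ?l1_ge0//.
  + by rewrite (le_trans _ (base_ge1 x u)).
  + rewrite ler_wpM2l// lerXn2r ?nnegrE//.
    * by rewrite (le_trans _ (base_ge1 x u)).
    * by rewrite mulr_ge0// addr_ge0.
    * by have := ux; lra.
rewrite mulrA ler_pdivrMr// exprMn.
have hL : K * 2 ^+ p <= e / 2 * L.
  rewrite /L; have := e0; set k := K * _.
  rewrite (_ : 2 * K * 2 ^+ p = 2 * k); last by rewrite /k; ring.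
  move=> _; rewrite mulrDr (_ : e / 2 * (2 * k / e) = k); last by field; rewrite gt_eqF.
  by rewrite lerDl mulr1 divr_ge0// (ltW e0).
have -> : (1 + l1 x) ^+ p.+2 = (1 + l1 x) ^+ p * (1 + l1 x) ^+ 2 by rewrite -exprD addn2.
have w1 : l1 x ^+ 2 <= (1 + l1 x) ^+ 2.
  by rewrite lerXn2r ?nnegrE ?addr_ge0// lerDr.
rewrite (_ : K * (2 ^+ p * (1 + l1 x) ^+ p) * l1 x ^+ 2 =
  (K * 2 ^+ p) * ((1 + l1 x) ^+ p * l1 x ^+ 2)); last by ring.
rewrite (_ : e / 2 * ((1 + l1 x) ^+ p * (1 + l1 x) ^+ 2) * L =
  (e / 2 * L) * ((1 + l1 x) ^+ p * (1 + l1 x) ^+ 2)); last by ring.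
have wp : 0 <= (1 + l1 x) ^+ p by rewrite exprn_ge0// addr_ge0.
apply: ler_pM => //.
- by rewrite mulr_ge0// exprn_ge0.
- by rewrite mulr_ge0// sqr_ge0.
- by rewrite ler_wpM2l.
Qed.
End PolyLip.

(** * Equality in law from equality of characteristic functions *)

Section SameLaw.
Context {R : realType} {I : finType}.

Section One.
Context {d : measure_display} {T : measurableType d}.
Variables (P : probability T R) (X : I -> T -> R).
Hypothesis mX : forall i, mom P (X i).

Lemma mom_l1 : mom P (fun t => 1 + l1 (X^~ t)).
Proof.
by apply: momD; [exact: mom_cst|apply: mom_sum => i; exact: mom_norm].
Qed.

Lemma mom_trig F : trig F -> mom P (fun t => F (X^~ t)).
Proof.
move=> [s hs]; under eq_fun do rewrite hs /trigsum.
apply: mom_sum => p; apply: momZ; apply: mom_cos; apply: measurable_funD => //.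
exact/mom_meas/mom_dot.
Qed.

(** Measurability is obtained from the trigonometric approximations, which converge to f pointwise;
    the moments come from the polynomial growth. *)
Lemma mom_polylip f : polylip f -> mom P (fun t => f (X^~ t)).
Proof.
move=> pf; have [q hq] := polylip_trig pf.
have [C [q' [C0 fC]]] := polylip_growth pf.
apply: (mom_dom _ (fun t => fC (X^~ t))); last by apply: momZ; apply: momX; exact: mom_l1.
have e0 n : 0 < n.+1%:R^-1 :> R by rewrite invr_gt0.
have F_ n : {F : (I -> R) -> R | trig F /\
    forall x, `|f x - F x| <= n.+1%:R^-1 * (1 + l1 x) ^+ q}.
  by apply: cid; have [F ? ?] := hq _ (e0 n); exists F.
apply: (@measurable_fun_cvg _ _ _ _ (fun n t => sval (F_ n) (X^~ t))).
  by move=> n; apply: mom_meas; apply: mom_trig; case: (svalP (F_ n)).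
move=> t _; apply/cvgrPdist_le => e ep; near=> n.
have [_ /(_ (X^~ t))] := svalP (F_ n); move/le_trans; apply.
rewrite mulrC ler_pdivrMr ?ltr0n// mulrC -ler_pdivrMr//.
apply: (@le_trans _ _ n%:R); last by rewrite ler_nat.
by near: n; exact: nbhs_infty_ger.
Unshelve. all: end_near.
Qed.
End One.

Section Two.
Context {d d' : measure_display} {T : measurableType d} {T' : measurableType d'}.
Variables (P : probability T R) (Q : probability T' R).
Variables (X : I -> T -> R) (Y : I -> T' -> R).
Hypotheses (mX : forall i, mom P (X i)) (mY : forall i, mom Q (Y i)).
Hypothesis samecf : forall xi phi, ev P (fun t => cos (dot xi (X^~ t) + phi)) =
                                   ev Q (fun t => cos (dot xi (Y^~ t) + phi)).

Lemma samelaw_trig F : trig F -> ev P (fun t => F (X^~ t)) = ev Q (fun t => F (Y^~ t)).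
Proof.
move=> [s hs].
under [in LHS]eq_fun do rewrite hs /trigsum.
under [in RHS]eq_fun do rewrite hs /trigsum.
have mc p : mom P (fun t => cos (dot p.1.2 (X^~ t) + p.2)).
  by have := mom_trig mX (trig_cos 1 p.1.2 p.2); under eq_fun do rewrite mul1r.
have mc' p : mom Q (fun t => cos (dot p.1.2 (Y^~ t) + p.2)).
  by have := mom_trig mY (trig_cos 1 p.1.2 p.2); under eq_fun do rewrite mul1r.
rewrite !ev_sum; last 2 first.
- by move=> p; apply: momZ; exact: mc'.
- by move=> p; apply: momZ; exact: mc.
apply: eq_bigr => p _; by rewrite !evZ ?samecf.
Qed.

(** Plays the part of the uniqueness theorem for characteristic functions: both sides agree on
    trigonometric polynomials, and the weighted error of [polylip_trig] has finite expectation. *)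
Lemma samelaw_ev f : polylip f -> ev P (fun t => f (X^~ t)) = ev Q (fun t => f (Y^~ t)).
Proof.
move=> pf; have [q hq] := polylip_trig pf.
pose A := ev P (fun t => (1 + l1 (X^~ t)) ^+ q).
pose B := ev Q (fun t => (1 + l1 (Y^~ t)) ^+ q).
have mA := momX q (mom_l1 mX); have mB := momX q (mom_l1 mY).
have A0 : 0 <= A by apply: ev_ge0 => t; rewrite exprn_ge0// addr_ge0// l1_ge0.
have B0 : 0 <= B by apply: ev_ge0 => t; rewrite exprn_ge0// addr_ge0// l1_ge0.
apply/eqP; rewrite -subr_eq0 -normr_le0; apply/ler_addgt0Pr => e e0.
have e1 : 0 < e / (A + B + 1) by rewrite divr_gt0// ltr_wpDl// addr_ge0.
have [F tF hF] := hq _ e1.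
have mf := mom_polylip mX pf; have mf' := mom_polylip mY pf.
have mF := mom_trig mX tF; have mF' := mom_trig mY tF.
have -> : ev P (fun t => f (X^~ t)) - ev Q (fun t => f (Y^~ t)) =
  ev P (fun t => f (X^~ t) - F (X^~ t)) - ev Q (fun t => f (Y^~ t) - F (Y^~ t)).
  by rewrite !evB// (samelaw_trig tF); ring.
apply: le_trans (ler_normB _ _) _.
rewrite add0r (@le_trans _ _ (e / (A + B + 1) * A + e / (A + B + 1) * B))//.
  by rewrite lerD// -evZ//; apply: ev_abs => //; [exact: momB|exact: momZ|exact: momB|exact: momZ].
rewrite -mulrDr mulrAC ler_pdivrMr ?ltr_wpDl ?addr_ge0// ler_pM2l//.
by rewrite lerDl.
Qed.
End Two.
End SameLaw.

Ltac mom_tac := repeat first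
  [ assumption
  | lazymatch goal with
    | |- mom _ (fun t => @?f t + @?g t) => apply: (@momD _ _ _ _ f g)
    | |- mom _ (fun t => - @?f t) => apply: (@momN _ _ _ _ f)
    | |- mom _ (fun t => @?f t * @?g t) => apply: (@momM _ _ _ _ f g)
    | |- mom _ (fun t => @?f t ^+ _) => apply: (@momX _ _ _ _ f)
    | |- mom _ (fun t => `|@?f t|) => apply: (@mom_norm _ _ _ _ f)
    | |- mom ?P (fun t => cos (@?f t)) => apply: (@mom_cos _ _ _ _ f); apply: (@mom_meas _ _ _ P)
    | |- mom ?P (fun t => sin (@?f t)) => apply: (@mom_sin _ _ _ _ f); apply: (@mom_meas _ _ _ P)
    | |- mom _ (fun t => bigop.body _ _ _) => apply: mom_sum => ?
    | |- mom _ (fun t => _) => first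
      [ exact: mom_cst
      | match goal with H : forall _, mom _ _ |- _ => solve [apply: H] end
      | match goal with H : forall _ _, mom _ _ |- _ => solve [apply: H] end ]
    end
  | match goal with H : forall _, mom _ _ |- _ => solve [apply: H] end ].

(** * Wick formula and Stein identity for quadratic forms *)

Section Product.
Context {d d' : measure_display} {T : measurableType d} {U : measurableType d'} {R : realType}.
Variables (P : probability T R) (Q : probability U R).

Definition pprod : probability (T * U)%type R := (P \x Q)%E.

Lemma mom_fst (f : T -> R) : mom P f -> mom pprod (fun z => f z.1).
Proof.
move=> [mf i_f].
have mf1 : measurable_fun setT (fun z : T * U => f z.1).
  exact: (measurableT_comp mf (@measurable_fst _ _ T U)).
split=> // k.
apply/integrable12ltyP.
  apply/measurable_EFinP; apply: measurable_funX; exact: measurableT_comp.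
have /integrableP[_] := i_f k; apply: le_lt_trans; apply: ge0_le_integral => //=.
- by move=> x _; exact: integral_ge0.
- rewrite (_ : (fun x => _) = (fun x => `| `|f x| ^+ k |%:E)); last first.
    by apply/funext => x; rewrite integral_cst//= probability_setT mule1.
  apply/measurable_EFinP; apply: measurableT_comp => //; apply: measurable_funX.
  exact: measurableT_comp.
- apply/measurable_EFinP; apply: measurableT_comp => //; apply: measurable_funX.
  exact: measurableT_comp.
- by move=> x _; rewrite integral_cst//= probability_setT mule1.
Qed.

Lemma mom_snd (g : U -> R) : mom Q g -> mom pprod (fun z => g z.2).
Proof.
move=> [mf i_f].
have mf1 : measurable_fun setT (fun z : T * U => g z.2).
  exact: (measurableT_comp mf (@measurable_snd _ _ T U)).
split=> // k.
apply/integrable12ltyP.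
  apply/measurable_EFinP; apply: measurable_funX; exact: measurableT_comp.
have /integrableP[_] := i_f k; apply: le_lt_trans.
rewrite /= (_ : (fun _ : T => _) = cst (\int[Q]_y `|(`|g y| ^+ k)%:E|)%E)//.
by rewrite integral_cst//= probability_setT mule1.
Qed.

Lemma ev_prod (f : T -> R) (g : U -> R) : mom P f -> mom Q g ->
  ev pprod (fun z => f z.1 * g z.2) = ev P f * ev Q g.
Proof.
move=> mf mg; have m := momM (mom_fst mf) (mom_snd mg).
have e : (\int[pprod]_z (f z.1 * g z.2)%:E = (ev P f * ev Q g)%:E)%E.
  rewrite -(integral12_prod_meas1 (mom_itg m)) /fubini_F/=.
  have e1 x : (\int[Q]_y (f x * g y)%:E = (f x * ev Q g)%:E)%E.
    under eq_integral do rewrite EFinM.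
    rewrite integralZl//; last exact: mom_itg mg.
    by rewrite EFinM /ev /Rintegral fineK//; exact: integrable_fin_num (mom_itg mg).
  under eq_integral do rewrite e1 EFinM.
  rewrite integralZr//; last exact: mom_itg mf.
  rewrite EFinM; congr (_ * _)%E.
  by rewrite /ev /Rintegral fineK//; exact: integrable_fin_num (mom_itg mf).
by rewrite {1}/ev /Rintegral e.
Qed.

Lemma ev_fst (f : T -> R) : mom P f -> ev pprod (fun z => f z.1) = ev P f.
Proof.
move=> mf; have := ev_prod mf (mom_cst 1); rewrite ev_cst mulr1 => <-.
by congr ev; apply/funext => z; rewrite mulr1.
Qed.

Lemma ev_snd (g : U -> R) : mom Q g -> ev pprod (fun z => g z.2) = ev Q g.
Proof.
move=> mf; have := ev_prod (mom_cst 1) mf; rewrite ev_cst mul1r => <-.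
by congr ev; apply/funext => z; rewrite mul1r.
Qed.

End Product.

(** * Covariance and rotation invariance of Gaussian vectors *)

Section GaussFacts.
Context {R : realType} {I : finType} {d : measure_display} {T : measurableType d}.
Variables (P : probability T R) (X : I -> T -> R) (C : I -> I -> R).
Hypothesis gX : gaussv P X C.
Let mX : forall i, mom P (X i) := gX.1.

Lemma qformZ c xi : qform C (fun i => c * xi i) = c ^+ 2 * qform C xi.
Proof.
rewrite /qform big_distrr/=; apply: eq_bigr => a _.
rewrite big_distrr/=; apply: eq_bigr => b _; ring.
Qed.

Lemma dotZ c (xi x : I -> R) : dot (fun i => c * xi i) x = c * dot xi x.
Proof. by rewrite /dot big_distrr/=; apply: eq_bigr => a _; rewrite mulrA. Qed.

Lemma gauss_cos xi phi :
  ev P (fun t => cos (dot xi (X^~ t) + phi)) = expR (- (qform C xi / 2)) * cos phi.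
Proof. exact: gX.2. Qed.

Lemma gauss_sin xi phi :
  ev P (fun t => sin (dot xi (X^~ t) + phi)) = expR (- (qform C xi / 2)) * sin phi.
Proof.
rewrite -(cosBpihalf phi) -gauss_cos; congr ev; apply/funext => t.
by rewrite addrA cosBpihalf.
Qed.

Lemma qform_ge0 xi : 0 <= qform C xi.
Proof.
have := gauss_cos xi 0; rewrite cos0 mulr1 => e.
have : expR (- (qform C xi / 2)) <= expR 0.
  rewrite -e expR0 -(ev_cst P 1); apply: ev_le; [|exact: mom_cst|by move=> t; exact: cos_le1].
  have mL := mom_dot xi mX; mom_tac.
by rewrite ler_expR; lra.
Qed.

(* Moments of a linear form are read off the standard normal law, which has the
   same characteristic function after scaling. *)
Lemma gauss_dot_moments xi : ev P (fun t => dot xi (X^~ t)) = 0 /\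
  ev P (fun t => dot xi (X^~ t) ^+ 2) = qform C xi.
Proof.
have v0 := qform_ge0 xi.
set s := Num.sqrt (qform C xi).
have s2 : s ^+ 2 = qform C xi by rewrite sqr_sqrtr.
have o1 : (1 : R) != 0 by [].
pose N : probability _ R := normal_prob (0 : R) 1.
have mid : mom N (fun x => x).
  by have := normal_mom 0 o1; under eq_fun do rewrite subr0.
pose Y (_ : unit) t := dot xi (X^~ t).
pose Z (_ : unit) (x : measurableTypeR R) : R := s * x.
have mY i : mom P (Y i) by exact: mom_dot.
have mZ i : mom N (Z i) by exact: momZ.
have dot1 (a b : unit -> R) : dot a b = a tt * b tt.
  by rewrite /dot (big_pred1 tt)// => -[].
have cf (c : unit -> R) phi : ev P (fun t => cos (dot c (Y^~ t) + phi)) =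
    ev N (fun x => cos (dot c (Z^~ x) + phi)).
  have := normal_cf 0 o1 (c tt * s) phi.
  rewrite expr1n mulr1 exprMn s2 -qformZ -gauss_cos => e.
  transitivity (ev P (fun t => cos (dot (fun i => c tt * xi i) (X^~ t) + phi))).
    by congr ev; apply/funext => t; rewrite dot1 dotZ.
  by rewrite -e; congr ev; apply/funext => x; rewrite dot1 subr0 mulrA.
have h1 := samelaw_ev mY mZ cf (polylip_coord tt).
have h2 := samelaw_ev mY mZ cf (polylipM (polylip_coord tt) (polylip_coord tt)).
split.
- rewrite [LHS]h1 [LHS]evZ//.
  by have := normal_mean (0 : R) o1; under eq_fun do rewrite subr0; move=> ->; rewrite mulr0.
- transitivity (ev P (fun t => Y tt t * Y tt t)).
    by congr ev; apply/funext => t; rewrite expr2.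
  rewrite h2.
  rewrite (_ : (fun x => _) = fun x : R => s ^+ 2 * (x - 0) ^+ 2); last first.
    by apply/funext => x; rewrite /Z subr0; ring.
  rewrite evZ; last by apply: momX; exact: normal_mom.
  by rewrite normal_var// expr1n mulr1.
Qed.

Let dlt (a : I) : I -> R := fun i => (i == a)%:R.

Lemma dot_delta a x : dot (dlt a) x = x a.
Proof.
rewrite /dot (bigD1 a)//= /dlt eqxx mul1r big1 ?addr0// => i /negbTE ->.
by rewrite mul0r.
Qed.

Lemma gauss_mean a : ev P (X a) = 0.
Proof.
have [<- _] := gauss_dot_moments (dlt a).
by congr ev; apply/funext => t; rewrite dot_delta.
Qed.

(** Polarisation: the variance of X_a + X_b contains C a b + C b a, which symmetry turns into twice
    the covariance. *)
Lemma gauss_cov : (forall a b, C a b = C b a) ->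
  forall a b, ev P (fun t => X a t * X b t) = C a b.
Proof.
move=> symC a b.
have m2 (xi : I -> R) := (gauss_dot_moments xi).2.
have dq (x : I) : \sum_i \sum_j dlt x i * dlt x j * C i j = C x x.
  rewrite (bigD1 x)//= [X in _ + X]big1 ?addr0; last first.
    by move=> i /negbTE ne; rewrite big1// => j _; rewrite /dlt ne !mul0r.
  rewrite (bigD1 x)//= [X in _ + X]big1 ?addr0; last first.
    by move=> i /negbTE ne; rewrite /dlt ne mulr0 mul0r.
  by rewrite /dlt eqxx !mul1r.
have dq2 (x y : I) : \sum_i \sum_j dlt x i * dlt y j * C i j = C x y.
  rewrite (bigD1 x)//= [X in _ + X]big1 ?addr0; last first.
    by move=> i /negbTE ne; rewrite big1// => j _; rewrite /dlt ne !mul0r.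
  rewrite (bigD1 y)//= [X in _ + X]big1 ?addr0; last first.
    by move=> i /negbTE ne; rewrite /dlt ne mulr0 mul0r.
  by rewrite /dlt !eqxx !mul1r.
have haa x : ev P (fun t => X x t ^+ 2) = C x x.
  by have := m2 (dlt x); rewrite /qform dq => <-; congr ev; apply/funext => t; rewrite dot_delta.
have := m2 (fun i => dlt a i + dlt b i).
have -> : qform C (fun i => dlt a i + dlt b i) = C a a + C a b + (C b a + C b b).
  rewrite -{1}(dq a) -(dq2 a b) -{1}(dq2 b a) -(dq b) -!big_split/=.
  apply: eq_bigr => i _; rewrite -!big_split/=; apply: eq_bigr => j _; ring.
rewrite (_ : (fun t => _) = fun t => X a t ^+ 2 + 2 * (X a t * X b t) + X b t ^+ 2); last first.
  apply/funext => t; rewrite -{2}(dot_delta a (X^~ t)) -{2}(dot_delta b (X^~ t)).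
  rewrite -{1}(dot_delta a (X^~ t)) -{1}(dot_delta b (X^~ t)).
  have -> : dot (fun i => dlt a i + dlt b i) (X^~ t) = dot (dlt a) (X^~ t) + dot (dlt b) (X^~ t).
    by rewrite /dot -big_split/=; apply: eq_bigr => i _; rewrite mulrDl.
  ring.
rewrite evD; [|mom_tac..]; rewrite evD; [|mom_tac..]; rewrite evZ; [|mom_tac].
by rewrite !haa (symC b a); lra.
Qed.

(** The addition formula separates the two copies. The sine term of the second copy has zero phase
    and so zero mean, and c^2 + s^2 = 1 recombines the two exponentials. *)
Lemma gauss_rotate c s : c ^+ 2 + s ^+ 2 = 1 ->
  gaussv (pprod P P) (fun i z => c * X i z.1 + s * X i z.2) C.
Proof.
move=> cs.
have m1 i : mom (pprod P P) (fun z => X i z.1) by apply: mom_fst; exact: mX.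
have m2 i : mom (pprod P P) (fun z => X i z.2) by apply: mom_snd; exact: mX.
split=> [i|xi phi]; first by mom_tac.
have mL k ph : mom P (fun t => dot (fun i => k * xi i) (X^~ t) + ph).
  by apply: momD; [exact: mom_dot|exact: mom_cst].
have mc k ph : mom P (fun t => cos (dot (fun i => k * xi i) (X^~ t) + ph)).
  by apply: mom_cos; exact: mom_meas (mL k ph).
have ms k ph : mom P (fun t => sin (dot (fun i => k * xi i) (X^~ t) + ph)).
  by apply: mom_sin; exact: mom_meas (mL k ph).
rewrite (_ : (fun z => _) = fun z : T * T =>
   cos (dot (fun i => c * xi i) (X^~ z.1) + phi) * cos (dot (fun i => s * xi i) (X^~ z.2) + 0) -
   sin (dot (fun i => c * xi i) (X^~ z.1) + phi) * sin (dot (fun i => s * xi i) (X^~ z.2) + 0)); last first.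
  apply/funext => z; rewrite -cosD; congr cos.
  rewrite addr0 addrAC; congr (_ + _); rewrite /dot -big_split/=.
  by apply: eq_bigr => i _; ring.
rewrite evB; last 2 first.
- by apply: momM; [exact: (mom_fst P (mc c phi))|exact: (mom_snd P (mc s 0))].
- by apply: momM; [exact: (mom_fst P (ms c phi))|exact: (mom_snd P (ms s 0))].
rewrite (ev_prod (mc c phi) (mc s 0)) (ev_prod (ms c phi) (ms s 0)).
rewrite !gauss_cos !gauss_sin sin0 cos0 !mulr0 subr0 mulr1 !qformZ.
rewrite mulrAC -expRD; congr (expR _ * _).
by rewrite -opprD -!mulrDl cs mul1r.
Qed.

Lemma gauss_rotate_ev c s f : c ^+ 2 + s ^+ 2 = 1 -> polylip f ->
  ev (pprod P P) (fun z => f (fun i => c * X i z.1 + s * X i z.2)) =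
  ev P (fun t => f (X^~ t)).
Proof.
move=> cs pf; have [m' cf'] := gauss_rotate cs.
apply: (@samelaw_ev _ _ _ _ _ _ _ _ _ _ m' mX) => // xi phi.
by rewrite cf' gauss_cos.
Qed.

End GaussFacts.

Section GaussMoments.
Context {R : realType} {I : finType} {d : measure_display} {T : measurableType d}.
Variables (P : probability T R) (X : I -> T -> R) (C : I -> I -> R).
Hypotheses (gX : gaussv P X C) (symC : forall a b, C a b = C b a).
Let mX : forall i, mom P (X i) := gX.1.
Local Notation PP := (pprod P P).

Let m1 i : mom PP (fun z => X i z.1). Proof. by apply: mom_fst; exact: mX. Qed.
Let m2 i : mom PP (fun z => X i z.2). Proof. by apply: mom_snd; exact: mX. Qed.

(* [X] and [(X + X') / sqrt 2] have the same law, for [X'] an independent copy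
   of [X]; expanding the product in the latter leaves half of the fourth moment
   plus the pairings. *)
Lemma gauss_isserlis a b c e :
  ev P (fun t => X a t * X b t * (X c t * X e t)) =
  C a b * C c e + C a c * C b e + C a e * C b c.
Proof.
pose r : R := (Num.sqrt 2)^-1.
have r2 : r ^+ 2 = 2^-1 by rewrite exprVn sqr_sqrtr.
have rr : r ^+ 2 + r ^+ 2 = 1 by rewrite r2; field.
pose f (x : I -> R) := x a * x b * (x c * x e).
have pf : polylip f.
  by apply: polylipM; apply: polylipM; exact: polylip_coord.
have := gauss_rotate_ev gX rr pf; rewrite /f => h.
set m4 := ev P _ in h *.
have cov := gauss_cov gX symC.
have p22 i j k l : ev PP (fun z => X i z.1 * X j z.1 * (X k z.2 * X l z.2)) = C i j * C k l.
  by rewrite (ev_prod (momM (mX i) (mX j)) (momM (mX k) (mX l))) !cov.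
have p31 i j k l : ev PP (fun z => X i z.1 * X j z.1 * X k z.1 * X l z.2) = 0.
  by rewrite (ev_prod (momM (momM (mX i) (mX j)) (mX k)) (mX l)) (gauss_mean gX) mulr0.
have p13 i j k l : ev PP (fun z => X i z.1 * (X j z.2 * X k z.2 * X l z.2)) = 0.
  by rewrite (ev_prod (mX i) (momM (momM (mX j) (mX k)) (mX l))) (gauss_mean gX) mul0r.
have mm : mom P (fun t => X a t * X b t * (X c t * X e t)) by mom_tac.
have p40 : ev PP (fun z => X a z.1 * X b z.1 * (X c z.1 * X e z.1)) = m4.
  exact: (ev_fst P mm).
have p04 : ev PP (fun z => X a z.2 * X b z.2 * (X c z.2 * X e z.2)) = m4.
  exact: (ev_snd P mm).
move: h; rewrite (_ : (fun z => _) = fun z => r ^+ 2 * r ^+ 2 * (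
    X a z.1 * X b z.1 * (X c z.1 * X e z.1) +
    X a z.2 * X b z.2 * (X c z.2 * X e z.2) +
    X a z.1 * X b z.1 * (X c z.2 * X e z.2) +
    X c z.1 * X e z.1 * (X a z.2 * X b z.2) +
    X a z.1 * X c z.1 * (X b z.2 * X e z.2) +
    X b z.1 * X e z.1 * (X a z.2 * X c z.2) +
    X a z.1 * X e z.1 * (X b z.2 * X c z.2) +
    X b z.1 * X c z.1 * (X a z.2 * X e z.2) +
    X a z.1 * X b z.1 * X c z.1 * X e z.2 +
    X a z.1 * X b z.1 * X e z.1 * X c z.2 +
    X a z.1 * X c z.1 * X e z.1 * X b z.2 +
    X b z.1 * X c z.1 * X e z.1 * X a z.2 +
    X a z.1 * (X b z.2 * X c z.2 * X e z.2) +
    X b z.1 * (X a z.2 * X c z.2 * X e z.2) +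
    X c z.1 * (X a z.2 * X b z.2 * X e z.2) +
    X e z.1 * (X a z.2 * X b z.2 * X c z.2))); last first.
  by apply/funext => z; ring.
rewrite evZ; last by mom_tac.
(* Of the 16 monomials, the eight that are odd in each copy have mean zero. With m4 the moment and S
   the sum of the three pairings, what remains is m4 = (2 m4 + 2 S) / 4. *)
do 15 (rewrite evD; [|by mom_tac|by mom_tac]).
rewrite p40 p04 !p22 !p31 !p13 r2.
have t1 : 2^-1 * 2^-1 = 4^-1 :> R by field.
rewrite t1; lra.
Qed.

Variables (bet : I -> I -> R).
Hypothesis symB : forall a b, bet a b = bet b a.

Let bil (x y : I -> R) := \sum_a \sum_b bet a b * (x a * y b).
Let q0 := \sum_a \sum_b bet a b * C a b.

Definition quad (x : I -> R) := (\sum_a \sum_b bet a b * (x a * x b)) - \sum_a \sum_b bet a b * C a b.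
(** The variance of y -> sum_ab bet a b x_a y_b when y is Gaussian with covariance [C] and x is
    fixed; it is a quarter of the C-energy of the gradient of [quad]. *)
Definition quad_var (x : I -> R) :=
  \sum_a \sum_b \sum_c \sum_e bet a b * bet c e * C b e * (x a * x c).

Let bil_lin (x y : I -> R) c s :
  bil (fun i => c * x i + s * y i) (fun i => c * x i + s * y i) =
  c ^+ 2 * bil x x + 2 * (c * s) * bil x y + s ^+ 2 * bil y y.
Proof.
have sym : bil y x = bil x y.
  rewrite /bil exchange_big/=; apply: eq_bigr => a _; apply: eq_bigr => b _.
  by rewrite (symB b a); ring.
have -> : 2 * (c * s) * bil x y = (c * s) * bil x y + (c * s) * bil y x by rewrite sym; ring.
rewrite /bil !big_distrr/= -!big_split/=; apply: eq_bigr => a _.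
rewrite !big_distrr/= -!big_split/=; apply: eq_bigr => b _; ring.
Qed.

Lemma polylip_quad : polylip quad.
Proof.
apply: polylipD; last exact: polylip_cst.
apply: polylip_sum => a; apply: polylip_sum => b; apply: polylipM; first exact: polylip_cst.
by apply: polylipM; exact: polylip_coord.
Qed.

(* The law of [c X + u X'] with [c^2 + u^2 = 1] does not depend on [u]; the
   identity is the [u^2] coefficient of [E cos (quad (c X + u X') + phi)]. *)
Lemma stein_quad phi :
  ev P (fun t => quad (X^~ t) * sin (quad (X^~ t) + phi)) =
  2 * ev P (fun t => quad_var (X^~ t) * cos (quad (X^~ t) + phi)).
Proof.
have cov := gauss_cov gX symC.
have mq : mom P (fun t => quad (X^~ t)) by exact: (mom_polylip mX polylip_quad).
have mqp : mom P (fun t => quad (X^~ t) + phi) by mom_tac.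
have mS : mom P (fun t => sin (quad (X^~ t) + phi)) by mom_tac.
have mC : mom P (fun t => cos (quad (X^~ t) + phi)) by mom_tac.
pose S (z : T * T) := sin (quad (X^~ z.1) + phi).
pose Cc (z : T * T) := cos (quad (X^~ z.1) + phi).
pose B11 (z : T * T) := bil (X^~ z.1) (X^~ z.1).
pose B12 (z : T * T) := bil (X^~ z.1) (X^~ z.2).
pose B22 (z : T * T) := bil (X^~ z.2) (X^~ z.2).
have mSS : mom PP S by exact: (mom_fst P mS).
have mCC : mom PP Cc by exact: (mom_fst P mC).
have mbil : mom P (fun t => bil (X^~ t) (X^~ t)) by rewrite /bil; mom_tac.
have mB11 : mom PP B11 by exact: (mom_fst P mbil).
have mB22 : mom PP B22 by exact: (mom_snd P mbil).
have mB12 : mom PP B12 by rewrite /B12 /bil; mom_tac.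
have ebil : ev P (fun t => bil (X^~ t) (X^~ t)) = q0.
  rewrite /bil ev_sum; last by move=> a; mom_tac.
  apply: eq_bigr => a _; rewrite ev_sum; last by move=> b; mom_tac.
  by apply: eq_bigr => b _; rewrite evZ ?cov//; mom_tac.
(* The first-order term in u is linear in the independent copy, hence has mean zero; this makes u^2
   the leading order. *)
have e12 : ev PP (fun z => B12 z * S z) = 0.
  rewrite (_ : (fun z => _) = fun z => \sum_a \sum_b bet a b *
      ((X a z.1 * S z) * X b z.2)); last first.
    apply/funext => z; rewrite /B12 /bil big_distrl/=; apply: eq_bigr => a _.
    by rewrite big_distrl/=; apply: eq_bigr => b _; ring.
  rewrite ev_sum; last by move=> a; mom_tac.
  rewrite big1// => a _; rewrite ev_sum; last by move=> b; mom_tac.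
  rewrite big1// => b _; rewrite evZ; last by mom_tac.
  by rewrite (ev_prod (momM (mX a) mS) (mX b)) (gauss_mean gX) !mulr0.
have eqS : ev PP (fun z => (B11 z - B22 z) * S z) =
    ev P (fun t => quad (X^~ t) * sin (quad (X^~ t) + phi)).
  have -> : (fun z => (B11 z - B22 z) * S z) = fun z => B11 z * S z - S z * B22 z.
    by apply/funext => z; ring.
  rewrite evB; [|by mom_tac..].
  rewrite (ev_prod mS mbil) ebil (ev_fst P (momM mbil mS)) mulrC -evZ//.
  by rewrite -evB; [congr ev; apply/funext => t; rewrite /quad /bil /q0; ring|mom_tac..].
have eqC : ev PP (fun z => B12 z ^+ 2 * Cc z) =
    ev P (fun t => quad_var (X^~ t) * cos (quad (X^~ t) + phi)).
  rewrite (_ : (fun z => _) = fun z => \sum_a \sum_b \sum_c \sum_e bet a b * bet c e *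
      ((X a z.1 * X c z.1 * Cc z) * (X b z.2 * X e z.2))); last first.
    apply/funext => z; rewrite expr2 /B12 /bil !big_distrl/=; apply: eq_bigr => a _.
    rewrite !big_distrl/=; apply: eq_bigr => b _.
    rewrite big_distrr/= big_distrl/=; apply: eq_bigr => c _.
    by rewrite big_distrr/= big_distrl/=; apply: eq_bigr => e _; ring.
  rewrite (_ : (fun t => _) = fun t => \sum_a \sum_b \sum_c \sum_e bet a b * bet c e * C b e *
      (X a t * X c t * cos (quad (X^~ t) + phi))); last first.
    apply/funext => t; rewrite /quad_var !big_distrl/=; apply: eq_bigr => a _.
    rewrite !big_distrl/=; apply: eq_bigr => b _.
    rewrite big_distrl/=; apply: eq_bigr => c _.
    by rewrite big_distrl/=; apply: eq_bigr => e _; ring.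
  rewrite !ev_sum; [|by move=> a; mom_tac..]; apply: eq_bigr => a _.
  rewrite !ev_sum; [|by move=> b; mom_tac..]; apply: eq_bigr => b _.
  rewrite !ev_sum; [|by move=> c; mom_tac..]; apply: eq_bigr => c _.
  rewrite !ev_sum; [|by move=> e; mom_tac..]; apply: eq_bigr => e _.
  have mac := momM (momM (mX a) (mX c)) mC; have mbe := momM (mX b) (mX e).
  rewrite evZ; last exact: momM (mom_fst P mac) (mom_snd P mbe).
  by rewrite (ev_prod mac mbe) evZ// cov; ring.
rewrite -eqS -eqC.
set A := ev PP _; set A' := ev PP _.
(* The increment D of the quadratic form under the rotation satisfies |D| <= u Y for 0 < u <= 1, so
   Y^3 controls the cubic Taylor remainder. *)
pose Y z := `|B11 z| + 2 * `|B12 z| + `|B22 z|.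
(* u^3 W controls what D^2 / 2 contains beyond its leading part 2 u^2 B12^2. *)
pose W z := 2 * B12 z ^+ 2 + 2 * `|B12 z| * `|B22 z - B11 z| + (B22 z - B11 z) ^+ 2.
have mY : mom PP (fun z => Y z ^+ 3) by rewrite /Y; mom_tac.
have mW : mom PP W by rewrite /W; mom_tac.
pose M := ev PP (fun z => Y z ^+ 3) + ev PP W.
(* Dividing by u^2 and letting u tend to 0 forces A = 2 A', which is the claim. *)
have key u : 0 < u -> u <= 1 -> `|u ^+ 2 * (2 * A' - A)| <= u ^+ 3 * M.
  move=> u0 u1; set c := Num.sqrt (1 - u ^+ 2).
  have u21 : u ^+ 2 <= 1 by rewrite exprn_ile1// ltW.
  have c2 : c ^+ 2 = 1 - u ^+ 2 by rewrite sqr_sqrtr// subr_ge0.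
  have c0 : 0 <= c by exact: sqrtr_ge0.
  have c1 : c <= 1 by have := sqr_ge0 u; nra.
  have cu : c ^+ 2 + u ^+ 2 = 1 by rewrite c2 subrK.
  pose Xu (z : T * T) i := c * X i z.1 + u * X i z.2.
  (* The first coefficient is c^2 - 1 = - u^2. *)
  pose D z := - u ^+ 2 * B11 z + 2 * (c * u) * B12 z + u ^+ 2 * B22 z.
  have quD z : quad (Xu z) = quad (X^~ z.1) + D z.
    have := bil_lin (X^~ z.1) (X^~ z.2) c u.
    rewrite /quad -/(bil (Xu z) (Xu z)) -/(bil (X^~ z.1) (X^~ z.1)) -/q0 => ->.
    by rewrite c2 /D /B11 /B12 /B22; ring.
  pose f (x : I -> R) := cos (quad x + phi).
  have pf : polylip f.
    apply: polylip_comp; first exact: cos_lip.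
    by apply: polylipD; [exact: polylip_quad|exact: polylip_cst].
  have := gauss_rotate_ev gX cu pf; rewrite -[RHS](ev_fst P mC) -/Cc => efc.
  have mD : mom PP D by rewrite /D; mom_tac.
  have mXu i : mom PP (Xu^~ i) by rewrite /Xu; mom_tac.
  have mf : mom PP (fun z => f (Xu z)) by exact: (@mom_polylip _ _ _ _ PP (fun i z => Xu z i)).
  have DY z : `|D z| <= u * Y z.
    rewrite /D /Y; have h1 := normr_ge0 (B11 z); have h2 := normr_ge0 (B12 z).
    have h3 := normr_ge0 (B22 z).
    apply: le_trans (ler_normD _ _) _.
    apply: le_trans (lerD (ler_normD _ _) (lexx _)) _.
    rewrite !normrM normrN (ger0_norm c0) (gtr0_norm u0) (ger0_norm (sqr_ge0 u)).
    rewrite (@ger0_norm _ 2)//; set b1 := `|_| in h1 *; set b2 := `|_| in h2 *; set b3 := `|_| in h3 *.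
    have uu : u ^+ 2 <= u by nra.
    have cu' : c * u <= u by nra.
    nra.
  have h1 : `|ev PP (fun z => D z * S z + D z ^+ 2 / 2 * Cc z)| <= u ^+ 3 * ev PP (fun z => Y z ^+ 3).
    have -> : ev PP (fun z => D z * S z + D z ^+ 2 / 2 * Cc z) =
       ev PP (fun z => f (Xu z) - (Cc z - D z * S z - D z ^+ 2 / 2 * Cc z)).
      have mr : mom PP (fun z => D z * S z + D z ^+ 2 / 2 * Cc z) by mom_tac.
      have -> : (fun z => f (Xu z) - (Cc z - D z * S z - D z ^+ 2 / 2 * Cc z)) =
        fun z => (f (Xu z) - Cc z) + (D z * S z + D z ^+ 2 / 2 * Cc z).
        by apply/funext => z; ring.
      rewrite [RHS]evD; [|mom_tac..]; rewrite [X in _ = X + _]evB; [|mom_tac..].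
      by rewrite efc subrr add0r.
    rewrite -evZ//; apply: ev_abs; [mom_tac|mom_tac|move=> z].
    rewrite /f quD (_ : quad _ + D z + phi = (quad (X^~ z.1) + phi) + D z); last by ring.
    apply: le_trans (cos_taylor2 _ _) _.
    by rewrite -exprMn lerXn2r ?nnegrE// (le_trans _ (DY z)).
  have Rm z : `|(D z ^+ 2 / 2 - 2 * u ^+ 2 * B12 z ^+ 2) * Cc z| <= u ^+ 3 * W z.
    rewrite normrM -[leRHS]mulr1; apply: ler_pM => //; last exact: cos_max.
    have -> : D z ^+ 2 / 2 - 2 * u ^+ 2 * B12 z ^+ 2 =
       - (2 * u ^+ 4 * B12 z ^+ 2) + 2 * u ^+ 3 * c * (B12 z * (B22 z - B11 z)) + u ^+ 4 * (B22 z - B11 z) ^+ 2 / 2.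
      have -> : D z = u * (2 * c * B12 z + u * (B22 z - B11 z)) by rewrite /D; ring.
      rewrite (_ : (u * _) ^+ 2 = u ^+ 2 * (4 * c ^+ 2 * B12 z ^+ 2 +
         4 * c * u * B12 z * (B22 z - B11 z) + u ^+ 2 * (B22 z - B11 z) ^+ 2)); last by ring.
      by rewrite c2; field.
    rewrite /W; set b := B12 z; set g := B22 z - B11 z.
    apply: le_trans (ler_normD _ _) _.
    apply: le_trans (lerD (ler_normD _ _) (lexx _)) _.
    have b2 : 0 <= b ^+ 2 by exact: sqr_ge0.
    have g2 : 0 <= g ^+ 2 by exact: sqr_ge0.
    have bg := mulr_ge0 (normr_ge0 b) (normr_ge0 g).
    have u3 : 0 <= u ^+ 3 by rewrite exprn_ge0// ltW.
    have u4 : 0 <= u ^+ 4 by rewrite exprn_ge0// ltW.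
    have u43 : u ^+ 4 <= u ^+ 3 by rewrite (exprS u 3) ler_piMl.
    have n1 : `|- (2 * u ^+ 4 * b ^+ 2)| = 2 * u ^+ 4 * b ^+ 2.
      by rewrite normrN ger0_norm//; apply: mulr_ge0 => //; apply: mulr_ge0.
    have n2 : `|2 * u ^+ 3 * c * (b * g)| = 2 * u ^+ 3 * c * (`|b| * `|g|).
      rewrite normrM (normrM b g) (@ger0_norm _ (2 * u ^+ 3 * c))//.
      by apply: mulr_ge0 => //; apply: mulr_ge0.
    have n3 : `|u ^+ 4 * g ^+ 2 / 2| = u ^+ 4 * g ^+ 2 / 2.
      by rewrite ger0_norm//; apply: divr_ge0 => //; apply: mulr_ge0.
    rewrite n1 n2 n3.
    rewrite -[2 * `|b| * `|g|]mulrA; move: (`|b| * `|g|) bg => bg' bg.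
    have k1 : u ^+ 4 * b ^+ 2 <= u ^+ 3 * b ^+ 2 by rewrite ler_wpM2r.
    have k2 : u ^+ 4 * g ^+ 2 <= u ^+ 3 * g ^+ 2 by rewrite ler_wpM2r.
    have k3 : u ^+ 3 * c * bg' <= u ^+ 3 * bg' by rewrite ler_wpM2r// ler_piMr.
    have k4 : 0 <= u ^+ 3 * g ^+ 2 by rewrite mulr_ge0.
    by lra.
  have h2 : `|ev PP (fun z => (D z ^+ 2 / 2 - 2 * u ^+ 2 * B12 z ^+ 2) * Cc z)| <= u ^+ 3 * ev PP W.
    by rewrite -evZ//; apply: ev_abs => //; mom_tac.
  have -> : u ^+ 2 * (2 * A' - A) = ev PP (fun z => D z * S z + D z ^+ 2 / 2 * Cc z) -
     ev PP (fun z => (D z ^+ 2 / 2 - 2 * u ^+ 2 * B12 z ^+ 2) * Cc z).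
    rewrite -evB; [|mom_tac..].
    transitivity (ev PP (fun z => 2 * u ^+ 2 * (B12 z ^+ 2 * Cc z) - u ^+ 2 * ((B11 z - B22 z) * S z) +
       2 * (c * u) * (B12 z * S z))); last first.
      by congr ev; apply/funext => z; rewrite /D; ring.
    rewrite evD; [|mom_tac..]; rewrite evB; [|mom_tac..].
    do 3 (rewrite evZ; [|by mom_tac]).
    by rewrite e12 mulr0 addr0 /A /A'; ring.
  by apply: le_trans (ler_normB _ _) _; rewrite /M mulrDr; exact: lerD.
have M0 : 0 <= M.
  by have := key 1 ltr01 (lexx _); rewrite !expr1n !mul1r; apply: le_trans.
suff : `|2 * A' - A| <= 0 by rewrite normr_le0 subr_eq0 => /eqP.
apply/ler_addgt0Pr => e e0; rewrite add0r.
have M1 : 0 < M + 1 by rewrite ltr_wpDl.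
have [u [u0 u1 ue]] : exists u, [/\ 0 < u, u <= 1 & u * (M + 1) <= e].
  exists (Num.min 1 (e / (M + 1))); split.
  - by rewrite lt_min ltr01 divr_gt0.
  - by rewrite ge_min lexx.
  - by rewrite -ler_pdivlMr// ge_min lexx orbT.
have := key u u0 u1; rewrite normrM (ger0_norm (sqr_ge0 u)).
rewrite (_ : u ^+ 3 * M = u ^+ 2 * (u * M)); last by ring.
rewrite ler_pM2l ?exprn_gt0// => h; apply: le_trans h _.
by apply: le_trans ue; rewrite ler_pM2l// lerDl.
Qed.

End GaussMoments.

(** * Euclidean norm and 1-Lipschitz test functions *)

Section L2Norm.
Context {R : realType} {I : finType}.
Implicit Types (x y z : I -> R).

Definition nrm z : R := Num.sqrt (\sum_i z i ^+ 2).

Lemma sumsq_ge0 z : 0 <= \sum_i z i ^+ 2.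
Proof. by apply: sumr_ge0 => i _; exact: sqr_ge0. Qed.

Lemma nrm_ge0 z : 0 <= nrm z. Proof. exact: sqrtr_ge0. Qed.

Lemma sqr_nrm z : nrm z ^+ 2 = \sum_i z i ^+ 2.
Proof. by rewrite sqr_sqrtr// sumsq_ge0. Qed.

Lemma nrm_le x y : (forall i, `|x i| <= `|y i|) -> nrm x <= nrm y.
Proof.
move=> xy; rewrite ler_sqrt ?sumsq_ge0//; apply: ler_sum => i _.
by rewrite -[x i ^+ 2]real_normK ?num_real// -[y i ^+ 2]real_normK ?num_real// lerXn2r ?nnegrE.
Qed.

Lemma nrmZ a z : nrm (fun i => a * z i) = `|a| * nrm z.
Proof.
rewrite /nrm -sqrtr_sqr -sqrtrM ?sqr_ge0//; congr Num.sqrt.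
by rewrite big_distrr/=; apply: eq_bigr => i _; rewrite exprMn.
Qed.

Lemma nrm_le_l1 z : nrm z <= l1 z.
Proof.
rewrite -[leRHS]ger0_norm ?l1_ge0// -sqrtr_sqr ler_sqrt ?sqr_ge0//.
rewrite expr2 {1}/l1 big_distrl/=; apply: ler_sum => i _.
by rewrite -[z i ^+ 2]real_normK ?num_real// expr2 ler_wpM2l// le_l1.
Qed.

Lemma nrm_dot_self z : dot z z = nrm z ^+ 2.
Proof. by rewrite sqr_nrm; apply: eq_bigr => i _; rewrite expr2. Qed.

Definition lip1 (g : (I -> R) -> R) :=
  forall x y, `|g x - g y| <= nrm (fun i => x i - y i).

Lemma lip1_l1 g : lip1 g -> forall x y, `|g x - g y| <= 1 * l1 (fun i => x i - y i).
Proof. by move=> hg x y; rewrite mul1r; apply: le_trans (hg x y) (nrm_le_l1 _). Qed.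

Lemma lip1_polylip g : lip1 g -> polylip g.
Proof. by move=> hg; apply: (@polylip_lip _ _ _ 1) => //; exact: lip1_l1. Qed.

Lemma dotC x y : dot x y = dot y x.
Proof. by apply: eq_bigr => i _; rewrite mulrC. Qed.

Lemma dotDr x y z : dot x (fun i => y i + z i) = dot x y + dot x z.
Proof. by rewrite /dot -big_split/=; apply: eq_bigr => i _; rewrite mulrDr. Qed.

Lemma dotDl x y z : dot (fun i => y i + z i) x = dot y x + dot z x.
Proof. by rewrite dotC dotDr !(dotC x). Qed.

Lemma dotZr a x y : dot x (fun i => a * y i) = a * dot x y.
Proof. by rewrite dotC dotZ dotC. Qed.

End L2Norm.

Section EvNorm.
Context {R : realType} {d : measure_display} {T : measurableType d}.
Variable P : probability T R.

Lemma mom_sqrt (f : T -> R) : mom P f -> mom P (fun t => Num.sqrt (f t)).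
Proof.
move=> mf; apply: (mom_dom _ _ (momD (mom_cst 1) (mom_norm mf))).
  apply: (measurableT_comp _ (mom_meas mf)).
  by apply: continuous_measurable_fun; exact: sqrt_continuous.
move=> t; rewrite ger0_norm ?sqrtr_ge0//.
have [f0|f0] := leP 0 (f t); last by rewrite ltr0_sqrtr// addr_ge0.
rewrite (ger0_norm f0); have := sqr_sqrtr f0; have := sqrtr_ge0 (f t).
by move: (Num.sqrt _) => z z0 <-; have := sqr_ge0 (z - 1 / 2); nra.
Qed.

Lemma ev_le_sqrt (f : T -> R) : mom P f -> ev P f <= Num.sqrt (ev P (fun t => f t ^+ 2)).
Proof.
move=> mf; apply: le_trans (ler_norm _) _.
by rewrite -sqrtr_sqr ler_sqrt ?ev_sqr//; apply: ev_ge0 => t; exact: sqr_ge0.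
Qed.

Lemma mom_nrm (J : finType) (X : J -> T -> R) : (forall i, mom P (X i)) ->
  mom P (fun t => nrm (X^~ t)).
Proof. by move=> mX; apply: mom_sqrt; apply: mom_sum => i; apply: momX. Qed.

Lemma ev_nrm_le (J : finType) (X : J -> T -> R) : (forall i, mom P (X i)) ->
  ev P (fun t => nrm (X^~ t)) <= Num.sqrt (\sum_i ev P (fun t => X i t ^+ 2)).
Proof.
move=> mX; apply: le_trans (ev_le_sqrt (mom_nrm mX)) _.
rewrite (_ : (fun t => _) = fun t => \sum_i X i t ^+ 2); last first.
  by apply/funext => t; rewrite sqr_nrm.
by rewrite ev_sum// => i; apply: momX.
Qed.
End EvNorm.

(** * Gaussian integration by parts and its Lipschitz version *)

Section GaussIbp.
Context {R : realType} {I : finType} {d : measure_display} {T : measurableType d}.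
Variables (P : probability T R) (S : I -> T -> R) (C : I -> I -> R).
Hypotheses (gS : gaussv P S C) (symC : forall a b, C a b = C b a).
Let mS : forall i, mom P (S i) := gS.1.

Definition mxact (v : I -> R) a := \sum_b C a b * v b.

Lemma qformE xi : qform C xi = dot xi (mxact xi).
Proof.
rewrite /qform /dot; apply: eq_bigr => a _; rewrite /mxact big_distrr/=.
by apply: eq_bigr => b _; ring.
Qed.

Lemma dot_mxact x y : dot x (mxact y) = dot y (mxact x).
Proof.
rewrite /dot /mxact; under eq_bigr do rewrite big_distrr/=.
under [RHS]eq_bigr do rewrite big_distrr/=.
rewrite exchange_big/=; apply: eq_bigr => a _; apply: eq_bigr => b _.
by rewrite symC; ring.
Qed.

Lemma mxactD x y : mxact (fun i => x i + y i) = fun i => mxact x i + mxact y i.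
Proof.
by apply/funext => i; rewrite /mxact -big_split/=; apply: eq_bigr => b _; rewrite mulrDr.
Qed.

Lemma mxactZ a x : mxact (fun i => a * x i) = fun i => a * mxact x i.
Proof.
by apply/funext => i; rewrite /mxact big_distrr/=; apply: eq_bigr => b _; ring.
Qed.

Lemma qformDZ h xi v : qform C (fun i => xi i + h * v i) =
  qform C xi + 2 * h * dot v (mxact xi) + h ^+ 2 * qform C v.
Proof.
by rewrite !qformE mxactD mxactZ !(dotDl, dotDr, dotZr, dotZ) (dot_mxact xi v); ring.
Qed.

(** Differentiate h -> E cos(<xi + h v, S> + psi) at h = 0 twice over: under the expectation, and on
    the closed form of the characteristic function. *)
Lemma gauss_ibp v xi psi :
  ev P (fun t => dot v (S^~ t) * sin (dot xi (S^~ t) + psi)) =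
  dot v (mxact xi) * (expR (- (qform C xi / 2)) * cos psi).
Proof.
have mv := mom_dot v mS; have mxi := momD (mom_dot xi mS) (mom_cst psi).

pose F (h : R) := expR (- (qform C xi / 2) - h * dot v (mxact xi) - h ^+ 2 * (qform C v / 2)) * cos psi.
have FE : (fun h => ev P (fun t => cos (h * dot v (S^~ t) + (dot xi (S^~ t) + psi)))) = F.
  apply/funext => h; have := gauss_cos gS (fun i => xi i + h * v i) psi.
  rewrite qformDZ => e.
  rewrite /F (_ : - _ - _ - _ = - ((qform C xi + 2 * h * dot v (mxact xi) + h ^+ 2 * qform C v) / 2)); last by field.
  rewrite -e; congr ev; apply/funext => t; congr cos.
  by rewrite dotDl dotZ; ring.
have h2 : is_derive (0 : R) (1 : R) F (- (dot v (mxact xi) * (expR (- (qform C xi / 2)) * cos psi))).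
  apply: is_derive_eq; rewrite /GRing.scale/=.
  rewrite (_ : - _ - 0 * _ - _ = - (qform C xi / 2)); last by ring.
  ring.
have h1 := is_derive_ev_cos 0 mv mxi; rewrite FE in h1.
have := @derive_val _ _ _ _ _ _ _ h1; rewrite (@derive_val _ _ _ _ _ _ _ h2) => /eqP.
rewrite eqr_opp => /eqP ->; congr ev; apply/funext => t.
by rewrite mul0r add0r.
Qed.

Variable (kap : R).
Hypothesis kap0 : 0 < kap.

(** An eigenvector v of C is C-orthogonal to its Euclidean orthogonal complement, so the reflection
    along v preserves the quadratic form of C and hence the Gaussian law. This is where the
    eigenspace condition enters. *)
Lemma gauss_reflect v : mxact v = (fun i => kap * v i) -> 0 < nrm v ->
  gaussv P (fun i t => S i t + - (2 * dot v (S^~ t) / nrm v ^+ 2) * v i) C.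
Proof.
move=> Cv v0; have v2 : nrm v ^+ 2 != 0 by rewrite expf_neq0// gt_eqF.
have mv := mom_dot v mS.
split=> [i|xi phi].
  apply: momD; first exact: mS.
  apply: momM; last exact: mom_cst.
  apply: momN; apply: momM; last exact: mom_cst.
  exact: momZ.
pose h := - (2 * dot v xi / nrm v ^+ 2).
have -> : qform C xi = qform C (fun i => xi i + h * v i).
  rewrite qformDZ (qformE v) (dot_mxact v xi) Cv !dotZr nrm_dot_self (dotC xi v) /h; by field; rewrite gt_eqF.
rewrite -(gauss_cos gS); congr ev; apply/funext => t; congr (cos (_ + _)).
rewrite dotDl dotZ dotDr dotZr /h (dotC v xi); ring.
Qed.

(* Antisymmetrising under the reflection along [v] turns [dot v S] into a
   finite difference of [g], so no derivative of [g] is needed. *)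
Lemma gauss_lip_bound g v y r : lip1 g -> 0 <= r -> mxact v = (fun i => kap * v i) ->
  `|ev P (fun t => dot v (S^~ t) * g (fun i => y i + r * S i t))| <= kap * r * nrm v.
Proof.
move=> hg r0 Cv.
have := nrm_ge0 v; rewrite le_eqVlt => /predU1P[v0|v0].
  have vi i : v i = 0.
    apply/eqP; rewrite -sqrf_eq0; apply/eqP.
    have := sqr_nrm v; rewrite -v0 expr0n/= => /esym/psumr_eq0P; apply=> // j _.
    exact: sqr_ge0.
  rewrite (_ : (fun t => _) = fun=> 0); last first.
    by apply/funext => t; rewrite /dot big1 ?mul0r// => i _; rewrite vi mul0r.
  by rewrite ev_cst normr0 -v0 mulr0.
have gS' := gauss_reflect Cv v0.
set S' := (fun i t => _) in gS'.
have v2 : nrm v ^+ 2 != 0 by rewrite expf_neq0// gt_eqF.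
pose f (x : I -> R) := dot v x * g (fun i => y i + r * x i).
have pg : polylip (fun x : I -> R => g (fun i => y i + r * x i)).
  apply: (@polylip_lip _ _ _ r) => // x x'; apply: le_trans (hg _ _) _.
  apply: le_trans (nrm_le_l1 _) _; rewrite /l1 big_distrr/=; apply: ler_sum => i _.
  by rewrite opprD addrACA subrr add0r -mulrBr normrM ger0_norm.
have pf : polylip f by apply: polylipM => //; exact: polylip_dot.
have mf : mom P (fun t => f (S^~ t)) by exact: mom_polylip.
have mf' : mom P (fun t => f (S'^~ t)) by exact: (mom_polylip gS'.1).
have ef : ev P (fun t => f (S^~ t)) = ev P (fun t => f (S'^~ t)).
  apply: samelaw_ev => //; first exact: gS'.1.
  by move=> xi phi; rewrite gS'.2 gS.2.
have vS' t : dot v (S'^~ t) = - dot v (S^~ t).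
  by rewrite /S' dotDr dotZr nrm_dot_self; field; rewrite gt_eqF.
have mv := mom_dot v mS.
(* The reflection changes the sign of L = <v, S> and moves S by 2 |L| / |v|, so the average is at
   most r L^2 / |v|; finally E L^2 = kap |v|^2. *)
have -> : ev P (fun t => f (S^~ t)) = ev P (fun t => 2^-1 * (f (S^~ t) + f (S'^~ t))).
  by rewrite evZ ?evD//; [rewrite -ef; field|exact: momD].
apply: (@le_trans _ _ (ev P (fun t => r / nrm v * dot v (S^~ t) ^+ 2))).
  apply: ev_abs; first by apply: momZ; exact: momD.
    by apply: momZ; exact: momX.
  move=> t; rewrite /f vS' mulNr -mulrBr normrM ger0_norm// normrM.
  rewrite ler_pdivrMl//; set L := dot v (S^~ t).
  apply: (@le_trans _ _ (`|L| * (r * (2 * `|L| / nrm v)))).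
    apply: ler_wpM2l => //; apply: le_trans (hg _ _) _.
    rewrite (_ : (fun i => _) = fun i => (r * (2 * L / nrm v ^+ 2)) * v i); last first.
      by apply/funext => i; rewrite /S' -/L; ring.
    rewrite nrmZ normrM (ger0_norm r0) !normrM normfV (ger0_norm (sqr_ge0 _)) (@ger0_norm _ 2)//.
    by rewrite le_eqVlt; apply/orP; left; apply/eqP; field; rewrite gt_eqF.
  rewrite -[L ^+ 2]real_normK ?num_real//.
  by rewrite le_eqVlt; apply/orP; left; apply/eqP; field; rewrite gt_eqF.
rewrite evZ; last exact: momX.
rewrite (gauss_dot_moments gS v).2 qformE Cv dotZr nrm_dot_self.
by rewrite le_eqVlt; apply/orP; left; apply/eqP; field; rewrite gt_eqF.
Qed.

End GaussIbp.

(** * Interpolation *)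

Section HessianBound.
Context {R : realType} {I : finType} {d : measure_display} {U : measurableType d}.
Variables (Q : probability U R) (S : I -> U -> R) (C : I -> I -> R) (kap : R).
Hypotheses (gS : gaussv Q S C) (symC : forall a b, C a b = C b a) (kap0 : 0 < kap).
Let mS : forall i, mom Q (S i) := gS.1.

Definition hsn (M : I -> I -> R) : R := nrm (fun ab : I * I => M ab.1 ab.2).

(** The image of a symmetric matrix is spanned by its rows, so it lies in the eigenspace of [C] as
    soon as they do; M S is then an admissible direction for the Lipschitz bound. *)
Lemma mxact_mxact (M : I -> I -> R) w : (forall a b, M a b = M b a) ->
  (forall a, mxact C (M a) = fun i => kap * M a i) ->
  mxact C (mxact M w) = fun i => kap * mxact M w i.
Proof.
move=> symM hM; apply/funext => c; rewrite /mxact.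
under eq_bigr do rewrite big_distrr/=.
rewrite exchange_big/= big_distrr/=; apply: eq_bigr => b _.
have := congr1 (fun f => f c) (hM b); rewrite /mxact => e.
rewrite (symM c b) mulrA -e big_distrl/=; apply: eq_bigr => a _.
by rewrite (symM a b) mulrA.
Qed.

Variables (s : seq (R * (I -> R) * R)) (g : (I -> R) -> R) (eps : R).
Hypotheses (hg : lip1 g) (sg : forall x, `|g x - trigsum s x| <= eps).

Let mtrig (x : I -> R) r : mom Q (fun t => trigsum s (fun i => x i + r * S i t)).
Proof.
apply: (@mom_trig _ _ _ _ _ (fun i t => x i + r * S i t)); last by exists s.
by move=> i; apply: momD; [exact: mom_cst|exact: momZ].
Qed.

(** The trigonometric sum is traded for the Lipschitz g at the cost eps E|<v, S>| <= eps sqrt(kap)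
    |v|, after which [gauss_lip_bound] applies. *)
Let inner_bound x r v : 0 <= r -> mxact C v = (fun i => kap * v i) ->
  `|ev Q (fun t => dot v (S^~ t) * trigsum s (fun i => x i + r * S i t))| <=
  (kap * r + eps * Num.sqrt kap) * nrm v.
Proof.
move=> r0 Cv; have mv := mom_dot v mS.
have eps0 : 0 <= eps by apply: le_trans (sg (fun=> 0)).
have mg : mom Q (fun t => g (fun i => x i + r * S i t)).
  apply: (@mom_polylip _ _ _ _ _ (fun i t => x i + r * S i t)); last exact: lip1_polylip.
  by move=> i; apply: momD; [exact: mom_cst|exact: momZ].
have mt := mtrig x r.
rewrite (_ : (fun t => _) = fun t => dot v (S^~ t) * g (fun i => x i + r * S i t) -
  dot v (S^~ t) * (g (fun i => x i + r * S i t) - trigsum s (fun i => x i + r * S i t))); last first.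
  by apply/funext => t; ring.
rewrite evB; [|exact: momM|by apply: momM => //; exact: momB].
apply: le_trans (ler_normB _ _) _; rewrite mulrDl; apply: lerD.
  exact: (gauss_lip_bound gS symC).
apply: (@le_trans _ _ (ev Q (fun t => eps * `|dot v (S^~ t)|))).
  apply: ev_abs; [by apply: momM => //; exact: momB|by apply: momZ; exact: mom_norm|].
  by move=> t; rewrite normrM mulrC ler_wpM2r.
rewrite evZ; last exact: mom_norm.
rewrite -mulrA ler_wpM2l//; apply: le_trans (ev_le_sqrt (mom_norm mv)) _.
rewrite (_ : (fun t => _) = fun t => dot v (S^~ t) ^+ 2); last first.
  by apply/funext => t; rewrite real_normK ?num_real.
rewrite (gauss_dot_moments gS v).2 qformE Cv dotZr nrm_dot_self sqrtrM ?(ltW kap0)//.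
by rewrite sqrtr_sqr ger0_norm// nrm_ge0.
Qed.

Let inner_eq x r v : mxact C v = (fun i => kap * v i) ->
  ev Q (fun t => dot v (S^~ t) * trigsum s (fun i => x i + r * S i t)) =
  \sum_(p <- s) - (r * kap) * p.1.1 * expR (- (r ^+ 2 * qform C p.1.2 / 2)) *
     (dot v p.1.2 * sin (dot p.1.2 x + p.2)).
Proof.
move=> Cv; have mv := mom_dot v mS.
have mt (p : R * (I -> R) * R) ps : mom Q (fun t => dot v (S^~ t) * sin (dot (fun i => r * p.1.2 i) (S^~ t) + ps)).
  apply: momM => //; apply: mom_sin; apply: (@mom_meas _ _ _ Q); apply: momD; last exact: mom_cst.
  exact: mom_dot.
rewrite (_ : (fun t => _) = fun t => \sum_(p <- s) p.1.1 * (dot v (S^~ t) *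
   sin (dot (fun i => r * p.1.2 i) (S^~ t) + (dot p.1.2 x + p.2 + pi / 2)))); last first.
  apply/funext => t; rewrite /trigsum big_distrr/=; apply: eq_bigr => p _.
  rewrite -sinDpihalf mulrCA; congr (_ * (_ * sin _)).
  by rewrite dotDr dotZr dotZ; ring.
rewrite ev_sum; last by move=> p; apply: momZ.
apply: eq_bigr => p _; rewrite evZ// (gauss_ibp gS symC).
rewrite cosDpihalf mxactZ dotZr (dot_mxact symC) Cv dotZr (dotC _ v) qformZ; ring.
Qed.

(** Up to sign, the sum is the contraction of M with the Hessian at x of the smoothing of
    [trigsum s] by r S + r S', with S and S' independent copies. Integrating by parts in both gives
    (r kap)^-2 E[<M S, S'> f(x + r S + r S')]; for fixed S, [inner_bound] is used in the direction M
    S. *)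
Lemma hessian_bound (M : I -> I -> R) x r : 0 < r -> (forall a b, M a b = M b a) ->
  (forall a, mxact C (M a) = fun i => kap * M a i) ->
  `|\sum_(p <- s) p.1.1 * dot p.1.2 (mxact M p.1.2) *
      (expR (- (r ^+ 2 * qform C p.1.2)) * cos (dot p.1.2 x + p.2))| <=
  hsn M * ((Num.sqrt kap * r)^-1 + eps / (kap * r ^+ 2)).
Proof.
move=> r0 symM hM; set D := \sum_(p <- s) _.
have eps0 : 0 <= eps by apply: le_trans (sg (fun=> 0)).
(* The expectation over the inner copy, by [inner_eq], with the outer copy frozen at [S^~ t]. *)
pose inner t := \sum_(p <- s) - (r * kap) * p.1.1 * expR (- (r ^+ 2 * qform C p.1.2 / 2)) *
     (dot (mxact M (S^~ t)) p.1.2 * sin (dot p.1.2 (fun i => x i + r * S i t) + p.2)).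
have mMS b : mom Q (fun t => mxact M (S^~ t) b) by apply: mom_sum => a; exact: momZ.
have mdot (p : R * (I -> R) * R) : mom Q (fun t => dot (mxact M p.1.2) (S^~ t) *
     sin (dot (fun i => r * p.1.2 i) (S^~ t) + (dot p.1.2 x + p.2))).
  apply: momM; first exact: mom_dot.
  apply: mom_sin; apply: (@mom_meas _ _ _ Q); apply: momD; last exact: mom_cst.
  exact: mom_dot.
have innerE : inner = fun t => \sum_(p <- s) (- (r * kap) * p.1.1 * expR (- (r ^+ 2 * qform C p.1.2 / 2))) *
     (dot (mxact M p.1.2) (S^~ t) * sin (dot (fun i => r * p.1.2 i) (S^~ t) + (dot p.1.2 x + p.2))).
  apply/funext => t; apply: eq_bigr => p _; congr (_ * (_ * sin _)).
    by rewrite dotC (dot_mxact symM) dotC.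
  by rewrite dotDr dotZr dotZ; ring.
have minner : mom Q inner by rewrite innerE; apply: mom_sum => p; apply: momZ.
have einner : ev Q inner = - (r ^+ 2 * kap ^+ 2) * D.
  rewrite innerE ev_sum; last by move=> p; apply: momZ.
  rewrite big_distrr/=; apply: eq_bigr => p _; rewrite evZ// (gauss_ibp gS symC).
  rewrite mxactZ dotZr (dot_mxact symC) (mxact_mxact _ symM hM) dotZr qformZ.
  rewrite (_ : expR (- (r ^+ 2 * qform C p.1.2)) =
     expR (- (r ^+ 2 * qform C p.1.2 / 2)) * expR (- (r ^+ 2 * qform C p.1.2 / 2))); last first.
    by rewrite -expRD; congr expR; field.
  ring.
have binner t : `|inner t| <= (kap * r + eps * Num.sqrt kap) * nrm (mxact M (S^~ t)).
  have Cv := mxact_mxact (S^~ t) symM hM.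
  by have := inner_bound (fun i => x i + r * S i t) (ltW r0) Cv; rewrite inner_eq.
have k0 : 0 <= kap * r + eps * Num.sqrt kap.
  by rewrite addr_ge0// mulr_ge0// ?sqrtr_ge0// ltW.
(* E |M S|^2 = kap |M|^2, row by row, since every row of M is an eigenvector. *)
have bn : ev Q (fun t => nrm (mxact M (S^~ t))) <= Num.sqrt kap * hsn M.
  apply: le_trans (ev_nrm_le mMS) _.
  rewrite /hsn /nrm -sqrtrM ?(ltW kap0)// -(pair_bigA _ (fun a b => M a b ^+ 2))/=.
  rewrite big_distrr/= ler_sqrt; last first.
    apply: sumr_ge0 => a _; apply: mulr_ge0; first exact: ltW.
    by apply: sumr_ge0 => b _; exact: sqr_ge0.
  apply: ler_sum => a _; rewrite le_eqVlt; apply/orP; left; apply/eqP.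
  have := (gauss_dot_moments gS (M a)).2; rewrite qformE hM dotZr nrm_dot_self sqr_nrm => <-.
  by [].
have : `|- (r ^+ 2 * kap ^+ 2) * D| <= (kap * r + eps * Num.sqrt kap) * (Num.sqrt kap * hsn M).
  rewrite -einner; apply: (@le_trans _ _ (ev Q (fun t => (kap * r + eps * Num.sqrt kap) * nrm (mxact M (S^~ t))))).
    by apply: ev_abs => //; apply: momZ; exact: mom_nrm.
  by rewrite evZ ?ler_wpM2l//; exact: mom_nrm.
have rk : 0 < r ^+ 2 * kap ^+ 2 by rewrite mulr_gt0// exprn_gt0.
rewrite normrM normrN (gtr0_norm rk) -ler_pdivlMl// => h; apply: le_trans h _.
rewrite le_eqVlt; apply/orP; left; apply/eqP.
have k2 : Num.sqrt kap ^+ 2 = kap by rewrite sqr_sqrtr// ltW.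
have sk : Num.sqrt kap != 0 by rewrite gt_eqF// sqrtr_gt0.
move: (Num.sqrt kap) sk k2 => k sk <-; field.
by rewrite sk gt_eqF.
Qed.

End HessianBound.

Section Interpolation.
Context {R : realType} {I : finType} {d d' : measure_display}
  {T : measurableType d} {U : measurableType d'}.
Variables (P : probability T R) (Q : probability U R).
Variables (F : I -> T -> R) (S : I -> U -> R) (C : I -> I -> R) (kap : R).
Variable tau : T -> I -> I -> R.
Hypotheses (gS : gaussv Q S C) (symC : forall a b, C a b = C b a) (kap0 : 0 < kap).
Hypothesis CC : forall a, mxact C (C a) = fun i => kap * C a i.
Hypotheses (mF : forall i, mom P (F i)) (mtau : forall a b, mom P (fun t => tau t a b)).
Hypothesis symtau : forall t a b, tau t a b = tau t b a.
Hypothesis Ctau : forall t a, mxact C (tau t a) = fun i => kap * tau t a i.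
Hypothesis stein : forall xi phi,
  ev P (fun t => dot xi (F^~ t) * sin (dot xi (F^~ t) + phi)) =
  ev P (fun t => dot xi (mxact (tau t) xi) * cos (dot xi (F^~ t) + phi)).
Let mS : forall i, mom Q (S i) := gS.1.

Let M t a b := C a b - tau t a b.

Let symM t a b : M t a b = M t b a.
Proof. by rewrite /M symC symtau. Qed.

Let CM t a : mxact C (M t a) = fun i => kap * M t a i.
Proof.
have -> : M t a = fun i => C a i + (-1) * tau t a i.
  by apply/funext => i; rewrite mulN1r.
by rewrite mxactD mxactZ CC Ctau; apply/funext => i; ring.
Qed.

Let mM : mom P (fun t => hsn (M t)).
Proof. by apply: mom_nrm => -[a b] /=; apply: momB => //; exact: mom_cst. Qed.

Let K (p : R * (I -> R) * R) (c : R) := ev P (fun t => cos (c * dot p.1.2 (F^~ t) + p.2)).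

Let mdF (xi : I -> R) := mom_dot xi mF.

Let mcosF c (p : R * (I -> R) * R) : mom P (fun t => cos (c * dot p.1.2 (F^~ t) + p.2)).
Proof.
apply: mom_cos; apply: (@mom_meas _ _ _ P); apply: momD; last exact: mom_cst.
exact: momZ.
Qed.

Let mform (N : T -> I -> I -> R) xi : (forall a b, mom P (fun t => N t a b)) ->
  mom P (fun t => dot xi (mxact (N t) xi)).
Proof.
move=> mN; apply: mom_sum => a; apply: momZ; apply: mom_sum => b.
by apply: momM; [exact: mN|exact: mom_cst].
Qed.

(** The Stein identity at frequency c xi carries an extra factor c on the left and c^2 on the right;
    cancelling it is the reason for c != 0. *)
Let dK p c : c != 0 -> is_derive c (1 : R) (K p)
  (- (c * ev P (fun t => dot p.1.2 (mxact (tau t) p.1.2) * cos (c * dot p.1.2 (F^~ t) + p.2)))).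
Proof.
move=> c0; have := is_derive_ev_cos c (mdF p.1.2) (mom_cst p.2); rewrite -/(K p).
set A := ev P _; suff -> : A = c * ev P (fun t => dot p.1.2 (mxact (tau t) p.1.2) * cos (c * dot p.1.2 (F^~ t) + p.2)) by [].
apply: (mulfI c0); rewrite /A.
have ms : mom P (fun w => dot p.1.2 (F^~ w) * sin (c * dot p.1.2 (F^~ w) + p.2)).
  apply: momM => //; apply: mom_sin; apply: (@mom_meas _ _ _ P); apply: momD; last exact: mom_cst.
  exact: momZ.
have mc : mom P (fun t => dot p.1.2 (mxact (tau t) p.1.2) * cos (c * dot p.1.2 (F^~ t) + p.2)).
  by apply: momM => //; exact: mform.
rewrite -!evZ//; last exact: momZ.
have := stein (fun i => c * p.1.2 i) p.2.
under eq_fun do rewrite dotZ.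
move=> e; transitivity (ev P (fun t => c * dot p.1.2 (F^~ t) * sin (c * dot p.1.2 (F^~ t) + p.2))).
  by congr ev; apply/funext => t; rewrite mulrA.
rewrite e; congr ev; apply/funext => t.
by rewrite mxactZ dotZ dotZr dotZ !mulrA.
Qed.

Section Trig.
Variables (s : seq (R * (I -> R) * R)) (g : (I -> R) -> R) (eps : R).
Hypotheses (hg : lip1 g) (sg : forall x, `|g x - trigsum s x| <= eps).

(** E f(cos th F + sin th S) with the Gaussian vector integrated out frequency by frequency, which
    leaves a function of the real variable th alone. *)
Let Psi th := \sum_(p <- s) p.1.1 * (expR (- (sin th ^+ 2 * (qform C p.1.2 / 2))) * K p (cos th)).

Let dPsi th := \sum_(p <- s) p.1.1 * (expR (- (sin th ^+ 2 * (qform C p.1.2 / 2))) *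
  (- (sin th * cos th) * ev P (fun t => dot p.1.2 (mxact (M t) p.1.2) * cos (cos th * dot p.1.2 (F^~ t) + p.2)))).

Let is_derive_Psi (th : R) : cos th != 0 -> is_derive th (1 : R) Psi (dPsi th).
Proof.
move=> c0; rewrite /Psi /dPsi; elim: s => [|p s' ih].
  under eq_fun do rewrite big_nil; rewrite big_nil; exact: is_derive_cst.
under eq_fun do rewrite big_cons; rewrite big_cons.
apply: is_deriveD.
have h1 := dK p c0.
have h2 : is_derive th (1 : R) (fun th => K p (cos th))
   (sin th * (cos th * ev P (fun t => dot p.1.2 (mxact (tau t) p.1.2) * cos (cos th * dot p.1.2 (F^~ t) + p.2)))).
  have := @is_derive1_comp _ (K p) cos th _ _ h1 (is_derive_cos th).
  by rewrite mulrNN mulrC.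
set Et := ev P _ in h2.
have -> : ev P (fun t => dot p.1.2 (mxact (M t) p.1.2) * cos (cos th * dot p.1.2 (F^~ t) + p.2)) =
   qform C p.1.2 * K p (cos th) - Et.
  rewrite /Et /K -evZ// -evB; last 2 first.
  - exact: momZ.
  - by apply: momM => //; exact: mform.
  congr ev; apply/funext => t; rewrite qformE -mulrBl; congr (_ * _).
  have -> : mxact (M t) p.1.2 = fun i => mxact C p.1.2 i + (-1) * mxact (tau t) p.1.2 i.
    by apply/funext => i; rewrite /mxact big_distrr/= -big_split/=; apply: eq_bigr => b _; rewrite /M; ring.
  by rewrite dotDr dotZr; ring.
apply: is_derive_eq; rewrite /GRing.scale/=.
by field.
Qed.

(** The factor sin th of the derivative cancels the 1 / r of [hessian_bound]; only the approximation
    error keeps a 1 / sin th, bounded by its value at del. *)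
Let dPsi_bound th del : 0 < sin del -> sin del <= sin th -> 0 <= cos th ->
  `|dPsi th| <= cos th * (ev P (fun t => hsn (M t)) *
     (Num.sqrt 2 / Num.sqrt kap + 2 * eps / (kap * sin del))).
Proof.
move=> sd0 sds c0; have eps0 : 0 <= eps by apply: le_trans (sg (fun=> 0)).
have s0 : 0 < sin th by apply: lt_le_trans sds.
(* Two independent copies of scale r add up to one Gaussian vector of scale sin th. *)
pose r := sin th / Num.sqrt 2.
have q2 : 0 < Num.sqrt (2 : R) by rewrite sqrtr_gt0.
have sq2 : Num.sqrt (2 : R) ^+ 2 = 2 by rewrite sqr_sqrtr.
have r0 : 0 < r by rewrite divr_gt0.
have r2 : r ^+ 2 = sin th ^+ 2 / 2 by rewrite /r expr_div_n sq2.
have -> : dPsi th = - (sin th * cos th) * ev P (fun t => \sum_(p <- s) p.1.1 * dot p.1.2 (mxact (M t) p.1.2) *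
      (expR (- (r ^+ 2 * qform C p.1.2)) * cos (dot p.1.2 (fun i => cos th * F i t) + p.2))).
  have mm (p : R * (I -> R) * R) : mom P (fun t => dot p.1.2 (mxact (M t) p.1.2) * cos (cos th * dot p.1.2 (F^~ t) + p.2)).
    by apply: momM => //; apply: mform => a b; apply: momB => //; exact: mom_cst.
  rewrite (_ : (fun t => _) = fun t => \sum_(p <- s) (p.1.1 * expR (- (r ^+ 2 * qform C p.1.2))) *
     (dot p.1.2 (mxact (M t) p.1.2) * cos (cos th * dot p.1.2 (F^~ t) + p.2))); last first.
    by apply/funext => t; apply: eq_bigr => p _; rewrite dotZr; ring.
  rewrite ev_sum; last by move=> p; exact: momZ.
  rewrite big_distrr/= /dPsi; apply: eq_bigr => p _; rewrite evZ//.
  rewrite (_ : r ^+ 2 * qform C p.1.2 = sin th ^+ 2 * (qform C p.1.2 / 2)); last by rewrite r2; field.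
  ring.
set X := ev P _.
have hX : `|X| <= ev P (fun t => hsn (M t)) * ((Num.sqrt kap * r)^-1 + eps / (kap * r ^+ 2)).
  rewrite mulrC -evZ//; apply: ev_abs; [|exact: momZ|].
    apply: mom_sum => p; apply: momM.
      by apply: momZ; apply: mform => a b; apply: momB => //; exact: mom_cst.
    apply: momZ; apply: mom_cos; apply: (@mom_meas _ _ _ P); apply: momD; last exact: mom_cst.
    by apply: mom_sum => i; apply: momZ; exact: momZ.
  by move=> t; rewrite mulrC; exact: (hessian_bound gS symC kap0 hg sg).
have h0 : 0 <= ev P (fun t => hsn (M t)) by apply: ev_ge0 => t; exact: nrm_ge0.
rewrite mulNr normrN !normrM (gtr0_norm s0) (ger0_norm c0).
rewrite [sin th * _]mulrC -(mulrA (cos th)); apply: ler_wpM2l => //; rewrite [sin th * _]mulrC.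
apply: le_trans (ler_wpM2r (ltW s0) hX) _; rewrite -(mulrA (ev P _)); apply: ler_wpM2l => //.
have k0 : 0 < Num.sqrt kap by rewrite sqrtr_gt0.
have -> : ((Num.sqrt kap * r)^-1 + eps / (kap * r ^+ 2)) * sin th =
   Num.sqrt 2 / Num.sqrt kap + 2 * eps / (kap * sin th).
  rewrite r2 /r; field; rewrite !gt_eqF//.
rewrite lerD2l; apply: ler_pM => //; first by rewrite mulr_ge0.
  by rewrite invr_ge0 mulr_ge0// ltW.
by rewrite lef_pV2 ?posrE ?mulr_gt0// ler_pM2l.
Qed.

Let Psi_rot th : Psi th = ev (pprod P Q) (fun z => trigsum s (fun i => cos th * F i z.1 + sin th * S i z.2)).
Proof.
have mc1 (p : R * (I -> R) * R) := mcosF (cos th) p.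
have ms1 (p : R * (I -> R) * R) : mom P (fun t => sin (cos th * dot p.1.2 (F^~ t) + p.2)).
  by apply: mom_sin; apply: (@mom_meas _ _ _ P); apply: momD; [exact: momZ|exact: mom_cst].
have mL (p : R * (I -> R) * R) : mom Q (fun t => dot (fun i => sin th * p.1.2 i) (S^~ t) + 0).
  by apply: momD; [exact: mom_dot|exact: mom_cst].
have mc2 (p : R * (I -> R) * R) := mom_cos (mom_meas (mL p)).
have ms2 (p : R * (I -> R) * R) := mom_sin (mom_meas (mL p)).
have E (p : R * (I -> R) * R) (z : T * U) : cos (dot p.1.2 (fun i => cos th * F i z.1 + sin th * S i z.2) + p.2) =
  cos (cos th * dot p.1.2 (F^~ z.1) + p.2) * cos (dot (fun i => sin th * p.1.2 i) (S^~ z.2) + 0) -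
  sin (cos th * dot p.1.2 (F^~ z.1) + p.2) * sin (dot (fun i => sin th * p.1.2 i) (S^~ z.2) + 0).
  by rewrite -cosD; congr cos; rewrite dotDr !dotZr dotZ; ring.
have mE (p : R * (I -> R) * R) : mom (pprod P Q) (fun z => cos (dot p.1.2 (fun i => cos th * F i z.1 + sin th * S i z.2) + p.2)).
  under eq_fun do rewrite E.
  apply: momB; apply: momM; [exact: (mom_fst Q (mc1 p))|exact: (mom_snd P (mc2 Q p))|exact: (mom_fst Q (ms1 p))|exact: (mom_snd P (ms2 Q p))].
rewrite /trigsum ev_sum; last by move=> p; exact: momZ.
rewrite /Psi; apply: eq_bigr => p _; rewrite evZ//; congr (_ * _).
under eq_fun do rewrite E.
rewrite evB; [|by apply: momM; [exact: (mom_fst Q (mc1 p))|exact: (mom_snd P (mc2 Q p))]|by apply: momM; [exact: (mom_fst Q (ms1 p))|exact: (mom_snd P (ms2 Q p))]].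
rewrite (ev_prod (mc1 p) (mc2 Q p)) (ev_prod (ms1 p) (ms2 Q p)).
rewrite (gauss_cos gS) (gauss_sin gS) cos0 sin0 !mulr0 subr0 mulr1 qformZ mulrC /K.
by congr (_ * expR (- _)); rewrite mulrA.
Qed.

Let Psi_end : Psi (pi / 2) = ev Q (fun t => trigsum s (S^~ t)).
Proof.
have mc (p : R * (I -> R) * R) : mom Q (fun t => cos (dot p.1.2 (S^~ t) + p.2)).
  by apply: mom_cos; apply: (@mom_meas _ _ _ Q); apply: momD; [exact: mom_dot|exact: mom_cst].
rewrite /Psi /trigsum ev_sum; last by move=> p; exact: momZ.
apply: eq_bigr => p _; rewrite evZ// (gauss_cos gS) sin_pihalf cos_pihalf expr1n mul1r.
rewrite /K (_ : (fun t => cos (0 * _ + _)) = fun=> cos p.2) ?ev_cst//.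
by apply/funext => t; rewrite mul0r add0r.
Qed.

Let Psi_path del : 0 < del < pi / 2 -> `|Psi del - Psi (pi / 2)| <=
  ev P (fun t => hsn (M t)) * (Num.sqrt 2 / Num.sqrt kap + 2 * eps / (kap * sin del)).
Proof.
move=> /andP[del0 del_pi]; set B := ev P _ * _.
have eps0 : 0 <= eps by apply: le_trans (sg (fun=> 0)).
have sd0 : 0 < sin del by apply: sin_gt0_pihalf; rewrite del0.
have B0 : 0 <= B.
  rewrite /B mulr_ge0//; first by apply: ev_ge0 => t; exact: nrm_ge0.
  by rewrite addr_ge0// divr_ge0 ?sqrtr_ge0 ?mulr_ge0// ?ltW// mulr_ge0// ltW.
have dP (th : R) : th \in `]del, (pi / 2)[ -> is_derive th (1 : R) Psi (dPsi th).
  rewrite in_itv/= => /andP[h1 h2]; apply: is_derive_Psi; rewrite gt_eqF// cos_gt0_pihalf// h2 andbT.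
  by apply: lt_trans (lt_trans del0 h1); rewrite oppr_lt0 divr_gt0 ?pi_gt0.
have cP : continuous Psi.
  have cK p : continuous (K p).
    move=> c; apply: differentiable_continuous; apply/derivable1_diffP.
    by have [] := is_derive_ev_cos c (mdF p.1.2) (mom_cst p.2).
  move=> th; rewrite /Psi; elim: s => [|p s' ih].
    by under eq_fun do rewrite big_nil; exact: cst_continuous.
  under eq_fun do rewrite big_cons.
  apply: (@continuousD _ R^o _ _ _ _ _ ih).
  apply: (@continuousM _ _ _ _ _ (cvg_cst _)).
  apply: continuousM; last by apply: continuous_comp; [exact: continuous_cos|exact: cK].
  apply: continuous_comp; last exact: continuous_expR.
  apply: continuousN; apply: continuousM; last exact: cvg_cst.
  exact: (@continuousM _ _ sin sin th (@continuous_sin _ th) (@continuous_sin _ th)).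
(* B sin is a primitive of the bound B cos on |Psi'|, so the mean value theorem for e Psi - B sin
   integrates the bound up to sin(pi/2) = 1. The values e = 1 and e = -1 give the two signs. *)
have key (e : R) : `|e| <= 1 -> e * (Psi (pi / 2) - Psi del) <= B.
  move=> e1.
  have [||th hth] := @MVT R (fun th => e * Psi th - B * sin th) (fun th => e * dPsi th - B * cos th) del (pi / 2) del_pi.
  - move=> th /dP h; apply: is_deriveB.
  - apply: continuous_subspaceT => x.
    by apply: (@continuousB _ R^o _ (fun th => e * Psi th) (fun th => B * sin th));
      apply: continuousM; [exact: cvg_cst|exact: cP|exact: cvg_cst|exact: continuous_sin].
  have := hth; rewrite in_itv/= => /andP[h1 h2] eq.
  have cth : 0 <= cos th.
    apply/ltW; rewrite cos_gt0_pihalf// h2 andbT.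
    by apply: lt_trans (lt_trans del0 h1); rewrite oppr_lt0 divr_gt0 ?pi_gt0.
  have sth : sin del <= sin th.
    have lo : - (pi / 2) < del by apply: lt_trans del0; rewrite oppr_lt0 divr_gt0 ?pi_gt0.
    by apply: ltW; rewrite ltr_sin// in_itv/= !ltW// (lt_trans lo).
  have hb := dPsi_bound sd0 sth cth.
  have : e * Psi (pi / 2) - B * sin (pi / 2) - (e * Psi del - B * sin del) <= 0.
    rewrite eq mulr_le0_ge0 ?subr_ge0 ?(ltW del_pi)// subr_le0 mulrC.
    apply: le_trans (ler_norm _) _; rewrite normrM [leRHS]mulrC mulrC.
    by apply: (@le_trans _ _ `|dPsi th|); [rewrite ler_piMr|rewrite mulrC].
  rewrite sin_pihalf mulr1 => h.
  have : 0 <= B * sin del by rewrite mulr_ge0// ltW.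
  lra.
rewrite ler_norml; have := key 1; have := key (-1); rewrite normrN normr1 => /(_ (lexx _)) a /(_ (lexx _)) b.
by apply/andP; split; lra.
Qed.

Let ml1F : mom P (fun t => l1 (F^~ t)).
Proof. by apply: mom_sum => i; exact: mom_norm. Qed.

Let ml1S : mom Q (fun t => l1 (S^~ t)).
Proof. by apply: mom_sum => i; exact: mom_norm. Qed.

Let mtF : mom P (fun t => trigsum s (F^~ t)).
Proof. by apply: (mom_trig mF); exists s. Qed.

Let mtS : mom Q (fun t => trigsum s (S^~ t)).
Proof. by apply: (mom_trig mS); exists s. Qed.

(** A rotation by del moves F by O(del). The move is measured on the Lipschitz g and not on the
    trigonometric sum, whence the two errors eps. *)
Let Psi_start del : 0 < del < pi / 2 -> `|ev P (fun t => trigsum s (F^~ t)) - Psi del| <=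
  2 * eps + (del * ev P (fun t => l1 (F^~ t)) + del * ev Q (fun t => l1 (S^~ t))).
Proof.
move=> /andP[del0 del_pi].
have mm : mom (pprod P Q) (fun z => trigsum s (fun i => cos del * F i z.1 + sin del * S i z.2)).
  apply: (@mom_trig _ _ _ _ (pprod P Q) (fun i z => cos del * F i z.1 + sin del * S i z.2)); last by exists s.
  by move=> i; apply: momD; apply: momZ; [exact: (mom_fst Q (mF i))|exact: (mom_snd P (mS i))].
have m1 := mom_fst Q mtF.
have m2 := mom_fst Q ml1F.
have m3 := mom_snd P ml1S.
rewrite Psi_rot -(ev_fst Q mtF) -(ev_fst Q ml1F) -(ev_snd P ml1S) -evB// -(ev_cst (pprod P Q) (2 * eps)).
rewrite -!evZ// -!evD//; try by [exact: mom_cst|exact: momZ|apply: momD; exact: momZ].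
apply: ev_abs; [exact: momB|by apply: momD; [exact: mom_cst|apply: momD; exact: momZ]|].
move=> z; set x := F^~ z.1; set y := fun i => _ + _.
apply: (@le_trans _ _ (eps + `|g x - g y| + eps)).
  have := sg x; have := sg y; rewrite distrC => h1 h2.
  rewrite (_ : trigsum s x - trigsum s y = - (g x - trigsum s x) + (g x - g y) - (trigsum s y - g y)); last by ring.
  apply: le_trans (ler_normB _ _) _; apply: lerD => //.
  by apply: le_trans (ler_normD _ _) _; rewrite normrN lerD2r.
rewrite mulr2n mulrDl mul1r addrAC lerD2l.
apply: le_trans (hg x y) _; apply: le_trans (nrm_le_l1 _) _.
rewrite /l1 !big_distrr/= -big_split/=; apply: ler_sum => i _.
rewrite /x /y (_ : _ - _ = (1 - cos del) * F i z.1 - sin del * S i z.2); last by ring.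
apply: le_trans (ler_normB _ _) _; rewrite !normrM; apply: lerD; apply: ler_wpM2r => //.
  by rewrite ger0_norm ?subr_ge0 ?cos_le1// cosB1_le// ltW.
by apply: le_trans (normr_sin_le _) _; rewrite ger0_norm// ltW.
Qed.

(** With this eps, the amplified error 2 eps / (kap sin del) of [Psi_path] is 2 sin del, and all
    errors together are O(del). *)
Lemma trig_compare del : 0 < del < pi / 2 -> eps = kap * sin del ^+ 2 ->
  `|ev P (fun t => g (F^~ t)) - ev Q (fun t => g (S^~ t))| <=
  Num.sqrt 2 / Num.sqrt kap * ev P (fun t => hsn (M t)) + del *
  (2 * ev P (fun t => hsn (M t)) + 4 * kap +
   ev P (fun t => l1 (F^~ t)) + ev Q (fun t => l1 (S^~ t))).
Proof.
move=> del0 epsE; have h1 := Psi_start del0; have h2 := Psi_path del0.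
move: del0 => /andP[del0 del_pi].
have sd0 : 0 < sin del by apply: sin_gt0_pihalf; rewrite del0.
have sd : sin del <= del by apply: sin_le; exact: ltW.
have mgF : mom P (fun t => g (F^~ t)) := mom_polylip mF (lip1_polylip hg).
have mgS : mom Q (fun t => g (S^~ t)) := mom_polylip mS (lip1_polylip hg).
have h3 : `|ev P (fun t => g (F^~ t)) - ev P (fun t => trigsum s (F^~ t))| <= eps.
  rewrite -evB// -(ev_cst P eps); apply: ev_abs => //; [exact: momB|exact: mom_cst].
have h4 : `|ev Q (fun t => g (S^~ t)) - ev Q (fun t => trigsum s (S^~ t))| <= eps.
  rewrite -evB// -(ev_cst Q eps); apply: ev_abs => //; [exact: momB|exact: mom_cst].
rewrite Psi_end in h2.
have A0 : 0 <= ev P (fun t => hsn (M t)) by apply: ev_ge0 => t; exact: nrm_ge0.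
set A := ev P (fun t => hsn (M t)) in h2 A0 *.
have e1 : 2 * eps / (kap * sin del) = 2 * sin del by rewrite epsE; field; rewrite !gt_eqF.
have e2 : eps <= kap * del.
  rewrite epsE ler_pM2l// expr2; apply: le_trans _ sd.
  by rewrite ler_piMl ?sin_le1// ltW.
have e3 : A * sin del <= A * del by rewrite ler_wpM2l.
rewrite e1 mulrDr in h2.
move: h1 h2 h3 h4; rewrite !ler_norml => /andP[a1 b1] /andP[a2 b2] /andP[a3 b3] /andP[a4 b4].
by apply/andP; split; lra.
Qed.

End Trig.

(** Uniform approximation is available only on a box, so g is first composed with x -> L sin(x / L).
    With L = 1 / del this cutoff and the initial angle disappear together as del tends to 0. *)
Lemma stein_compare g : lip1 g ->
  `|ev P (fun t => g (F^~ t)) - ev Q (fun t => g (S^~ t))| <=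
  Num.sqrt 2 / Num.sqrt kap * ev P (fun t => hsn (fun a b => C a b - tau t a b)).
Proof.
move=> hg; set A := ev P (fun t => hsn _).
have ml1F : mom P (fun t => l1 (F^~ t)) by apply: mom_sum => i; exact: mom_norm.
have ml1S : mom Q (fun t => l1 (S^~ t)) by apply: mom_sum => i; exact: mom_norm.
pose B := 2 * A + 4 * kap + ev P (fun t => l1 (F^~ t)) + ev Q (fun t => l1 (S^~ t)).
pose B' := B + ev P (fun t => l1 (F^~ t) ^+ 2) + ev Q (fun t => l1 (S^~ t) ^+ 2).
have l1_0 : 0 <= ev P (fun t => l1 (F^~ t)) by apply: ev_ge0 => t; exact: l1_ge0.
have l1_0' : 0 <= ev Q (fun t => l1 (S^~ t)) by apply: ev_ge0 => t; exact: l1_ge0.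
have l2_0 : 0 <= ev P (fun t => l1 (F^~ t) ^+ 2) by apply: ev_ge0 => t; exact: sqr_ge0.
have l2_0' : 0 <= ev Q (fun t => l1 (S^~ t) ^+ 2) by apply: ev_ge0 => t; exact: sqr_ge0.
have A0 : 0 <= A by apply: ev_ge0 => t; exact: nrm_ge0.
have B'0 : 0 < B'.
  rewrite /B' /B -!addrA; apply: ltr_wpDl; first by rewrite mulr_ge0.
  by apply: ltr_pwDl; [rewrite mulr_gt0|rewrite !addr_ge0].
have key del : 0 < del < 1 -> `|ev P (fun t => g (F^~ t)) - ev Q (fun t => g (S^~ t))| <=
    Num.sqrt 2 / Num.sqrt kap * A + del * B'.
  move=> /andP[del0 del1].
  have del_pi : del < pi / 2 by apply: lt_le_trans del1 _; have := pi_ge2 R; lra.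
  pose L := del^-1.
  have L0 : 0 < L by rewrite invr_gt0.
  (* The scaled sine is 1-Lipschitz in each coordinate, so gL is again 1-Lipschitz for the Euclidean
     norm. *)
  pose gL x := g (fun i => L * sin (x i / L)).
  have hgL : lip1 gL.
    move=> x y; apply: le_trans (hg _ _) _; apply: nrm_le => i.
    rewrite -mulrBr normrM (gtr0_norm L0) -ler_pdivlMl//.
    apply: le_trans (sin_lip _ _) _.
    by rewrite -mulrBl normrM mulrC (gtr0_norm (_ : 0 < L^-1)) ?invr_gt0.
  have e0 : 0 < kap * sin del ^+ 2.
    by rewrite mulr_gt0// exprn_gt0// sin_gt0_pihalf// del0.
  have [G [s sG] GE] := bernstein_trig L0 ler01 e0 (fun x y _ _ => lip1_l1 hg x y).
  have sgL x : `|gL x - trigsum s x| <= kap * sin del ^+ 2 by rewrite -sG; exact: GE.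
  have del0pi : 0 < del < pi / 2 by rewrite del0.
  have h1 := trig_compare hgL sgL del0pi erefl.
  have gdist x : `|g x - gL x| <= del * l1 x ^+ 2.
    apply: le_trans (hg _ _) _; apply: le_trans (nrm_le_l1 _) _.
    rewrite [_ ^+ 2]expr2 mulrA {2}/l1 big_distrr/=; apply: ler_sum => i _.
    rewrite (_ : x i - _ = - L * (sin (x i / L) - x i / L)); last by field; rewrite gt_eqF.
    rewrite normrM normrN (gtr0_norm L0).
    apply: le_trans (ler_wpM2l (ltW L0) (sinB_sqr _)) _.
    rewrite (_ : L * _ = del * `|x i| * `|x i|); last first.
      rewrite -mulrA -expr2 real_normK ?num_real// /L; field; rewrite gt_eqF//.
    by rewrite ler_wpM2r// ler_wpM2l ?le_l1// ltW.
  have mgF : mom P (fun t => g (F^~ t)) := mom_polylip mF (lip1_polylip hg).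
  have mgS : mom Q (fun t => g (S^~ t)) := mom_polylip mS (lip1_polylip hg).
  have mgLF : mom P (fun t => gL (F^~ t)) := mom_polylip mF (lip1_polylip hgL).
  have mgLS : mom Q (fun t => gL (S^~ t)) := mom_polylip mS (lip1_polylip hgL).
  have h3 : `|ev P (fun t => g (F^~ t)) - ev P (fun t => gL (F^~ t))| <= del * ev P (fun t => l1 (F^~ t) ^+ 2).
    have mq : mom P (fun t => l1 (F^~ t) ^+ 2) by exact: momX.
    rewrite -evB// -(evZ _ mq); apply: ev_abs; [exact: momB|exact: momZ|by move=> t; exact: gdist].
  have h4 : `|ev Q (fun t => g (S^~ t)) - ev Q (fun t => gL (S^~ t))| <= del * ev Q (fun t => l1 (S^~ t) ^+ 2).
    have mq : mom Q (fun t => l1 (S^~ t) ^+ 2) by exact: momX.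
    rewrite -evB// -(evZ _ mq); apply: ev_abs; [exact: momB|exact: momZ|by move=> t; exact: gdist].
  rewrite -/A in h1; rewrite /B' /B.
  move: h1 h3 h4; rewrite !ler_norml => /andP[a1 b1] /andP[a3 b3] /andP[a4 b4].
  by apply/andP; split; lra.
apply/ler_addgt0Pr => e e0.
pose del := Num.min (1 / 2) (e / B').
have d0 : 0 < del < 1.
  rewrite lt_min gt_min; apply/andP; split; first by rewrite !divr_gt0.
  by apply/orP; left; lra.
apply: le_trans (key del d0) _; rewrite lerD2l -ler_pdivlMr//.
by rewrite ge_min lexx orbT.
Qed.

End Interpolation.

(** * Independent normal entries *)

Section BoundedTest.
Context {R : realType} {d : measure_display} {T : measurableType d}.
Variable P : probability T R.

Lemma ev_indic (A : set T) : measurable A -> ev P (\1_A) = fine (P A).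
Proof. by move=> mA; rewrite /ev /Rintegral integral_indic// setIT. Qed.

(** The sum counts the positive integers up to x, that is, it is the integer part of x. *)
Lemma sum_indic_le k (x : R) : 0 <= x <= k%:R ->
  x - 1 <= \sum_(i < k) ((i.+1%:R <= x :> R)%:R : R) <= x.
Proof.
elim: k x => [|k ih] x /andP[x0 xk].
  by rewrite big_ord0; apply/andP; split; lra.
rewrite big_ord_recr/=; have [xk1|kx] := lerP x k%:R.
  have [h|h] := lerP k.+1%:R x.
    by have := le_trans h xk1; rewrite ler_nat ltnn.
  by rewrite addr0; apply: ih; rewrite x0.
rewrite (eq_bigr (fun=> 1)); last first.
  move=> i _; have -> // : (i.+1%:R <= x) = true.
  by apply/ltW/(le_lt_trans _ kx); rewrite ler_nat.
rewrite sumr_const card_ord; rewrite -natr1 in xk.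
rewrite -natr1; case: (lerP (k%:R + 1) x) => [h|h]; apply/andP; split => /=; lra.
Qed.

(** A function with values in [0, 1] is within 1/k of the average of the indicators of its
    superlevel sets at 1/k, ..., k/k, so the factorisation passes from indicators to bounded
    functions. *)
Lemma ev_bounded_test (w Y : T -> R) m : mom P w -> (forall t, `|w t| <= 1) ->
  measurable_fun setT Y ->
  (forall A : set R, measurable A -> ev P (fun t => w t * \1_A (Y t)) = m * ev P (fun t => \1_A (Y t))) ->
  forall h : R -> R, measurable_fun setT h -> (forall x, `|h x| <= 1) ->
  ev P (fun t => w t * h (Y t)) = m * ev P (fun t => h (Y t)).
Proof.
move=> mw w1 mY hA h mh h1.
have mwT : ev P w = m.
  have := hA setT measurableT; rewrite indicT ev_cst mulr1 => <-.
  by congr ev; apply/funext => t; rewrite mulr1.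
have m1 : `|m| <= 1.
  rewrite -mwT -(ev_cst P 1); apply: ev_abs => //; exact: mom_cst.
pose h' x := (h x + 1) / 2.
have mh' : measurable_fun setT h'.
  by apply: measurable_funM => //; exact: measurable_funD.
have h'01 x : 0 <= h' x <= 1.
  by have := h1 x; rewrite /h' ler_norml => /andP[a b]; apply/andP; split; lra.
have mhY (f : R -> R) : measurable_fun setT f -> measurable_fun setT (fun t => f (Y t)).
  by move=> mf; exact: measurableT_comp.
have mom_h'Y : mom P (fun t => h' (Y t)).
  apply: (@mom_bnd _ _ _ _ _ 1); first exact: mhY.
  by move=> t; have /andP[a b] := h'01 (Y t); rewrite ger0_norm.
have mom_hY : mom P (fun t => h (Y t)).
  by apply: (@mom_bnd _ _ _ _ _ 1); [exact: mhY|].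
suff key : ev P (fun t => w t * h' (Y t)) = m * ev P (fun t => h' (Y t)).
  have e1 : (fun t => h' (Y t)) = (fun t => 2^-1 * h (Y t) + 2^-1 * 1).
    by apply/funext => t; rewrite /h'; ring.
  have e2 : (fun t => w t * h' (Y t)) = (fun t => 2^-1 * (w t * h (Y t)) + 2^-1 * w t).
    by apply/funext => t; rewrite /h'; ring.
  move: key; rewrite e1 e2 evD; [|by apply: momZ; exact: momM|exact: momZ].
  rewrite evD; [|exact: momZ|exact: mom_cst].
  rewrite !evZ//; [|exact: mom_cst|exact: momM].
  rewrite ev_cst mwT => e; lra.
apply/eqP; rewrite -subr_eq0 -normr_le0; apply/ler_addgt0Pr => e e0; rewrite add0r.
(* The approximation is used on both sides of the identity, hence 2 / k <= e. *)
pose k := (Num.trunc (2 / e)).+1.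
have k0 : 0 < k%:R :> R by rewrite ltr0n.
have ke : 2 / k%:R <= e.
  rewrite ler_pdivrMr// mulrC -ler_pdivrMr//; apply/ltW.
  by have /andP[_] := Num.Theory.truncn_itv (ltW (divr_gt0 (ltr0Sn _ 1) e0)).
pose A i : set R := [set x | i.+1%:R / k%:R <= h' x].
have mA i : measurable (A i).
  have := mh' measurableT `[i.+1%:R / k%:R, +oo[%classic (measurable_itv _).
  by rewrite setTI (_ : _ @^-1` _ = A i)//; apply/seteqP; split=> x /=; rewrite /A/= in_itv/= andbT.
pose hk x : R := k%:R^-1 * \sum_(i < k) \1_(A i) x.
have mAY i : mom P (fun t => \1_(A i) (Y t) : R).
  apply: (@mom_bnd _ _ _ _ _ 1) => [|t].
    by apply: mhY; exact: measurable_indic.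
  by rewrite indicE; case: (_ \in _); rewrite ?normr1// normr0.
have mhk : mom P (fun t => hk (Y t)) by apply: momZ; apply: mom_sum.
have hkE : ev P (fun t => w t * hk (Y t)) = m * ev P (fun t => hk (Y t)).
  rewrite evZ; last exact: mom_sum.
  rewrite ev_sum//.
  rewrite (_ : (fun t => _) = fun t => k%:R^-1 * \sum_(i < k) (w t * \1_(A i) (Y t))); last first.
    by apply/funext => t; rewrite /hk mulrCA big_distrr.
  rewrite evZ; last by apply: mom_sum => i; exact: momM.
  rewrite ev_sum; last by move=> i; exact: momM.
  by rewrite mulrCA; congr (_ * _); rewrite big_distrr/=; apply: eq_bigr => i _; exact: hA.
have dist x : `|h' x - hk x| <= k%:R^-1.
  have /andP[a b] := h'01 x.
  have -> : h' x - hk x = k%:R^-1 * (k%:R * h' x - \sum_(i < k) (i.+1%:R <= k%:R * h' x :> R)%:R).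
    rewrite mulrBr mulKf ?gt_eqF//; congr (_ - _ * _); apply: eq_bigr => i _.
    rewrite indicE.
    have -> : (x \in A i) = (i.+1%:R <= k%:R * h' x).
      by apply/idP/idP; rewrite ?inE /A /= ler_pdivrMr// mulrC.
    by [].
  rewrite normrM gtr0_norm ?invr_gt0// ler_piMr ?invr_ge0//.
  have := @sum_indic_le k (k%:R * h' x).
  rewrite mulr_ge0//= -{2}[k%:R]mulr1 ler_pM2l// => /(_ b) /andP[c c'].
  by rewrite ler_norml; apply/andP; split; lra.
have -> : ev P (fun t => w t * h' (Y t)) - m * ev P (fun t => h' (Y t)) =
   ev P (fun t => w t * (h' (Y t) - hk (Y t))) - m * ev P (fun t => h' (Y t) - hk (Y t)).
  rewrite evB// (_ : (fun t => w t * (_ - _)) = fun t => w t * h' (Y t) - w t * hk (Y t)); last first.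
    by apply/funext => t; rewrite mulrBr.
  by rewrite evB; [rewrite hkE; ring|exact: momM|exact: momM].
have md : mom P (fun t => h' (Y t) - hk (Y t)) by exact: momB.
apply: le_trans ke; apply: le_trans (ler_normB _ _) _.
rewrite mulrDl mul1r; apply: lerD.
  rewrite -(ev_cst P k%:R^-1); apply: ev_abs; [exact: momM|exact: mom_cst|].
  by move=> t; rewrite normrM; apply: le_trans (dist (Y t)); rewrite ler_piMl.
rewrite normrM; apply: le_trans (_ : 1 * `|ev P (fun t => h' (Y t) - hk (Y t))| <= _).
  by rewrite ler_wpM2r.
rewrite mul1r -(ev_cst P k%:R^-1); apply: ev_abs => //; exact: mom_cst.
Qed.

End BoundedTest.

Section Independence.
Context {R : realType} {I : eqType} {d : measure_display} {T : measurableType d}.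
Variables (P : probability T R) (D : set I) (Y : I -> {RV P >-> R}) (v : I -> R).
Hypothesis indepY : mutually_independent P D Y.
Hypothesis v0 : forall i, D i -> 0 <= v i.
Hypothesis lawY : forall i, D i -> has_normal_law P (Y i) 0 (v i).

Let mY i : measurable_fun setT (Y i). Proof. exact: measurable_funPT. Qed.

Let mind (B : set R) i : measurable B -> mom P (fun t => \1_B (Y i t) : R).
Proof.
move=> mB; apply: (@mom_bnd _ _ _ _ _ 1) => [|t].
  by apply: (measurableT_comp _ (mY i)); exact: measurable_indic.
by rewrite indicE; case: (_ \in _); rewrite ?normr1// normr0.
Qed.

Let mprod (K : seq I) (B : I -> set R) : (forall i, i \in K -> measurable (B i)) ->
  mom P (fun t => \prod_(k <- K) \1_(B k) (Y k t) : R).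
Proof.
elim: K => [|k K ih] hB; first by under eq_fun do rewrite big_nil; exact: mom_cst.
under eq_fun do rewrite big_cons; apply: momM; first by apply: mind; apply: hB; rewrite mem_head.
by apply: ih => i iK; apply: hB; rewrite inE iK orbT.
Qed.

Let ev_prod_indic (K : seq I) (B : I -> set R) : uniq K ->
  (forall i, i \in K -> D i) -> (forall i, i \in K -> measurable (B i)) ->
  ev P (fun t => \prod_(k <- K) \1_(B k) (Y k t) : R) =
  \prod_(k <- K) ev P (fun t => \1_(B k) (Y k t) : R).
Proof.
move=> uK KD mB.
have E1 k : k \in K -> ev P (fun t => \1_(B k) (Y k t) : R) = fine (P (Y k @^-1` B k)).
  move=> kK; rewrite -ev_indic//.
  by rewrite -[X in measurable X]setTI; exact: mY measurableT _ (mB _ kK).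
have -> : \prod_(k <- K) ev P (fun t => \1_(B k) (Y k t) : R) = \prod_(k <- K) fine (P (Y k @^-1` B k)).
  by rewrite big_seq [RHS]big_seq; apply: eq_bigr => k kK; exact: E1.
have E2 : (fun t => \prod_(k <- K) \1_(B k) (Y k t) : R) = \1_[set t | forall i, i \in K -> B i (Y i t)].
  apply/funext => t; rewrite indicE; have [h|h] := pselect (forall i, i \in K -> B i (Y i t)).
    rewrite mem_set// big_seq big1// => k kK; rewrite indicE mem_set//; exact: h.
  rewrite memNset//; have [k [kK nB]] : exists k, k \in K /\ ~ B k (Y k t).
    by have /existsNP[k /not_implyP] := h; exists k.
  rewrite (big_rem k kK)/= indicE memNset// mul0r//.
have mS : measurable [set t | forall i, i \in K -> B i (Y i t)].
  have := mom_meas (mprod mB); rewrite E2 => /(_ measurableT [set 1] (measurable_set1 _)).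
  rewrite setTI; congr (measurable _); apply/seteqP; split=> t /=; rewrite indicE.
    by case: (boolP (t \in _)) => [|_ /eqP]; [rewrite inE|rewrite eq_sym oner_eq0].
  by move=> h; rewrite mem_set.
rewrite E2 ev_indic// indepY//.
have E3 k : k \in K -> P (Y k @^-1` B k) = (fine (P (Y k @^-1` B k)))%:E.
  move=> kK; rewrite fineK// fin_num_measure//.
  by rewrite -[X in measurable X]setTI; exact: mY measurableT _ (mB _ kK).
have -> : (\prod_(k <- K) P (Y k @^-1` B k) = \prod_(k <- K) (fine (P (Y k @^-1` B k)))%:E)%E.
  by rewrite big_seq [RHS]big_seq; apply: eq_bigr => k /E3.
by rewrite prodEFin.
Qed.

(** Independence is given for indicators and wanted for cosines. The variables pass one at a time
    from the indicator list K to the cosine list J: the case [j :: K] of the induction hypothesis is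
    the factorisation that [ev_bounded_test] requires for Y_j. *)
Lemma indep_cf (J K : seq I) (B : I -> set R) (a : I -> R) phi :
  uniq (J ++ K) -> (forall i, i \in J ++ K -> D i) -> (forall i, i \in K -> measurable (B i)) ->
  ev P (fun t => \prod_(k <- K) \1_(B k) (Y k t) * cos (\sum_(j <- J) a j * Y j t + phi)) =
  \prod_(k <- K) ev P (fun t => \1_(B k) (Y k t) : R) *
    (expR (- (\sum_(j <- J) a j ^+ 2 * v j) / 2) * cos phi).
Proof.
elim: J K B phi => [|j J ih] K B phi uJ hD mB.
  under eq_fun do rewrite big_nil add0r mulrC.
  rewrite evZ; last exact: mprod.
  by rewrite ev_prod_indic// big_nil oppr0 mul0r expR0 mul1r mulrC.
have Dj : D j by apply: hD; rewrite mem_head.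
have [mYj _ _ cf] := normal_law_facts (v0 Dj) (lawY Dj).
move: uJ; rewrite cat_cons cons_uniq => /andP[jJK uJ].
have mJ : measurable_fun setT (fun t => \sum_(j <- J) a j * Y j t).
  by apply: measurable_sum => i; exact: measurable_funM.
pose w ph t := \prod_(k <- K) \1_(B k) (Y k t) * cos (\sum_(j <- J) a j * Y j t + ph).
have mw ph : mom P (w ph).
  by apply: momM; [exact: mprod|apply: mom_cos; exact: measurable_funD].
have w1 ph t : `|w ph t| <= 1.
  rewrite normrM mulr_ile1// ?cos_max//.
  elim: (K) => [|k K' ihK]; first by rewrite big_nil normr1.
  rewrite big_cons normrM mulr_ile1//.
  by rewrite indicE; case: (_ \in _); rewrite ?normr1// normr0.
have hw ph (h : R -> R) : measurable_fun setT h -> (forall x, `|h x| <= 1) ->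
    ev P (fun t => w ph t * h (Y j t)) = \prod_(k <- K) ev P (fun t => \1_(B k) (Y k t) : R) *
    (expR (- (\sum_(j <- J) a j ^+ 2 * v j) / 2) * cos ph) * ev P (fun t => h (Y j t)).
  move=> mh h1; apply: (ev_bounded_test (mw ph) (w1 ph) (mY j)) => // A mA.
  (* Sets are given as one function on [I]; overwriting it at j is harmless because j is not in
     K. *)
  pose B' k := if k == j then A else B k.
  have jK : j \notin K by apply: contra jJK; rewrite mem_cat => ->; rewrite orbT.
  have B'K k : k \in K -> B' k = B k.
    by move=> kK; rewrite /B'; case: eqP => // e; rewrite e (negbTE jK) in kK.
  have B'j : B' j = A by rewrite /B' eqxx.
  have := ih (j :: K) B' ph; rewrite !big_cons B'j => H.
  rewrite [RHS]mulrC mulrA (_ : \prod_(k <- K) _ = \prod_(k <- K) ev P (fun t => \1_(B' k) (Y k t) : R)); last first.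
    by rewrite big_seq [RHS]big_seq; apply: eq_bigr => k kK; rewrite B'K.
  rewrite -mulrA in H; rewrite -!mulrA -H.
  - congr ev; apply/funext => t; rewrite /w big_cons B'j.
    have -> : \prod_(k <- K) \1_(B k) (Y k t) = \prod_(k <- K) \1_(B' k) (Y k t) :> R.
      by rewrite big_seq [RHS]big_seq; apply: eq_bigr => k kK; rewrite B'K.
    ring.
  - by rewrite (uniq_catCA J [:: j] K)/= jJK.
  - move=> i; rewrite mem_cat inE orbCA -mem_cat => hi; apply: hD; by rewrite cat_cons inE.
  - by move=> i; rewrite inE => /predU1P[->|iK]; [rewrite B'j|rewrite B'K//; exact: mB].
have mcos (ph : R) : measurable_fun setT (fun x : R => cos (a j * x + ph)).
  apply: measurableT_comp; last by apply: measurable_funD => //; exact: measurable_funM.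
  by apply: continuous_measurable_fun; exact: continuous_cos.
(* Sines are written as cosines shifted by pi/2, so a single statement covers both terms; the second
   has zero mean because Y_j is centred. *)
have E t : \prod_(k <- K) \1_(B k) (Y k t) * cos (\sum_(j <- j :: J) a j * Y j t + phi) =
    w phi t * cos (a j * Y j t + 0) - w (phi + pi / 2) t * cos (a j * Y j t + pi / 2).
  rewrite big_cons -addrA (cosD (a j * Y j t)) /w addr0 addrA !cosDpihalf; ring.
under eq_fun do rewrite E.
rewrite evB; [|by apply: momM => //; apply: mom_cos; apply: measurable_funD => //; exact: measurable_funM..].
rewrite (hw phi (fun x => cos (a j * x + 0))) => [||x]; [|exact: mcos|exact: cos_max].
rewrite (hw (phi + pi / 2) (fun x => cos (a j * x + pi / 2))) => [||x]; [|exact: mcos|exact: cos_max].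
rewrite !cf !mulr0 !add0r cos0 cos_pihalf !mulr0 subr0 mulr1 big_cons opprD mulrDl expRD !mulNr.
by rewrite -!mulrA; congr (_ * _); rewrite mulrCA [LHS]mulrCA mulrA -mulrA; ring.
Qed.

End Independence.

(** * Symmetric matrices with independent entries *)

Section FoldSym.
Context {R : realType} {n : nat}.
Notation I := ('I_n * 'I_n)%type.

Definition sw (p : I) : I := (p.2, p.1).

Lemma swK : involutive sw. Proof. by case. Qed.

Lemma sum_fold_sym (f : I -> R) : \sum_p f p =
  \sum_(p : I | (p.1 <= p.2)%N) (if p.1 == p.2 then f p else f p + f (sw p)).
Proof.
rewrite (bigID (fun p : I => (p.1 <= p.2)%N))/= [X in _ + X](reindex_inj (inv_inj swK))/=.
rewrite [in RHS](bigID (fun p : I => p.1 == p.2))/=.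
rewrite [X in X + _](bigID (fun p : I => p.1 == p.2))/= -addrA; congr (_ + _).
  by apply: eq_bigr => p /andP[_ ->].
rewrite [X in _ + X](eq_bigl (fun p : I => (p.1 <= p.2)%N && (p.1 != p.2))).
  by rewrite -big_split/=; apply: eq_bigr => p /andP[_ /negbTE ->].
by move=> p; rewrite -ltnNge ltn_neqAle andbC.
Qed.

(** Covariance of a symmetric matrix with uncorrelated entries, of variance c off the diagonal and 2
    c on it. As an operator it is 2 c times the projection onto symmetric matrices, whence kappa = 2
    c. *)
Definition symcov (c : R) (p q : I) : R := c * ((p == q)%:R + (p == sw q)%:R).

Lemma symcov_sym c p q : symcov c p q = symcov c q p.
Proof.
by rewrite /symcov [p == q]eq_sym (_ : (p == sw q) = (q == sw p))// -(inj_eq (inv_inj swK)) swK eq_sym.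
Qed.

Lemma mxact_symcov c x : mxact (symcov c) x = fun p => c * (x p + x (sw p)).
Proof.
apply/funext => p; rewrite /mxact.
under eq_bigr do rewrite /symcov -mulrA mulrDl.
rewrite -big_distrr/= big_split/=; congr (_ * (_ + _)).
  rewrite (bigD1 p)//= eqxx mul1r big1 ?addr0// => q /negbTE qp; by rewrite eq_sym qp mul0r.
rewrite (bigD1 (sw p))//= swK eqxx mul1r big1 ?addr0// => q qp.
by rewrite -(inj_eq (inv_inj swK)) swK eq_sym (negbTE qp) mul0r.
Qed.

Lemma qform_symcov c x : qform (symcov c) x =
  c * \sum_(p : I | (p.1 <= p.2)%N) (x p + (p.1 != p.2)%:R * x (sw p)) ^+ 2 * (1 + (p.1 == p.2)%:R).
Proof.
rewrite qformE mxact_symcov /dot sum_fold_sym big_distrr/=; apply: eq_bigr => -[i j] /= _.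
rewrite /sw/=; case: eqP => [->|_]/=; ring.
Qed.

Context {d : measure_display} {T : measurableType d}.

Lemma indep_sym_gaussv (P : probability T R) (Z : 'M[{RV P >-> R}]_n) c : 0 <= c ->
  Z^T = Z -> (forall i : 'I_n, has_normal_law P (Z i i) 0 (2 * c)) ->
  (forall i j : 'I_n, (i < j)%N -> has_normal_law P (Z i j) 0 c) ->
  mutually_independent P [set ij : 'I_n * 'I_n | (ij.1 <= ij.2)%N]
    (fun ij => Z ij.1 ij.2) ->
  gaussv P (fun p : I => Z p.1 p.2) (symcov c).
Proof.
move=> c0 sZ Zii Zij indZ.
have Zsw (p : I) : Z p.1 p.2 = Z (sw p).1 (sw p).2.
  by rewrite -{1}sZ mxE.
pose v (p : I) : R := c * (1 + (p.1 == p.2)%:R).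
have v0 p : 0 <= v p by rewrite mulr_ge0// addr_ge0.
have law (p : I) : (p.1 <= p.2)%N -> has_normal_law P (Z p.1 p.2) 0 (v p).
  case: p => i j /=; rewrite leq_eqVlt => /predU1P[/val_inj <-|ij].
    by rewrite /v/= eqxx mulrC; exact: Zii.
  rewrite /v/= (_ : (i == j) = false) ?addr0 ?mulr1; first exact: Zij.
  by apply/eqP => e; rewrite e ltnn in ij.
have mZ (p : I) : mom P (Z p.1 p.2).
  have [h|h] := leqP p.1 p.2; first by have [] := normal_law_facts (v0 p) (law p h).
  by rewrite Zsw; have [] := normal_law_facts (v0 (sw p)) (law (sw p) (ltnW h)).
split=> // xi phi.
pose J := [seq p : I <- enum {: I} | (p.1 <= p.2)%N].
(* The coefficient of Z_p for p in the upper triangle, once equal entries are merged. *)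
pose a (p : I) := xi p + (p.1 != p.2)%:R * xi (sw p).
have SJ (f : I -> R) : \sum_(p <- J) f p = \sum_(p : I | (p.1 <= p.2)%N) f p.
  by rewrite big_filter big_enum_cond; apply: eq_bigl => p; rewrite inE.
have := @indep_cf _ _ _ _ P _ _ v indZ (fun p _ => v0 p) law J [::] (fun=> setT) a phi.
rewrite cats0 big_nil mul1r => H.
transitivity (ev P (fun t => \prod_(k <- [::]) \1_setT (Z k.1 k.2 t) *
    cos (\sum_(j <- J) a j * Z j.1 j.2 t + phi))).
  congr ev; apply/funext => t; rewrite big_nil mul1r; congr (cos (_ + _)).
  rewrite SJ /dot sum_fold_sym; apply: eq_bigr => -[i j] /= _.
  rewrite /a/=; case: eqP => [->|_]; first by rewrite mul0r addr0.
  by rewrite mul1r mulrDl -(Zsw (i, j)).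
rewrite H//.
- rewrite SJ qform_symcov big_distrr/= -mulNr; congr (expR (- _ / 2) * _).
  by apply: eq_bigr => p _; rewrite /v/a; ring.
- by rewrite filter_uniq// enum_uniq.
- by move=> p; rewrite mem_filter => /andP[].
Qed.

End FoldSym.

(** * The Wishart matrix *)

Section Wishart.
Context {R : realType} {n m : nat} {d : measure_display} {T : measurableType d}.
Notation I := ('I_n * 'I_n)%type.
Notation J := ('I_n * 'I_m)%type.
Variables (P : probability T R) (X : J -> T -> R) (A : 'I_m -> 'I_m -> R).

Definition rowcov (p q : J) : R := (p.1 == q.1)%:R * A p.2 q.2.

Hypotheses (gX : gaussv P X rowcov) (symA : forall a b, A a b = A b a).
Hypotheses (A1 : forall a, A a a = 1) (m0 : (0 < m)%N).
Let mX : forall i, mom P (X i) := gX.1.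
Let r : R := (Num.sqrt m%:R)^-1.

Let rr : r * r = m%:R^-1.
Proof. by rewrite -invfM -expr2 sqr_sqrtr. Qed.

Let rm : r * m%:R = Num.sqrt m%:R.
Proof.
have s0 : Num.sqrt m%:R != 0 :> R by rewrite gt_eqF// sqrtr_gt0 ltr0n.
by apply: (mulfI s0); rewrite mulrA divff// mul1r -expr2 sqr_sqrtr.
Qed.

Lemma rowcov_sym p q : rowcov p q = rowcov q p.
Proof. by rewrite /rowcov symA eq_sym. Qed.

Lemma sum_delta (K : finType) (j : K) (f : K -> R) : \sum_k (j == k)%:R * f k = f j.
Proof.
rewrite (bigD1 j)//= eqxx mul1r big1 ?addr0// => k kj.
by rewrite eq_sym (negbTE kj) mul0r.
Qed.

Lemma sum_pair (K L : finType) (f : K * L -> R) : \sum_p f p = \sum_i \sum_j f (i, j).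
Proof. by rewrite pair_bigA/=; apply: eq_bigr => -[]. Qed.

Definition wish (p : I) (t : T) : R :=
  r * \sum_a X (p.1, a) t * X (p.2, a) t - Num.sqrt m%:R * (p.1 == p.2)%:R.
(** The (i, k) entry of m^-1 X A X^T, whose mean is [wsig] times the identity. *)
Definition wV (i k : 'I_n) (t : T) : R :=
  m%:R^-1 * \sum_a \sum_b A a b * (X (i, a) t * X (k, b) t).
Definition wsig : R := m%:R^-1 * \sum_a \sum_b A a b ^+ 2.
(** The matrix whose quadratic form is twice [quad_var], symmetrised in the two indices of p and of
    q. This puts its rows in the space of symmetric matrices, the eigenspace of the covariance. *)
Definition wtau (t : T) (p q : I) : R := 2^-1 *
  ((p.2 == q.2)%:R * wV p.1 q.1 t + (p.2 == q.1)%:R * wV p.1 q.2 t +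
   (p.1 == q.2)%:R * wV p.2 q.1 t + (p.1 == q.1)%:R * wV p.2 q.2 t).
(** m^-2 tr(A^4) for symmetric A: the fourfold sum governing the variance of [wV]. *)
Definition wK : R := m%:R^-1 ^+ 2 * \sum_a \sum_e (\sum_b A a b * A b e) ^+ 2.

Lemma mom_wish p : mom P (wish p).
Proof.
apply: momB; last exact: mom_cst.
by apply: momZ; apply: mom_sum => a; exact: momM.
Qed.

Lemma mom_wV i k : mom P (wV i k).
Proof.
by apply: momZ; apply: mom_sum => a; apply: mom_sum => b; apply: momZ; exact: momM.
Qed.

Lemma mom_wtau p q : mom P (fun t => wtau t p q).
Proof.
apply: momZ; repeat apply: momD; apply: momZ; exact: mom_wV.
Qed.

Lemma wV_sym i k t : wV i k t = wV k i t.
Proof.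
rewrite /wV exchange_big/=; congr (_ * _); apply: eq_bigr => a _; apply: eq_bigr => b _.
by rewrite symA mulrC; rewrite mulrC [X in _ * X]mulrC.
Qed.

Lemma wtau_sym t p q : wtau t p q = wtau t q p.
Proof.
rewrite /wtau (wV_sym q.1 p.1) (wV_sym q.1 p.2) (wV_sym q.2 p.1) (wV_sym q.2 p.2).
by rewrite ![q.1 == _]eq_sym ![q.2 == _]eq_sym; ring.
Qed.

Lemma wtau_sw t p q : wtau t p (sw q) = wtau t p q.
Proof. by rewrite /wtau/=; ring. Qed.

Let symz (xi F : I -> R) : \sum_p ((xi p + xi (sw p)) / 2) * F p =
  \sum_p xi p * ((F p + F (sw p)) / 2).
Proof.
under eq_bigr do rewrite mulrAC mulrDl mulrDl.
rewrite big_split/= [X in _ + X](reindex_inj (inv_inj (@swK n)))/= -big_split/=.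
by apply: eq_bigr => p _; rewrite swK; field.
Qed.

(** The matrix of <xi, W> as a quadratic form in the array. Only entries of the same column
    interact, and xi is symmetrised because [stein_quad] asks for a symmetric form. *)
Let bet (xi : I -> R) (a b : J) : R :=
  (a.2 == b.2)%:R * (r * ((xi (a.1, b.1) + xi (b.1, a.1)) / 2)).

Let symbet xi a b : bet xi a b = bet xi b a.
Proof. by rewrite /bet eq_sym addrC. Qed.

Let bet_sum xi (F : J -> J -> R) : \sum_a \sum_b bet xi a b * F a b =
  \sum_p ((xi p + xi (sw p)) / 2) * (r * \sum_k F (p.1, k) (p.2, k)).
Proof.
rewrite !sum_pair; apply: eq_bigr => i _.
under eq_bigr => k _.
  rewrite sum_pair; under eq_bigr => j _.
    under eq_bigr do rewrite /bet/= -mulrA.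
    rewrite sum_delta; over.
  over.
rewrite exchange_big/=; apply: eq_bigr => j _.
by rewrite -big_distrr /sw/=; ring.
Qed.

Lemma dot_wish xi t : dot xi (wish^~ t) = quad rowcov (bet xi) (X^~ t).
Proof.
rewrite /quad !bet_sum !symz -sumrB; apply: eq_bigr => -[i j] _ /=.
have -> : \sum_k rowcov (i, k) (j, k) = m%:R * (i == j)%:R.
  by rewrite (eq_bigr (fun=> (i == j)%:R)) ?sumr_const ?card_ord ?[RHS]mulr_natl// => k _; rewrite /rowcov A1 mulr1.
have -> : \sum_k rowcov (j, k) (i, k) = m%:R * (i == j)%:R.
  by rewrite (eq_bigr (fun=> (i == j)%:R)) ?sumr_const ?card_ord ?[RHS]mulr_natl// => k _; rewrite /rowcov A1 mulr1 eq_sym.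
have -> : \sum_k X (j, k) t * X (i, k) t = \sum_k X (i, k) t * X (j, k) t.
  by apply: eq_bigr => k _; rewrite mulrC.
by rewrite /wish/= -rm; field.
Qed.

Lemma quad_var_wish xi t : 2 * quad_var rowcov (bet xi) (X^~ t) = dot xi (mxact (wtau t) xi).
Proof.
have -> : quad_var rowcov (bet xi) (X^~ t) = \sum_p ((xi p + xi (sw p)) / 2) *
   \sum_q ((xi q + xi (sw q)) / 2) * ((p.2 == q.2)%:R * wV p.1 q.1 t).
  transitivity (\sum_a \sum_b bet xi a b * \sum_c \sum_e bet xi c e * (rowcov b e * (X a t * X c t))).
    apply: eq_bigr => a _; apply: eq_bigr => b _; rewrite big_distrr/=; apply: eq_bigr => c _.
    by rewrite big_distrr/=; apply: eq_bigr => e _; rewrite !mulrA.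
  rewrite bet_sum; apply: eq_bigr => p _; congr (_ * _).
  under eq_bigr do rewrite bet_sum.
  rewrite exchange_big/= big_distrr/=; apply: eq_bigr => q _.
  rewrite -big_distrr/= mulrCA; congr (_ * _).
  rewrite -big_distrr/= mulrA rr /wV mulrCA; congr (_ * _); rewrite big_distrr/=.
  apply: eq_bigr => k _; rewrite big_distrr/=; apply: eq_bigr => l _.
  by rewrite /rowcov/= -mulrA.
under eq_bigr do rewrite symz.
rewrite symz big_distrr/=; apply: eq_bigr => p _.
rewrite mulrCA; congr (_ * _); rewrite -big_split/= big_distrl/= big_distrr/=; apply: eq_bigr => q _.
by rewrite /wtau/=; field.
Qed.

Lemma wish_stein xi phi :
  ev P (fun t => dot xi (wish^~ t) * sin (dot xi (wish^~ t) + phi)) =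
  ev P (fun t => dot xi (mxact (wtau t) xi) * cos (dot xi (wish^~ t) + phi)).
Proof.
under eq_fun do rewrite dot_wish.
rewrite (stein_quad gX rowcov_sym (symbet xi)) -evZ.
  by congr ev; apply/funext => t; rewrite mulrA quad_var_wish dot_wish.
apply: momM.
  rewrite (_ : (fun t => _) = fun t => 2^-1 * dot xi (mxact (wtau t) xi)).
    apply: momZ; apply: mom_sum => p; apply: momZ; apply: mom_sum => q.
    by apply: momM; [exact: mom_wtau|exact: mom_cst].
  by apply/funext => t; rewrite -quad_var_wish mulKf.
apply: mom_cos; under eq_fun do rewrite -dot_wish.
apply: (@mom_meas _ _ _ P); apply: momD; last exact: mom_cst.
by apply: mom_dot; exact: mom_wish.
Qed.

Let cprod (a b : J) t := X a t * X b t - rowcov a b.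

Let mom_cprod a b : mom P (cprod a b).
Proof. by apply: momB; [exact: momM|exact: mom_cst]. Qed.

(** Centring removes exactly the pairing internal to the two products; the two cross pairings
    remain. *)
Let ev_cprod a b c e : ev P (fun t => cprod a b t * cprod c e t) =
  rowcov a c * rowcov b e + rowcov a e * rowcov b c.
Proof.
rewrite (_ : (fun t => _) = fun t => X a t * X b t * (X c t * X e t) -
  (rowcov c e * (X a t * X b t) + rowcov a b * (X c t * X e t) - rowcov a b * rowcov c e)); last first.
  by apply/funext => t; rewrite /cprod; ring.
have mXX p q : mom P (fun t => X p t * X q t) by exact: momM.
rewrite evB; [|by apply: momM; exact: momM|by apply: momB; [apply: momD; exact: momZ|exact: mom_cst]].
rewrite evB; [|by apply: momD; exact: momZ|exact: mom_cst].
rewrite evD; [|exact: momZ|exact: momZ].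
rewrite !(evZ _ (mXX _ _)) ev_cst (gauss_isserlis gX rowcov_sym) !(gauss_cov gX rowcov_sym); ring.
Qed.

Let ev_sum_mul (K L : finType) (f : K -> T -> R) (g : L -> T -> R) :
  (forall i, mom P (f i)) -> (forall j, mom P (g j)) ->
  ev P (fun t => (\sum_i f i t) * (\sum_j g j t)) = \sum_i \sum_j ev P (fun t => f i t * g j t).
Proof.
move=> mf mg; under eq_fun do rewrite big_distrl/=.
rewrite ev_sum; last by move=> i; apply: momM => //; exact: mom_sum.
apply: eq_bigr => i _; under eq_fun do rewrite big_distrr/=.
by rewrite ev_sum// => j; exact: momM.
Qed.

Let wish_cprod p t : wish p t = \sum_k r * cprod (p.1, k) (p.2, k) t.
Proof.
rewrite -big_distrr/= /cprod sumrB mulrBr /wish; congr (_ - _).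
rewrite /rowcov/= (eq_bigr (fun=> (p.1 == p.2)%:R)); last by move=> k _; rewrite A1 mulr1.
by rewrite sumr_const card_ord -[X in r * X]mulr_natl mulrA rm.
Qed.

Lemma wish_mean p : ev P (wish p) = 0.
Proof.
have -> : wish p = fun t => \sum_k r * cprod (p.1, k) (p.2, k) t by apply/funext => t.
rewrite ev_sum; last by move=> k; exact: momZ.
rewrite big1// => k _; rewrite evZ// evB; [|exact: momM|exact: mom_cst].
by rewrite ev_cst (gauss_cov gX rowcov_sym) subrr mulr0.
Qed.

Lemma wish_cov p q : ev P (fun t => wish p t * wish q t) = symcov wsig p q.
Proof.
under eq_fun do rewrite !wish_cprod.
rewrite ev_sum_mul; try by move=> i; exact: momZ.
rewrite /symcov /wsig -mulrA [X in _ = _ * X]mulrC mulrA big_distrr/=.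
under [RHS]eq_bigr do rewrite big_distrr/=.
apply: eq_bigr => a _; apply: eq_bigr => b _.
rewrite (_ : (fun t => _) = fun t => (r * r) * (cprod (p.1, a) (p.2, a) t * cprod (q.1, b) (q.2, b) t)); last first.
  by apply/funext => t; ring.
rewrite evZ; last exact: momM.
rewrite rr ev_cprod /rowcov/=.
case: p q => [i j] [k l]; rewrite !xpair_eqE/= -!mulnb !natrM; ring.
Qed.

(** Each cross pairing sums to tr(A^4), by symmetry of A; the second one survives only when the rows
    i and k coincide. *)
Let ev_U i k : ev P (fun t => (wV i k t - (i == k)%:R * wsig) ^+ 2) = (1 + (i == k)%:R) * wK.
Proof.
pose f (p : 'I_m * 'I_m) t := m%:R^-1 * A p.1 p.2 * cprod (i, p.1) (k, p.2) t.
have mf p : mom P (f p) by exact: momZ.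
have E t : wV i k t - (i == k)%:R * wsig = \sum_p f p t.
  rewrite sum_pair /f/=.
  rewrite /wV /wsig mulrCA -mulrBr big_distrr/= -sumrB big_distrr/=; apply: eq_bigr => a _.
  rewrite big_distrr/= -sumrB big_distrr/=; apply: eq_bigr => b _.
  by rewrite /cprod /rowcov/=; ring.
under eq_fun do rewrite E expr2.
rewrite ev_sum_mul//.
transitivity (m%:R^-1 ^+ 2 * \sum_(p : 'I_m * 'I_m) \sum_(q : 'I_m * 'I_m)
    (A p.1 p.2 * A q.1 q.2 * (A p.1 q.1 * A p.2 q.2) +
     (i == k)%:R * (A p.1 p.2 * A q.1 q.2 * (A p.1 q.2 * A p.2 q.1)))).
  rewrite big_distrr/=; apply: eq_bigr => p _; rewrite big_distrr/=; apply: eq_bigr => q _.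
  rewrite /f (_ : (fun t => _) = fun t => (m%:R^-1 ^+ 2 * (A p.1 p.2 * A q.1 q.2)) *
    (cprod (i, p.1) (k, p.2) t * cprod (i, q.1) (k, q.2) t)); last by apply/funext => t; ring.
  rewrite evZ; last exact: momM.
  rewrite ev_cprod /rowcov/= !eqxx [k == i]eq_sym.
  by case: (i == k) => /=; ring.
under eq_bigr do rewrite big_split/=.
rewrite big_split/=; under [X in _ + X]eq_bigr do rewrite -big_distrr/=.
rewrite -big_distrr/=.
have K1 : \sum_(p : 'I_m * 'I_m) \sum_(q : 'I_m * 'I_m) A p.1 p.2 * A q.1 q.2 * (A p.1 q.1 * A p.2 q.2) =
    \sum_a \sum_e (\sum_b A a b * A b e) ^+ 2.
  rewrite sum_pair; apply: eq_bigr => a _.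
  under eq_bigr do rewrite sum_pair exchange_big/=.
  rewrite exchange_big/=; apply: eq_bigr => e _.
  rewrite expr2 big_distrl/=; apply: eq_bigr => b _; rewrite big_distrr/=; apply: eq_bigr => c _.
  ring.
have K2 : \sum_(p : 'I_m * 'I_m) \sum_(q : 'I_m * 'I_m) A p.1 p.2 * A q.1 q.2 * (A p.1 q.2 * A p.2 q.1) =
    \sum_a \sum_e (\sum_b A a b * A b e) ^+ 2.
  rewrite -K1; apply: eq_bigr => p _.
  rewrite !sum_pair/= exchange_big/=; apply: eq_bigr => c _; apply: eq_bigr => e _.
  by rewrite [A e c]symA.
by rewrite K1 K2 /wK; ring.
Qed.

(** The squared deviation is at most the sum of the squares of its four terms. Each Kronecker symbol
    leaves n^3 of the n^4 index choices and each variance is at most 2 [wK], giving 4 n^3 times 2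
    [wK]. *)
Lemma wtau_dev : ev P (fun t => hsn (fun p q => symcov wsig p q - wtau t p q)) <=
  Num.sqrt (8 * n%:R ^+ 3 * wK).
Proof.
pose U i k t := wV i k t - (i == k)%:R * wsig.
have mU i k : mom P (U i k) by apply: momB; [exact: mom_wV|exact: mom_cst].
pose B (p q : I) t := (p.2 == q.2)%:R * U p.1 q.1 t ^+ 2 + (p.2 == q.1)%:R * U p.1 q.2 t ^+ 2 +
   (p.1 == q.2)%:R * U p.2 q.1 t ^+ 2 + (p.1 == q.1)%:R * U p.2 q.2 t ^+ 2.
have dB p q t : (symcov wsig p q - wtau t p q) ^+ 2 <= B p q t.
  have -> : symcov wsig p q - wtau t p q = - 2^-1 * ((p.2 == q.2)%:R * U p.1 q.1 t +
     (p.2 == q.1)%:R * U p.1 q.2 t + (p.1 == q.2)%:R * U p.2 q.1 t + (p.1 == q.1)%:R * U p.2 q.2 t).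
    rewrite /symcov /wtau /U; case: p q => [i j] [k l].
    by rewrite !xpair_eqE/= -!mulnb !natrM; field.
  rewrite /B; have bb (b : bool) (x : R) : (b%:R * x) ^+ 2 = b%:R * x ^+ 2.
    by case: b; rewrite ?mul1r// !mul0r expr0n.
  rewrite -!bb -subr_ge0.
  (* Cauchy-Schwarz for four terms, with its defect written as a sum of squares. *)
  have four (a b c e : R) : a ^+ 2 + b ^+ 2 + c ^+ 2 + e ^+ 2 - (- 2^-1 * (a + b + c + e)) ^+ 2 =
    4^-1 * ((a - b) ^+ 2 + (a - c) ^+ 2 + (a - e) ^+ 2 + (b - c) ^+ 2 + (b - e) ^+ 2 + (c - e) ^+ 2).
    by field.
  by rewrite four mulr_ge0// !addr_ge0// sqr_ge0.
have mB p q : mom P (B p q) by repeat apply: momD; apply: momZ; exact: momX.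
have mD p q : mom P (fun t => symcov wsig p q - wtau t p q).
  by apply: momB; [exact: mom_cst|exact: mom_wtau].
apply: le_trans (ev_nrm_le (fun pq : I * I => mD pq.1 pq.2)) _.
have U0 i k : 0 <= ev P (fun t => U i k t ^+ 2) by apply: ev_ge0 => t; exact: sqr_ge0.
have K0 : 0 <= wK.
  rewrite mulr_ge0 ?exprn_ge0 ?invr_ge0//; apply: sumr_ge0 => a _; apply: sumr_ge0 => b _; exact: sqr_ge0.
have D i k : ev P (fun t => U i k t ^+ 2) <= 2 * wK.
  by rewrite ev_U ler_wpM2r// (_ : 2 = 1 + 1)// lerD2l; case: (_ == _).
rewrite ler_sqrt; last by apply: mulr_ge0 => //; apply: mulr_ge0 => //; exact: exprn_ge0.
apply: (@le_trans _ _ (\sum_(pq : I * I) ev P (B pq.1 pq.2))).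
  by apply: ler_sum => -[p q] _ /=; apply: ev_le => //; exact: momX.
have S1 (p : I * I) : ev P (B p.1 p.2) = (p.1.2 == p.2.2)%:R * ev P (fun t => U p.1.1 p.2.1 t ^+ 2) +
   (p.1.2 == p.2.1)%:R * ev P (fun t => U p.1.1 p.2.2 t ^+ 2) +
   (p.1.1 == p.2.2)%:R * ev P (fun t => U p.1.2 p.2.1 t ^+ 2) +
   (p.1.1 == p.2.1)%:R * ev P (fun t => U p.1.2 p.2.2 t ^+ 2).
  have mU2 i k : mom P (fun t => U i k t ^+ 2) by exact: momX.
  have mZU b i k : mom P (fun t => b * U i k t ^+ 2) by exact: momZ.
  by rewrite !evD ?evZ//; repeat apply: momD.
have S2 (p : I * I) : ev P (B p.1 p.2) <= ((p.1.2 == p.2.2)%:R + (p.1.2 == p.2.1)%:R +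
   (p.1.1 == p.2.2)%:R + (p.1.1 == p.2.1)%:R) * (2 * wK).
  by rewrite S1 !(mulrDl _ _ (2 * wK)) !lerD// ler_wpM2l// ev_U; apply: D.
apply: le_trans (ler_sum _ (fun p _ => S2 p)) _.
rewrite -big_distrl/= (_ : 8 * n%:R ^+ 3 * wK = (4 * n%:R ^+ 3) * (2 * wK)); last by ring.
apply: ler_wpM2r; first by rewrite mulr_ge0.
rewrite sum_pair (eq_bigr (fun=> 4 * n%:R)); last first.
  move=> -[i j] _; rewrite sum_pair/=.
  have s1 (a : 'I_n) : \sum_(l < n) (a == l)%:R = 1 :> R.
    by have := sum_delta a (fun=> 1); under eq_bigr do rewrite mulr1.
  have s2 (a : 'I_n) : \sum_(k < n) \sum_(l < n) (a == l)%:R = n%:R :> R.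
    by rewrite (eq_bigr (fun=> 1)) ?sumr_const ?card_ord.
  have s3 (a : 'I_n) : \sum_(k < n) \sum_(l < n) (a == k)%:R = n%:R :> R.
    by rewrite exchange_big/= s2.
  under eq_bigr do rewrite !big_split/=.
  by rewrite !big_split/= !s2 !s3; ring.
rewrite sumr_const -[leLHS]mulr_natr card_prod card_ord natrM le_eqVlt; apply/orP; left; apply/eqP; ring.
Qed.

End Wishart.

(** * Sums of correlations *)

Section Young.
Context {R : realType}.

(** Lagrange's identity: the defect is half a double sum of squares. *)
Lemma sum_CauchySchwarz (K : finType) (f g : K -> R) :
  (\sum_k f k * g k) ^+ 2 <= (\sum_k f k ^+ 2) * (\sum_k g k ^+ 2).
Proof.
have h : \sum_k \sum_l (f k * g l - f l * g k) ^+ 2 =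
   2 * ((\sum_k f k ^+ 2) * (\sum_k g k ^+ 2) - (\sum_k f k * g k) ^+ 2).
  have E k l : (f k * g l - f l * g k) ^+ 2 =
     f k ^+ 2 * g l ^+ 2 + f l ^+ 2 * g k ^+ 2 - 2 * (f k * g k) * (f l * g l) by ring.
  under eq_bigr do under eq_bigr do rewrite E.
  under eq_bigr do rewrite sumrB big_split/= -!big_distrr/= -big_distrl/=.
  rewrite sumrB big_split/= -!big_distrl/= -!big_distrr/= -!mulrA.
  ring.
rewrite -subr_ge0 -(pmulr_rge0 _ (ltr0Sn R 1)) -h.
by apply: sumr_ge0 => k _; apply: sumr_ge0 => l _; exact: sqr_ge0.
Qed.

(* Young's inequality l^(4/3) * l^(4/3) -> l^2, squared and written for matrices;
   with |A| = w^3 the exponents become integers. *)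
Lemma wK_le m (A : 'I_m -> 'I_m -> R) S : (0 < m)%N -> (forall a b, A a b = A b a) ->
  (forall a, \sum_b `|A a b| `^ (4 / 3) <= S) -> wK A <= m%:R^-1 * S ^+ 3.
Proof.
move=> m0 symA hS.
pose w a b := `|A a b| `^ (3^-1).
have w0 a b : 0 <= w a b by exact: powR_ge0.
have w3 a b : w a b ^+ 3 = `|A a b|.
  by rewrite /w -powR_mulrn ?powR_ge0// -powRrM mulVf// powRr1.
have w4 a b : w a b ^+ 4 = `|A a b| `^ (4 / 3).
  by rewrite /w -powR_mulrn ?powR_ge0// -powRrM mulrC.
have symw a b : w a b = w b a by rewrite /w symA.
have hw a : \sum_b w a b ^+ 4 <= S by under eq_bigr do rewrite w4.
have S0 : 0 <= S.
  by apply: le_trans (hw (Ordinal m0)); apply: sumr_ge0 => b _; rewrite exprn_ge0.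
have sq a e : (\sum_b A a b * A b e) ^+ 2 <= S * \sum_b (w a b ^+ 4 * w b e ^+ 4).
  (* The split w^3 = w^2 w makes Cauchy-Schwarz produce w^4 w^4, to be summed later, and w^2 w^2,
     which is at most the mean of the two w^4 and hence sums to at most S. *)
  have h1 : (\sum_b A a b * A b e) ^+ 2 <= (\sum_b (w a b ^+ 2 * w b e ^+ 2) * (w a b * w b e)) ^+ 2.
    rewrite -[X in X <= _]real_normK ?num_real// lerXn2r ?nnegrE//.
      by apply: sumr_ge0 => b _; rewrite !mulr_ge0.
    apply: le_trans (ler_norm_sum _ _ _) _; apply: ler_sum => b _.
    by rewrite normrM -!w3 le_eqVlt; apply/orP; left; apply/eqP; ring.
  apply: le_trans h1 _; apply: le_trans (sum_CauchySchwarz _ _) _.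
  rewrite mulrC; apply: ler_pM.
  - by apply: sumr_ge0 => b _; exact: sqr_ge0.
  - by apply: sumr_ge0 => b _; exact: sqr_ge0.
  - apply: (@le_trans _ _ (\sum_b (w a b ^+ 4 + w e b ^+ 4) / 2)).
      apply: ler_sum => b _; rewrite (symw e) -subr_ge0.
      rewrite (_ : _ - _ = (w a b ^+ 2 - w b e ^+ 2) ^+ 2 / 2); last by field.
      by rewrite divr_ge0 ?sqr_ge0.
    rewrite -big_distrl/= big_split/= ler_pdivrMr// mulr_natr mulr2n.
    exact: lerD.
  - by apply: ler_sum => b _; rewrite le_eqVlt; apply/orP; left; apply/eqP; ring.
rewrite /wK; apply: (@le_trans _ _ (m%:R^-1 ^+ 2 * (m%:R * S ^+ 3))); last first.
  rewrite le_eqVlt; apply/orP; left; apply/eqP; field.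
  by rewrite pnatr_eq0 -lt0n.
apply: ler_wpM2l; first exact: sqr_ge0.
apply: (@le_trans _ _ (\sum_a \sum_e S * \sum_b (w a b ^+ 4 * w b e ^+ 4))).
  by apply: ler_sum => a _; apply: ler_sum => e _; exact: sq.
under eq_bigr do rewrite -big_distrr/= exchange_big/=.
rewrite -big_distrr/= exchange_big/= exprS mulrCA; apply: ler_wpM2l => //.
apply: (@le_trans _ _ (\sum_(b < m) S ^+ 2)); last first.
  by rewrite sumr_const card_ord mulr_natl.
apply: ler_sum => b _.
under eq_bigr do rewrite -big_distrr/=.
rewrite -big_distrl/= expr2; apply: ler_pM => //.
- by apply: sumr_ge0 => a _; rewrite exprn_ge0.
- by apply: sumr_ge0 => a _; rewrite exprn_ge0.
- by under eq_bigr do rewrite symw.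
Qed.

End Young.

Section IntSums.
Context {R : realType}.
Implicit Type f : int -> R.

Fixpoint int_seq (d : nat) : seq int :=
  if d is d'.+1 then [:: d%:Z, - d%:Z & int_seq d'] else [:: 0].

Lemma mem_int_seq d k : (k \in int_seq d) = (`|k| <= d%:Z).
Proof.
elim: d => [|d ih]; first by rewrite inE normr_le0.
rewrite /= !inE ih; apply/idP/idP; lia.
Qed.

Lemma uniq_int_seq d : uniq (int_seq d).
Proof.
elim: d => //= d ->; rewrite !inE !mem_int_seq andbT; apply/andP; split; lia.
Qed.

Lemma int_le_seq d : int_le d = [set` int_seq d].
Proof. by apply/seteqP; split=> k /=; rewrite mem_int_seq. Qed.

Lemma finite_int_le d : finite_set (int_le d).
Proof. by rewrite int_le_seq; exact: finite_seq. Qed.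

Lemma sum_int_le f d : \sum_(k \in int_le d) f k =
  f 0 + \sum_(j < d) (f j.+1%:Z + f (- j.+1%:Z)).
Proof.
rewrite int_le_seq -fsbig_seq ?uniq_int_seq//.
elim: d => [|d ih]; first by rewrite big_seq1 big_ord0 addr0.
by rewrite /= !big_cons ih big_ord_recr/=; ring.
Qed.

(** Bordering the matrix by one row and one column adds each difference of absolute value at most d
    exactly once. The end terms |k| = d have weight zero, so the closed window is harmless. *)
Lemma sum_toeplitz f d : \sum_(a < d) \sum_(b < d) f (a%:Z - b%:Z) =
  \sum_(k \in int_le d) (d%:R - `|k|%:~R) * f k.
Proof.
rewrite sum_int_le.
under [X in _ + X]eq_bigr do rewrite normrN -mulrDr.
elim: d => [|d ih]; first by rewrite !big_ord0 normr0 subr0 mul0r addr0.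
rewrite big_ord_recr/= [X in _ + X]big_ord_recr/= subrr.
under eq_bigr do rewrite big_ord_recr/=.
rewrite big_split/= ih big_ord_recr/=.
have E : \sum_(i < d) f (i%:Z - d%:Z) + \sum_(i < d) f (d%:Z - i%:Z) =
    \sum_(j < d) (f j.+1%:Z + f (- j.+1%:Z)).
  rewrite addrC -big_split/= (reindex_inj rev_ord_inj)/=; apply: eq_bigr => j _.
  have -> : d%:Z - (d - j.+1)%N%:Z = j.+1%:Z by have := ltn_ord j; lia.
  by have -> : (d - j.+1)%N%:Z - d%:Z = - j.+1%:Z by have := ltn_ord j; lia.
rewrite -addrA [X in _ + X]addrA E normr0 !subr0 -natr1 !gtr0_norm ?ltr0n//.
have -> : \sum_(i < d) (d%:R + 1 - `|i.+1%:Z|%:~R) * (f i.+1 + f (- i.+1%:Z)) =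
  \sum_(i < d) (d%:R - `|i.+1%:Z|%:~R) * (f i.+1 + f (- i.+1%:Z)) + \sum_(j < d) (f j.+1%:Z + f (- j.+1%:Z)).
  by rewrite -big_split/=; apply: eq_bigr => i _; ring.
rewrite (_ : d.+1%:~R = d%:R + 1 :> R) ?natr1//; ring.
Qed.

(** Row a visits each difference from a - d + 1 to a once, and all of them lie in the window. *)
Lemma sum_row_le f d (a : 'I_d) : (forall k, 0 <= f k) ->
  \sum_(b < d) f (a%:Z - b%:Z) <= \sum_(k \in int_le d) f k.
Proof.
move=> f0; rewrite sum_int_le big_split/=.
have [e de] : exists e, d = (a + e.+1)%N.
  by exists (d - a.+1)%N; have := ltn_ord a; lia.
move: (nat_of_ord a) de => {a} a ->.
rewrite [leLHS]big_split_ord/= [X in _ <= _ + (X + _)]big_split_ord/=.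
have -> : \sum_(i < a) f (a%:Z - i%:Z) = \sum_(i < a) f i.+1.
  rewrite (reindex_inj rev_ord_inj)/=; apply: eq_bigr => i _.
  by congr f; have := ltn_ord i; lia.
have -> : \sum_(i < e.+1) f (a%:Z - (a + i)%N%:Z) = f 0 + \sum_(i < e) f (- i.+1%:Z).
  rewrite big_ord_recl/=; congr (f _ + _); first by lia.
  by apply: eq_bigr => i _; congr f; rewrite /bump/=; lia.
have -> : (a + e.+1 = e + a.+1)%N by lia.
rewrite [X in _ <= _ + (_ + X)]big_split_ord/=.
have p1 : 0 <= \sum_(i < e.+1) f (a + i).+1 by exact: sumr_ge0.
have p2 : 0 <= \sum_(i < a.+1) f (- (e + i).+1%:Z) by exact: sumr_ge0.
lra.
Qed.

(** The left side is the gap between the limiting variance and that of the Wishart entries; square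
    summability makes the [fine] of the infinite sums additive. *)
Lemma ell2_split (s : int -> R) d : (0 < d)%N -> ell2 s ->
  ell2_norm s ^+ 2 - \sum_(k \in int_le d) (1 - `|k|%:~R / d%:R) * s k ^+ 2 =
  fine (\esum_(k in int_gt d) (s k ^+ 2)%:E) +
             d%:R^-1 * \sum_(k \in int_le d) (`|k|%:~R * s k ^+ 2).
Proof.
move=> d0 hs.
have s0 (A : set int) k : A k -> (0 <= (s k ^+ 2)%:E)%E by rewrite lee_fin sqr_ge0.
have fin : (\esum_(k in [set: int]) (s k ^+ 2)%:E)%E \is a fin_num.
  move: hs; rewrite /ell2 summableE; congr (_ \is a fin_num); apply: eq_esum => k _.
  by rewrite gee0_abs// lee_fin sqr_ge0.
rewrite /ell2_norm sqr_sqrtr; last by apply: fine_ge0; apply: esum_ge0; exact: s0.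
rewrite (esumID (int_le d)) in fin *; last exact: s0.
rewrite !setTI (_ : ~` int_le d = int_gt d) in fin *; last first.
  by apply/seteqP; split=> k /=; rewrite /int_le/int_gt/=; lia.
move: fin; rewrite fin_numD => /andP[f1 f2].
rewrite fineD// esum_fset; [|exact: finite_int_le|by move=> k _; exact: (s0 setT)].
rewrite fsumEFin; last exact: finite_int_le.
rewrite [fine _%:E]/=.
have -> : \sum_(k \in int_le d) s k ^+ 2 = \sum_(k \in int_le d) ((1 - `|k|%:~R / d%:R) * s k ^+ 2) +
    d%:R^-1 * \sum_(k \in int_le d) (`|k|%:~R * s k ^+ 2).
  rewrite !int_le_seq -!fsbig_seq ?uniq_int_seq// big_distrr/= -big_split/=; apply: eq_bigr => k _.
  by field; rewrite pnatr_eq0 -lt0n.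
ring.
Qed.

End IntSums.

(** * Wasserstein distance *)

Section WassersteinBound.
Context {R : realType} {n : nat} {dT dU : measure_display}
  {T : measurableType dT} {U : measurableType dU}.
Notation I := ('I_n * 'I_n)%type.
Variables (P : probability T R) (Q : probability U R).

Definition mxof (x : I -> R) : 'M[R]_n := \matrix_(i, j) x (i, j).

Lemma hs_norm_mxof (x y : I -> R) : hs_norm (mxof x - mxof y) = nrm (fun p => x p - y p).
Proof.
rewrite /hs_norm /nrm sum_pair; congr Num.sqrt; apply: eq_bigr => i _; apply: eq_bigr => j _.
by rewrite !mxE.
Qed.

Lemma lip_norm_lip1 (g : 'M[R]_n -> R) : (lip_norm g <= 1)%E -> lip1 (fun x => g (mxof x)).
Proof.
move=> hg x y; rewrite -hs_norm_mxof; have [->|ne] := eqVneq (mxof x) (mxof y).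
  by rewrite subrr normr0 sqrtr_ge0.
have : ((`|g (mxof x) - g (mxof y)| / hs_norm (mxof x - mxof y))%:E <= 1)%E.
  by apply: le_trans hg; apply: ereal_sup_ubound; exists (mxof x, mxof y).
rewrite lee_fin ler_pdivrMr ?mul1r// hs_norm_mxof lt_neqAle nrm_ge0 andbT eq_sym.
apply: contra_neq ne => /(congr1 (fun z => z ^+ 2)); rewrite sqr_nrm expr0n/= => /eqP.
rewrite psumr_eq0 => [/allP h|p _]; last exact: sqr_ge0.
apply/matrixP => i j; rewrite !mxE; apply/eqP; rewrite -subr_eq0 -sqrf_eq0.
by have := h (i, j); rewrite mem_index_enum => /(_ isT).
Qed.

Lemma d_Wass_le (F : I -> T -> R) (S : I -> U -> R) c :
  (forall p, mom P (F p)) -> (forall p, mom Q (S p)) ->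
  (forall g, lip1 g -> `|ev P (fun t => g (F^~ t)) - ev Q (fun t => g (S^~ t))| <= c) ->
  (d_Wass P Q (fun t => mxof (F^~ t)) (fun t => mxof (S^~ t)) <= c%:E)%E.
Proof.
move=> mF mS h; apply: ge_ereal_sup => _ [g /= /lip_norm_lip1 hg <-].
have hp := lip1_polylip hg.
rewrite (expectation_ev (mom_polylip mF hp)) (expectation_ev (mom_polylip mS hp)).
by rewrite -EFinB lee_fin; apply: le_trans (ler_norm _) (h _ hg).
Qed.

End WassersteinBound.

Lemma covariance_centered {R : realType} {d : measure_display} {T : measurableType d}
  (P : probability T R) (f g : T -> R) : mom P f -> mom P g -> ev P f = 0 -> ev P g = 0 ->
  covariance P f g = (ev P (fun t => f t * g t))%:E.
Proof.
move=> mf mg f0 g0; rewrite unlock (expectation_ev mf) (expectation_ev mg) f0 g0.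
rewrite -(expectation_ev (momM mf mg)); congr expectation.
by apply/funext => t; rewrite -[LHS]/((f t - 0) * (g t - 0)) !subr0.
Qed.

(** * The two comparison estimates *)

Section Comparison.
Context {R : realType} {n : nat}.
Notation I := ('I_n * 'I_n)%type.

(** The exact square is 2 n (n + 1). The inequality x^2 <= 2 x for x in {0, 1, 2} gives 4 n^2, which
    already fits the required constant. *)
Let nrm_delta2 : nrm (fun p : I * I => (p.1 == p.2)%:R + (p.1 == sw p.2)%:R : R) <=
  2 * Num.sqrt (n%:R * (n%:R + 1)).
Proof.
have -> : (2 : R) = Num.sqrt 4 by rewrite (_ : 4 = 2 ^+ 2 :> R) ?sqrtr_sqr ?ger0_norm//; ring.
rewrite -sqrtrM// ler_sqrt ?mulr_ge0 ?addr_ge0// sum_pair/=.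
apply: (@le_trans _ _ (\sum_(p : I) \sum_(q : I) 2 * ((p == q)%:R + (p == sw q)%:R))).
  apply: ler_sum => p _; apply: ler_sum => q _.
  by case: eqP; case: eqP => _ _ /=; lra.
rewrite (eq_bigr (fun=> 4)) => [|p _].
  rewrite sumr_const card_prod card_ord -[leLHS]mulr_natr natrM ler_wpM2l//.
  by rewrite mulrDr lerDl mulr1.
rewrite -big_distrr/= big_split/=.
have s1 (a : I) : \sum_q (a == q)%:R = 1 :> R.
  by have := sum_delta a (fun=> 1 : R); under eq_bigr do rewrite mulr1.
rewrite s1 (reindex_inj (inv_inj (@swK n)))/=; under eq_bigr do rewrite swK.
by rewrite s1; ring.
Qed.

Let mxact_symcov_sw c (x : I -> R) : (forall p, x (sw p) = x p) ->
  mxact (symcov c) x = fun p => 2 * c * x p.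
Proof. by move=> hx; rewrite mxact_symcov; apply/funext => p; rewrite hx; ring. Qed.

Let symcov_sw c (p q : I) : symcov c p (sw q) = symcov c p q :> R.
Proof. by rewrite /symcov swK addrC. Qed.

Let sqrt2_div (c : R) : 0 < c -> Num.sqrt 2 / Num.sqrt (2 * c) = (Num.sqrt c)^-1.
Proof.
move=> c0; have q2 : Num.sqrt (2 : R) != 0 by rewrite gt_eqF// sqrtr_gt0.
have qc : Num.sqrt c != 0 by rewrite gt_eqF// sqrtr_gt0.
by rewrite sqrtrM// invfM mulrA divff// mul1r.
Qed.

Context {dT dU : measure_display} {T : measurableType dT} {U : measurableType dU}.
Variables (P : probability T R) (Q : probability U R).

(** Gaussian integration by parts says that F satisfies the Stein identity with the constant matrix
    tau = [symcov c1]; the deviation is then (c2 - c1) times a fixed matrix. *)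
Lemma gauss_compare (F : I -> T -> R) (S : I -> U -> R) c1 c2 : 0 < c2 ->
  gaussv P F (symcov c1) -> gaussv Q S (symcov c2) ->
  (d_Wass P Q (fun t => mxof (F^~ t)) (fun t => mxof (S^~ t)) <=
    (2 * Num.sqrt (n%:R * (n%:R + 1)) / Num.sqrt c2 * `|c2 - c1|)%:E)%E.
Proof.
move=> c20 gF gS; apply: d_Wass_le; [exact: gF.1|exact: gS.1|move=> g hg].
have k0 : 0 < 2 * c2 by rewrite mulr_gt0.

have := @stein_compare _ _ _ _ _ _ P Q F S (symcov c2) (2 * c2) (fun _ => symcov c1) gS (@symcov_sym _ _ c2) k0.
move=> /(_ (fun a => mxact_symcov_sw c2 (symcov_sw c2 a)) gF.1 (fun a b => mom_cst _)).
move=> /(_ (fun _ => @symcov_sym _ _ c1) (fun _ a => mxact_symcov_sw c2 (symcov_sw c1 a))).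
move=> H; apply: le_trans (H _ g hg) _ => [xi phi|].
  rewrite (gauss_ibp gF (@symcov_sym _ _ c1)) evZ ?gF.2//.
  by apply: mom_cos; apply: (@mom_meas _ _ _ P); apply: momD; [apply: mom_dot; exact: gF.1|exact: mom_cst].
rewrite ev_cst (_ : hsn _ = `|c2 - c1| * nrm (fun p : I * I => (p.1 == p.2)%:R + (p.1 == sw p.2)%:R : R)); last first.
  by rewrite /hsn -nrmZ; congr nrm; apply/funext => p; rewrite /symcov; ring.
rewrite sqrt2_div//.
rewrite [leRHS]mulrC mulrCA; apply: ler_wpM2l => //.
by rewrite mulrC; apply: ler_wpM2r => //; rewrite invr_ge0 sqrtr_ge0.
Qed.

Lemma wish_compare m (X : 'I_n * 'I_m -> T -> R) (A : 'I_m -> 'I_m -> R) (S : I -> U -> R) :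
  gaussv P X (rowcov A) -> (forall a b, A a b = A b a) -> (forall a, A a a = 1) ->
  (0 < m)%N -> 0 < wsig A -> gaussv Q S (symcov (wsig A)) ->
  (d_Wass P Q (fun t => mxof (fun p => wish X p t)) (fun t => mxof (S^~ t)) <=
    (Num.sqrt (8 * n%:R ^+ 3 / wsig A * wK A))%:E)%E.
Proof.
move=> gX symA A1 m0 sig0 gS; apply: d_Wass_le; [exact: (mom_wish gX)|exact: gS.1|move=> g hg].
have k0 : 0 < 2 * wsig A by rewrite mulr_gt0.

have := @stein_compare _ _ _ _ _ _ P Q (wish X) S (symcov (wsig A)) (2 * wsig A) (wtau X A) gS (@symcov_sym _ _ _) k0.
move=> /(_ (fun a => mxact_symcov_sw _ (symcov_sw _ a)) (mom_wish gX) (mom_wtau gX)).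
move=> /(_ (wtau_sym X symA) (fun t a => mxact_symcov_sw _ (wtau_sw X A t a)) (wish_stein gX symA A1 m0) g hg).
move=> H; apply: le_trans H _.
apply: le_trans (ler_wpM2l _ (wtau_dev gX symA)) _; first by rewrite divr_ge0// sqrtr_ge0.
rewrite sqrt2_div//.
by rewrite -sqrtrV -?sqrtrM ?invr_ge0 ?(ltW sig0)// mulrC mulrAC.
Qed.

End Comparison.

Theorem theorem1p2 (R : realType) (s : int -> R)
    (hs : correlation_function s) (hs0 : s 0 = 1)
    (dT : measure_display) (T : measurableType dT) (P : probability T R)
    (X : nat -> nat -> {RV P >-> R}) (hX : gaussian_array P s X)
    (n d : nat) (hn : (1 <= n)%N) (hd : (1 <= d)%N)
    (dU : measure_display) (U : measurableType dU) (Q : probability U R)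
    (G : 'M[{RV Q >-> R}]_n) (hGsym : G^T = G)
    (hGgauss : jointly_gaussian Q (fun ij : 'I_n * 'I_n => G ij.1 ij.2))
    (hGcent : centered Q (fun ij : 'I_n * 'I_n => G ij.1 ij.2))
    (hGcov : forall i j k l : 'I_n,
        covariance Q (G i j) (G k l) =
        covariance P (fun t => wishart X n d t i j)
                     (fun t => wishart X n d t k l)) :
  [/\ (d_Wass P Q (wishart X n d) (realization G) <=
        (Num.sqrt (192 * n%:R ^+ 3 /
             (\sum_(k \in int_le d) (1 - `|k|%:~R / d%:R) * s k ^+ 2)
           * (d%:R^-1 * (\sum_(k \in int_le d) `|s k| `^ (4 / 3)) ^+ 3)))%:E)%E,
      Num.sqrt (192 * n%:R ^+ 3 /
           (\sum_(k \in int_le d) (1 - `|k|%:~R / d%:R) * s k ^+ 2)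
         * (d%:R^-1 * (\sum_(k \in int_le d) `|s k| `^ (4 / 3)) ^+ 3)) <=
      Num.sqrt (192 * n%:R ^+ 3 / d%:R
         * (\sum_(k \in int_le d) `|s k| `^ (4 / 3)) ^+ 3) &
      ell2 s ->
      forall (dV : measure_display) (V : measurableType dV)
        (P' : probability V R) (Z : 'M[{RV P' >-> R}]_n),
        Z^T = Z ->
        (forall i : 'I_n, has_normal_law P' (Z i i) 0 (2 * ell2_norm s ^+ 2)) ->
        (forall i j : 'I_n, (i < j)%N ->
          has_normal_law P' (Z i j) 0 (ell2_norm s ^+ 2)) ->
        mutually_independent P' [set ij : 'I_n * 'I_n | (ij.1 <= ij.2)%N]
          (fun ij => Z ij.1 ij.2) ->
        (d_Wass Q P' (realization G) (realization Z) <=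
          (2 * Num.sqrt (n%:R * (n%:R + 1)) / ell2_norm s *
            (fine (\esum_(k in int_gt d) (s k ^+ 2)%:E) +
             d%:R^-1 * \sum_(k \in int_le d) (`|k|%:~R * s k ^+ 2)))%:E)%E].
Proof.
case: hX => jgX cX eX.
pose X' (p : 'I_n * 'I_d) : T -> R := X p.1 p.2.
pose A (a b : 'I_d) := s (a%:Z - b%:Z).
have mX i j : mom P (X i j) := jointly_gaussian_mom jgX (i, j).
have evX i j i' j' : ev P (fun t => X i j t * X i' j' t) = (i == i')%:R * s (j%:Z - j'%:Z).
  have := eX i j i' j'; rewrite expectation_ev; last exact: momM.
  by case.
(* Evenness of s is read off the covariances of row 0 of the array. *)
have symA a b : A a b = A b a.
  have := evX 0%N a 0%N b; have := evX 0%N b 0%N a; rewrite !mul1r /A => <- <-.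
  by congr ev; apply/funext => t; rewrite mulrC.
have A1 a : A a a = 1 by rewrite /A subrr.
have gX : gaussv P X' (rowcov A).
  have := jointly_gaussian_gaussv (fun p : 'I_n * 'I_d => (nat_of_ord p.1, nat_of_ord p.2)) jgX cX.
  congr (gaussv P _ _); apply/funext => p; apply/funext => q.
  by rewrite evX /rowcov /A.
have d0 : d%:R != 0 :> R by rewrite pnatr_eq0 -lt0n.
have dgt0 : 0 < d%:R :> R by rewrite ltr0n.
have sigE : wsig A = \sum_(k \in int_le d) (1 - `|k|%:~R / d%:R) * s k ^+ 2.
  rewrite /wsig /A (sum_toeplitz (fun k => s k ^+ 2)) int_le_seq -!fsbig_seq ?uniq_int_seq//.
  by rewrite big_distrr/=; apply: eq_bigr => k _; field.
(* The diagonal terms s(0)^2 = 1 alone contribute 1. This gives both nondegeneracy and the second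
   inequality of the theorem. *)
have sig1 : 1 <= wsig A.
  rewrite /wsig ler_pdivlMl// mulr1 -[d in d%:R]card_ord -sumr_const.
  apply: ler_sum => a _; rewrite (bigD1 a)//= A1 expr1n lerDl.
  by apply: sumr_ge0 => b _; exact: sqr_ge0.
have sig0 : 0 < wsig A by apply: lt_le_trans sig1.
pose S := \sum_(k \in int_le d) `|s k| `^ (4 / 3).
have S0 : 0 <= S.
  by rewrite /S int_le_seq -fsbig_seq ?uniq_int_seq//; apply: sumr_ge0 => k _; exact: powR_ge0.
have hK : wK A <= d%:R^-1 * S ^+ 3.
  apply: wK_le => // a.
  by apply: (sum_row_le a (fun k => powR_ge0 `|s k| (4 / 3))).
have WE : wishart X n d = fun t => mxof (fun p => wish X' p t).
  apply/funext => t; apply/matrixP => i j; rewrite /wishart /wish !mxE/= mulrBr.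
  congr (_ - _); rewrite mulrA; congr (_ * _).
    have q0 : Num.sqrt d%:R != 0 :> R by rewrite gt_eqF// sqrtr_gt0.
    by apply: (mulfI q0); rewrite divff// mulrA -expr2 sqr_sqrtr// divff.
  by apply: eq_bigr => k _; rewrite !mxE.
have WijE i j : (fun t => wishart X n d t i j) = wish X' (i, j).
  by rewrite WE; apply/funext => t; rewrite mxE.
have W0 p : ev P (wish X' p) = 0 by exact: (wish_mean gX symA A1 hd).
have GE : realization G = fun t => mxof (fun p => G p.1 p.2 t) by [].
have mG (p : 'I_n * 'I_n) : mom Q (G p.1 p.2) := jointly_gaussian_mom hGgauss p.
have G0 (p : 'I_n * 'I_n) : ev Q (G p.1 p.2) = 0.
  by have := hGcent p; rewrite expectation_ev//; case.
have gG : gaussv Q (fun p : 'I_n * 'I_n => G p.1 p.2) (symcov (wsig A)).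
  have := jointly_gaussian_gaussv (fun p : 'I_n * 'I_n => p) hGgauss hGcent.
  congr (gaussv Q _ _); apply/funext => p; apply/funext => q.
  have := hGcov p.1 p.2 q.1 q.2; rewrite !WijE -!surjective_pairing.
  rewrite covariance_centered// covariance_centered//; try exact: (mom_wish gX).
  by rewrite (wish_cov gX symA A1 hd) => -[].
split.
- rewrite WE GE; apply: le_trans (wish_compare gX symA A1 hd sig0 gG) _.
  rewrite lee_fin -sigE -/S ler_sqrt; last first.
    by rewrite !mulr_ge0// ?invr_ge0 ?exprn_ge0// ltW.
  have K0 : 0 <= wK A.
    by rewrite /wK mulr_ge0 ?sqr_ge0//; apply: sumr_ge0 => a _; apply: sumr_ge0 => b _; exact: sqr_ge0.
  apply: ler_pM => //; first by rewrite !mulr_ge0// ?invr_ge0 ?exprn_ge0// ltW.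
  apply: ler_wpM2r; first by rewrite invr_ge0 ltW.
  (* Here the constant 8 is relaxed to 192. *)
  by apply: ler_wpM2r; [rewrite exprn_ge0|rewrite ler_nat].
- rewrite -sigE -/S ler_sqrt; last first.
    by rewrite !mulr_ge0// ?invr_ge0 ?exprn_ge0.
  rewrite mulrA; apply: ler_wpM2r; first by rewrite exprn_ge0.
  apply: ler_wpM2r; first by rewrite invr_ge0.
  by rewrite ler_pdivrMr// ler_peMr// mulr_ge0 ?exprn_ge0.
move=> s2 dV V P' Z sZ Zii Zij indZ.
have D := ell2_split hd s2.
set D1 := fine _ + _ in D *.
have D10 : 0 <= D1.
  apply: addr_ge0; first by apply: fine_ge0; apply: esum_ge0 => k _; rewrite lee_fin sqr_ge0.
  rewrite mulr_ge0 ?invr_ge0// int_le_seq -fsbig_seq ?uniq_int_seq//; apply: sumr_ge0 => k _.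
  by rewrite mulr_ge0 ?sqr_ge0// ler0z.
(* The squared norm is [wsig A] + D1, with D1 the nonnegative bracket of the last estimate; D1 is
   also the difference of the two variance parameters. *)
have c0 : 0 < ell2_norm s ^+ 2.
  by rewrite -(subrK (wsig A) (ell2_norm s ^+ 2)) ltr_wpDl// sigE D.
have gZ := indep_sym_gaussv (ltW c0) sZ Zii Zij indZ.
have ZE : realization Z = fun t => mxof (fun p => Z p.1 p.2 t) by [].
rewrite GE ZE; apply: le_trans (gauss_compare c0 gG gZ) _.
rewrite sqrtr_sqr ger0_norm ?sqrtr_ge0// sigE D ger0_norm// lexx.
Qed.
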